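(* Let $J\subseteq I$. The open subset $Or(J)$ of $\overline{Or(J)}$, equipped with the restriction of the structure of a locally ringed space of $\overline{Or(J)}$, is a scheme.
   Context: Setting. $\mathbb F$ is a field of characteristic $0$. $A=(a_{ij})_{i,j\in I}$, $I=\{1,\dots,n\}$, is a symmetrizable generalized Cartan matrix of rank $l$. $H,P$ are dual free $\mathbb Z$-modules of rank $2n-l$ with dual bases $h_1,\dots,h_{2n-l}$ of $H$ and $\Lambda_1,\dots,\Lambda_{2n-l}$ of $P$, together with linearly independent $\alpha_1,\dots,\alpha_n\in P$ such that $\alpha_i(h_j)=a_{ji}$ ($i,j\in I$). $P^+=\{\Lambda\in P:\Lambda(h_i)\ge 0\ \forall i\in I\}$, $\mathfrak h=H\otimes\mathbb F$. For $J\subseteq I$, $\overline{F_J}=\{\lambda\in P\otimes\mathbb R:\lambda(h_i)=0\ (i\in J),\ \lambda(h_i)\ge0\ (i\in I\setminus J)\}$. $\mathfrak g$ is the Kac-Moody algebra over $\mathbb F$ generated by the abelian Lie algebra $\mathfrak h$ and $e_i,f_i$ ($i\in I$) with relations $[e_i,f_j]=\delta_{ij}h_i$, $[h,e_i]=\alpha_i(h)e_i$, $[h,f_i]=-\alpha_i(h)f_i$, $(\mathrm{ad}\,e_i)^{1-a_{ij}}e_j=(\mathrm{ad}\,f_i)^{1-a_{ij}}f_j=0$ ($i\ne j$). $L(\Lambda)$, $\Lambda\in P^+$, is the irreducible highest weight $\mathfrak g$-module with set of weights $P(\Lambda)$; $L(\Lambda)^{( * )}=\bigoplus_{\lambda\in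 P(\Lambda)}L(\Lambda)_\lambda^*$ is its restricted dual. Cartan algebra. Fix highest weight vectors $v_\Lambda\in L(\Lambda)_\Lambda\setminus\{0\}$. $CA=\bigoplus_{\Lambda\in P^+}L(\Lambda)^{( * )}$ is the $P^+$-graded commutative algebra (without zero divisors) whose product of $\phi\in L(\Lambda)^{( * )}$ and $\psi\in L(N)^{( * )}$ is $(\phi\otimes\psi)\circ\Phi\in L(\Lambda+N)^{( * )}$, where $\Phi:L(\Lambda+N)\to L(\Lambda)\otimes L(N)$ is the $\mathfrak g$-equivariant map with $\Phi(v_{\Lambda+N})=v_\Lambda\otimes v_N$. Projective spectra. For a commutative $\mathbb F$-algebra $R=\bigoplus_{\Lambda\in\mathcal M}R_\Lambda$ graded by a cancellative commutative monoid $\mathcal M$ with torsion-free group of differences and $\mathbb F1\subseteq R_0$, $\mathrm{Proj}(R)$ is the set of all $\mathcal M$-homogeneous prime ideals of $R$ (none excluded) with closed sets $\mathcal V(\mathfrak a)=\{Q:Q\supseteq\mathfrak a\}$, $\mathfrak a$ a homogeneous ideal. Its structure sheaf $\mathcal O_{\mathrm{Proj}(R)}$ is the sheafification of the presheaf which assigns to a nonempty open $U$ the $\mathbb F$-algebra of fractions $a/b$ with $a\in R_\Lambda$, $b\in\bigcap_{Q\in U}(R_\Lambda\setminus Q)$ for some $\Lambda\in\mathcal M$ (inside the localization of $R$ at the multiplicative set of homogeneous elements lying in no $Q\in U$), with restriction maps $a/b\mapsto a/b$; this makes $\mathrm{Proj}(R)$ a locally ringed space. Strata. For $J\subseteq I$,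 $\overline{Or(J)}:=\mathcal V\big(\bigoplus_{\Lambda\in P^+\setminus\overline{F_J}}L(\Lambda)^{( * )}\big)\subseteq\mathrm{Proj}(CA)$ and $Or(J):=\overline{Or(J)}\setminus\bigcup_{J\subsetneq K\subseteq I}\overline{Or(K)}$. The topological space $\overline{Or(J)}$ is identified with $\mathrm{Proj}\big(\bigoplus_{\Lambda\in P^+\cap\overline{F_J}}L(\Lambda)^{( * )}\big)$ (projective spectrum of a graded subalgebra of $CA$) by the homeomorphism $\mathrm{Proj}\big(\bigoplus_{\Lambda\in P^+\cap\overline{F_J}}L(\Lambda)^{( * )}\big)\to\overline{Or(J)}$, $Q\mapsto Q\oplus\bigoplus_{\Lambda\in P^+\setminus\overline{F_J}}L(\Lambda)^{( * )}$; by this identification $\overline{Or(J)}$ gets the structure of a locally ringed space of $\mathbb F$-algebras. *)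

(* Defs.v *)
From HB Require Import structures.
From mathcomp Require Import all_boot all_order all_algebra.
From mathcomp Require Import ring.
From mathcomp Require Import mathcomp_extra boolp classical_sets functions cardinality.
From mathcomp Require Import topology_structure initial_topology subtype_topology.

Set Implicit Arguments.
Unset Strict Implicit.
Unset Printing Implicit Defensive.

Import Order.TTheory GRing.Theory Num.Theory.
Local Open Scope classical_set_scope.
Local Open Scope quotient_scope.
Local Open Scope ring_scope.


Record setoid := Setoid {
  st_sort :> Type;
  st_eqv : st_sort -> st_sort -> Prop;
  st_refl : forall x, st_eqv x x;
  st_sym : forall x y, st_eqv x y -> st_eqv y x;
  st_trans : forall x y z, st_eqv x y -> st_eqv y z -> st_eqv x z }.

Section Quotient.
Variable T : setoid.

Definition st_rel (x y : {classic T}) : bool := `[< st_eqv x y >].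

Fact st_rel_refl : reflexive st_rel.
Proof. by move=> x; apply/asboolP/st_refl. Qed.
Fact st_rel_sym : symmetric st_rel.
Proof. by move=> x y; apply/asboolP/asboolP => /st_sym. Qed.
Fact st_rel_trans : transitive st_rel.
Proof. by move=> y x z /asboolP xy /asboolP yz; apply/asboolP/(st_trans xy). Qed.

Definition st_equiv := EquivRel st_rel st_rel_refl st_rel_sym st_rel_trans.
Definition quot := {eq_quot st_equiv}.
HB.instance Definition _ := Choice.on quot.

Definition cls (x : T) : quot := \pi_quot (x : {classic T}).
Definition rpr (q : quot) : T := repr q.

Lemma rprK q : cls (rpr q) = q. Proof. exact: reprK. Qed.
Lemma clsP x y : cls x = cls y <-> st_eqv x y.
Proof. by split=> [/eqquotP/asboolP|xy]; last exact/eqquotP/asboolP. Qed.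
Lemma rpr_cls x : st_eqv (rpr (cls x)) x.
Proof. by apply/clsP; rewrite rprK. Qed.
End Quotient.

(** Vector spaces and commutative rings given by representatives: the axioms
    hold up to the congruence, and [quot] is the resulting structure. *)

Record premodule (F : fieldType) := PreModule {
  pm_setoid :> setoid;
  pm0 : pm_setoid;
  pmD : pm_setoid -> pm_setoid -> pm_setoid;
  pmZ : F -> pm_setoid -> pm_setoid;
  pmD_eqv : forall x x' y y', st_eqv x x' -> st_eqv y y' ->
    st_eqv (pmD x y) (pmD x' y');
  pmZ_eqv : forall c x x', st_eqv x x' -> st_eqv (pmZ c x) (pmZ c x');
  pmDA : forall x y z, st_eqv (pmD x (pmD y z)) (pmD (pmD x y) z);
  pmDC : forall x y, st_eqv (pmD x y) (pmD y x);
  pm0D : forall x, st_eqv (pmD pm0 x) x;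
  pmND : forall x, st_eqv (pmD (pmZ (-1) x) x) pm0;
  pmZA : forall a b x, st_eqv (pmZ a (pmZ b x)) (pmZ (a * b) x);
  pm1Z : forall x, st_eqv (pmZ 1 x) x;
  pmZDr : forall a x y, st_eqv (pmZ a (pmD x y)) (pmD (pmZ a x) (pmZ a y));
  pmZDl : forall a b x, st_eqv (pmZ (a + b) x) (pmD (pmZ a x) (pmZ b x)) }.

Definition pm_quot F (M : premodule F) := quot M.

Section ModuleQuotient.
Context (F : fieldType) (M : premodule F).
Local Notation Q := (pm_quot M).
HB.instance Definition _ := Choice.on Q.

Definition mqD (x y : Q) : Q := cls (pmD (rpr x) (rpr y)).
Definition mqZ c (x : Q) : Q := cls (pmZ c (rpr x)).
Definition mq0 : Q := cls (pm0 M).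

Lemma mqDE x y : mqD (cls x) (cls y) = cls (pmD x y).
Proof. by apply/clsP/pmD_eqv; apply: rpr_cls. Qed.
Lemma mqZE c x : mqZ c (cls x) = cls (pmZ c x).
Proof. by apply/clsP/pmZ_eqv/rpr_cls. Qed.

Fact mqDA : associative mqD.
Proof.
move=> x y z; rewrite -(rprK x) -(rprK y) -(rprK z) !mqDE.
exact/clsP/pmDA.
Qed.
Fact mqDC : commutative mqD.
Proof. by move=> x y; apply/clsP/pmDC. Qed.
Fact mq0D : left_id mq0 mqD.
Proof. by move=> x; rewrite -(rprK x) mqDE; apply/clsP/pm0D. Qed.
Fact mqND : left_inverse mq0 (mqZ (-1)) mqD.
Proof. by move=> x; rewrite -(rprK x) mqZE mqDE; apply/clsP/pmND. Qed.
HB.instance Definition _ := GRing.isZmodule.Build Q mqDA mqDC mq0D mqND.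

Fact mqZA a b x : mqZ a (mqZ b x) = mqZ (a * b) x.
Proof. by rewrite -(rprK x) !mqZE; apply/clsP/pmZA. Qed.
Fact mq1Z : left_id 1 mqZ.
Proof. by move=> x; rewrite -(rprK x) mqZE; apply/clsP/pm1Z. Qed.
Fact mqZDr : right_distributive mqZ +%R.
Proof.
move=> a x y; rewrite -(rprK x) -(rprK y) [_ + _]mqDE !mqZE [RHS]mqDE.
exact/clsP/pmZDr.
Qed.
Fact mqZDl x : {morph mqZ^~ x : a b / a + b}.
Proof.
by move=> a b; rewrite -(rprK x) !mqZE [RHS]mqDE; apply/clsP/pmZDl.
Qed.
HB.instance Definition _ :=
  GRing.Zmodule_isLmodule.Build F Q mqZA mq1Z mqZDr mqZDl.
End ModuleQuotient.

Record prering := PreRing {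
  pr_setoid :> setoid;
  pr0 : pr_setoid;
  pr1 : pr_setoid;
  prN : pr_setoid -> pr_setoid;
  prD : pr_setoid -> pr_setoid -> pr_setoid;
  prM : pr_setoid -> pr_setoid -> pr_setoid;
  prN_eqv : forall x x', st_eqv x x' -> st_eqv (prN x) (prN x');
  prD_eqv : forall x x' y y', st_eqv x x' -> st_eqv y y' ->
    st_eqv (prD x y) (prD x' y');
  prM_eqv : forall x x' y y', st_eqv x x' -> st_eqv y y' ->
    st_eqv (prM x y) (prM x' y');
  prDA : forall x y z, st_eqv (prD x (prD y z)) (prD (prD x y) z);
  prDC : forall x y, st_eqv (prD x y) (prD y x);
  pr0D : forall x, st_eqv (prD pr0 x) x;
  prND : forall x, st_eqv (prD (prN x) x) pr0;
  prMA : forall x y z, st_eqv (prM x (prM y z)) (prM (prM x y) z);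
  prMC : forall x y, st_eqv (prM x y) (prM y x);
  pr1M : forall x, st_eqv (prM pr1 x) x;
  prMDl : forall x y z, st_eqv (prM (prD x y) z) (prD (prM x z) (prM y z)) }.

Definition pr_quot (A : prering) := quot A.

Section RingQuotient.
Variable A : prering.
Local Notation Q := (pr_quot A).
HB.instance Definition _ := Choice.on Q.

Definition rq0 : Q := cls (pr0 A).
Definition rq1 : Q := cls (pr1 A).
Definition rqN (x : Q) : Q := cls (prN (rpr x)).
Definition rqD (x y : Q) : Q := cls (prD (rpr x) (rpr y)).
Definition rqM (x y : Q) : Q := cls (prM (rpr x) (rpr y)).

Lemma rqNE x : rqN (cls x) = cls (prN x).
Proof. by apply/clsP/prN_eqv/rpr_cls. Qed.
Lemma rqDE x y : rqD (cls x) (cls y) = cls (prD x y).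
Proof. by apply/clsP/prD_eqv; apply: rpr_cls. Qed.
Lemma rqME x y : rqM (cls x) (cls y) = cls (prM x y).
Proof. by apply/clsP/prM_eqv; apply: rpr_cls. Qed.

Fact rqDA : associative rqD.
Proof.
move=> x y z; rewrite -(rprK x) -(rprK y) -(rprK z) !rqDE.
exact/clsP/prDA.
Qed.
Fact rqDC : commutative rqD.
Proof. by move=> x y; apply/clsP/prDC. Qed.
Fact rq0D : left_id rq0 rqD.
Proof. by move=> x; rewrite -(rprK x) rqDE; apply/clsP/pr0D. Qed.
Fact rqND : left_inverse rq0 rqN rqD.
Proof. by move=> x; rewrite -(rprK x) rqNE rqDE; apply/clsP/prND. Qed.
HB.instance Definition _ := GRing.isZmodule.Build Q rqDA rqDC rq0D rqND.

Fact rqMA : associative rqM.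
Proof.
move=> x y z; rewrite -(rprK x) -(rprK y) -(rprK z) !rqME.
exact/clsP/prMA.
Qed.
Fact rqMC : commutative rqM.
Proof. by move=> x y; apply/clsP/prMC. Qed.
Fact rq1M : left_id rq1 rqM.
Proof. by move=> x; rewrite -(rprK x) rqME; apply/clsP/pr1M. Qed.
Fact rqMDl : left_distributive rqM +%R.
Proof.
move=> x y z; rewrite -(rprK x) -(rprK y) -(rprK z) [_ + _]rqDE !rqME [RHS]rqDE.
exact/clsP/prMDl.
Qed.
HB.instance Definition _ :=
  GRing.Zmodule_isComPzRing.Build Q rqMA rqMC rq1M rqMDl.

Lemma pr_quotN x : - (cls x : Q) = cls (prN x). Proof. exact: rqNE. Qed.
Lemma pr_quotD x y : (cls x : Q) + cls y = cls (prD x y).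
Proof. exact: rqDE. Qed.
Lemma pr_quotM x y : (cls x : Q) * cls y = cls (prM x y).
Proof. exact: rqME. Qed.
End RingQuotient.

Section KacMoodyData.
Context (n k : nat).

Definition is_gcm (A : 'M[int]_n) : Prop :=
  [/\ forall i, A i i = 2,
      forall i j, i != j -> A i j <= 0 &
      forall i j, A i j = 0 -> A j i = 0].

Definition symmetrizable (A : 'M[int]_n) : Prop :=
  exists (d : 'rV[rat]_n) (B : 'M[rat]_n),
    [/\ forall i, d 0 i != 0, B^T = B &
        map_mx intr A = diag_mx d *m B].

(** A weight in [P] is the row of its coordinates in the basis [Lambda_1, ...],
    an element of [H] (or of [H ⊗ F]) the row of its coordinates in the dual
    basis [h_1, ...]; [h_i] for [i] in [I] is the basis vector of index
    [lshift k i]. *)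
Definition weight_eval (F : fieldType) (la : 'rV[int]_(n + k))
  (h : 'rV[F]_(n + k)) : F := \sum_j (la 0 j)%:~R * h 0 j.

Definition coroot (F : fieldType) (i : 'I_n) : 'rV[F]_(n + k) :=
  delta_mx 0 (lshift k i).

Definition at_coroot (la : 'rV[int]_(n + k)) (i : 'I_n) : int :=
  la 0 (lshift k i).

Definition is_simple_roots (A : 'M[int]_n) (alpha : 'I_n -> 'rV[int]_(n + k)) :=
  (forall i j, at_coroot (alpha i) j = A j i) /\
  (forall c : 'I_n -> int, \sum_i c i *: alpha i = 0 -> forall i, c i = 0).

Definition Pplus : set 'rV[int]_(n + k) :=
  [set la | forall i, 0 <= at_coroot la i].

(** The intersection with [P] of the closed face of [J]; it lies in [Pplus]. *)
Definition face (J : {set 'I_n}) : set 'rV[int]_(n + k) :=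
  [set la | (forall i, i \in J -> at_coroot la i = 0) /\
            (forall i, i \notin J -> 0 <= at_coroot la i)].
End KacMoodyData.

Record lie_algebra (F : fieldType) := LieAlgebra {
  la_sort :> lmodType F;
  la_br : la_sort -> la_sort -> la_sort;
  la_brPl : forall c x y z, la_br (c *: x + y) z = c *: la_br x z + la_br y z;
  la_brPr : forall c x y z, la_br z (c *: x + y) = c *: la_br z x + la_br z y;
  la_brxx : forall x, la_br x x = 0;
  la_jacobi : forall x y z,
    la_br x (la_br y z) + la_br y (la_br z x) + la_br z (la_br x y) = 0 }.

Record lie_module (F : fieldType) (g : lie_algebra F) := LieModule {
  lm_sort :> lmodType F;
  lm_act : g -> lm_sort -> lm_sort;
  lm_actPl : forall c x y v,
    lm_act (c *: x + y) v = c *: lm_act x v + lm_act y v;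
  lm_actPr : forall c x v w,
    lm_act x (c *: v + w) = c *: lm_act x v + lm_act x w;
  lm_act_br : forall x y v,
    lm_act (la_br x y) v = lm_act x (lm_act y v) - lm_act y (lm_act x v) }.

Definition is_submodule (F : fieldType) (g : lie_algebra F) (V : lie_module g)
    (W : set V) : Prop :=
  [/\ W 0, forall c v w, W v -> W w -> W (c *: v + w) &
      forall x v, W v -> W (lm_act x v)].

Definition is_lie_hom (F : fieldType) (g : lie_algebra F)
    (V W : lie_module g) (f : V -> W) : Prop :=
  (forall c v w, f (c *: v + w) = c *: f v + f w) /\
  (forall x v, f (lm_act x v) = lm_act x (f v)).

Section Tensor.
Context (F : fieldType) (g : lie_algebra F) (V W : lie_module g).

Inductive tens_term : Type :=
| Tpure of V & W | Tzero | Tadd of tens_term & tens_term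
| Tscale of F & tens_term.

Inductive tens_eqv : tens_term -> tens_term -> Prop :=
| te_refl x : tens_eqv x x
| te_sym x y : tens_eqv x y -> tens_eqv y x
| te_trans x y z : tens_eqv x y -> tens_eqv y z -> tens_eqv x z
| te_add x x' y y' : tens_eqv x x' -> tens_eqv y y' ->
    tens_eqv (Tadd x y) (Tadd x' y')
| te_scale c x x' : tens_eqv x x' -> tens_eqv (Tscale c x) (Tscale c x')
| te_addA x y z : tens_eqv (Tadd x (Tadd y z)) (Tadd (Tadd x y) z)
| te_addC x y : tens_eqv (Tadd x y) (Tadd y x)
| te_add0 x : tens_eqv (Tadd Tzero x) x
| te_addN x : tens_eqv (Tadd (Tscale (-1) x) x) Tzero
| te_scaleA a b x : tens_eqv (Tscale a (Tscale b x)) (Tscale (a * b) x)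
| te_scale1 x : tens_eqv (Tscale 1 x) x
| te_scaleDr a x y :
    tens_eqv (Tscale a (Tadd x y)) (Tadd (Tscale a x) (Tscale a y))
| te_scaleDl a b x : tens_eqv (Tscale (a + b) x) (Tadd (Tscale a x) (Tscale b x))
| te_linl c v v' w :
    tens_eqv (Tpure (c *: v + v') w) (Tadd (Tscale c (Tpure v w)) (Tpure v' w))
| te_linr c v w w' :
    tens_eqv (Tpure v (c *: w + w')) (Tadd (Tscale c (Tpure v w)) (Tpure v w')).

Definition tens_setoid := Setoid te_refl te_sym te_trans.
Definition tens_premodule : premodule F :=
  @PreModule F tens_setoid Tzero Tadd Tscale te_add te_scale te_addA te_addC
    te_add0 te_addN te_scaleA te_scale1 te_scaleDr te_scaleDl.

Definition tens : Type := pm_quot tens_premodule.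
HB.instance Definition _ := GRing.Lmodule.on tens.

Definition tpure (v : V) (w : W) : tens := cls (Tpure v w : tens_premodule).

(** [phi ⊗ psi], for [phi] and [psi] linear. *)
Fixpoint teval (phi : V -> F) (psi : W -> F) (t : tens_term) : F :=
  match t with
  | Tpure v w => phi v * psi w
  | Tzero => 0
  | Tadd x y => teval phi psi x + teval phi psi y
  | Tscale c x => c * teval phi psi x
  end.

Definition tens_fun (phi : V -> F) (psi : W -> F) (t : tens) : F :=
  teval phi psi (rpr t).

Fixpoint tact (x : g) (t : tens_term) : tens_term :=
  match t with
  | Tpure v w => Tadd (Tpure (lm_act x v) w) (Tpure v (lm_act x w))
  | Tzero => Tzero
  | Tadd s u => Tadd (tact x s) (tact x u)
  | Tscale c s => Tscale c (tact x s)
  end.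

Definition tens_act (x : g) (t : tens) : tens := cls (tact x (rpr t) : tens_premodule).

Local Notation "[ t ]" := (cls (t : tens_premodule) : tens).

Lemma tens_clsD s t : [Tadd s t] = [s] + [t].
Proof. by rewrite [RHS](mqDE (M := tens_premodule)). Qed.
Lemma tens_clsZ c t : [Tscale c t] = c *: [t].
Proof. by rewrite [RHS](mqZE (M := tens_premodule)). Qed.
Lemma tens_cls0 : [Tzero] = 0. Proof. by []. Qed.

Lemma tpurePl c v v' w : tpure (c *: v + v') w = c *: tpure v w + tpure v' w.
Proof. by rewrite -tens_clsZ -tens_clsD; apply/clsP/te_linl. Qed.
Lemma tpurePr c v w w' : tpure v (c *: w + w') = c *: tpure v w + tpure v w'.
Proof. by rewrite -tens_clsZ -tens_clsD; apply/clsP/te_linr. Qed.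

Lemma tens_funE phi psi (t : tens_term) : scalar phi -> scalar psi ->
  tens_fun phi psi [t] = teval phi psi t.
Proof.
move=> lphi lpsi; rewrite /tens_fun.
have: tens_eqv (rpr [t]) t := @rpr_cls tens_premodule t.
move: (rpr [t]) => s st; elim: s t / st => //=.
- by move=> x y z _ -> _ ->.
- by move=> x x' y y' _ -> _ ->.
- by move=> c x x' _ ->.
- by move=> *; ring.
- by move=> *; ring.
- by move=> *; ring.
- by move=> *; ring.
- by move=> *; ring.
- by move=> *; ring.
- by move=> *; ring.
- by move=> *; ring.
- by move=> *; rewrite lphi; ring.
- by move=> *; rewrite lpsi; ring.
Qed.

Lemma tact_eqv x s t : tens_eqv s t -> tens_eqv (tact x s) (tact x t).
Proof.
move=> st; apply/(clsP (T := tens_premodule)).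
elim: s t / st => //=.
- by move=> s t u _ -> _ ->.
- by move=> s s' t t' _ Es _ Et; rewrite !tens_clsD Es Et.
- by move=> c s s' _ Es; rewrite !tens_clsZ Es.
- by move=> s t u; rewrite !tens_clsD addrA.
- by move=> s t; rewrite !tens_clsD addrC.
- by move=> s; rewrite !tens_clsD tens_cls0 add0r.
- by move=> s; rewrite !tens_clsD tens_clsZ tens_cls0 scaleN1r addNr.
- by move=> a b s; rewrite !tens_clsZ scalerA.
- by move=> s; rewrite tens_clsZ scale1r.
- by move=> a s t; rewrite !(tens_clsD, tens_clsZ) scalerDr.
- by move=> a b s; rewrite !(tens_clsD, tens_clsZ) scalerDl.
- move=> c v v' w; rewrite !(tens_clsD, tens_clsZ) lm_actPr -!/(tpure _ _).
  by rewrite !tpurePl scalerDr addrACA.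
- move=> c v w w'; rewrite !(tens_clsD, tens_clsZ) lm_actPr -!/(tpure _ _).
  by rewrite !tpurePr scalerDr addrACA.
Qed.

Lemma tens_actE x t : tens_act x [t] = [tact x t].
Proof. exact/clsP/tact_eqv/(@rpr_cls tens_premodule). Qed.

Fact tens_actPr c x s t :
  tens_act x (c *: s + t) = c *: tens_act x s + tens_act x t.
Proof.
rewrite -(rprK s) -(rprK t) -tens_clsZ -tens_clsD !tens_actE /=.
by rewrite tens_clsD tens_clsZ.
Qed.

Fact tens_actPl c x y t :
  tens_act (c *: x + y) t = c *: tens_act x t + tens_act y t.
Proof.
rewrite -(rprK t) !tens_actE; move: (rpr t) => {t}; elim=> /= [v w||s Es t Et|a t Et];
  rewrite ?(tens_clsD, tens_clsZ, tens_cls0).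
- by rewrite !lm_actPl -!/(tpure _ _) tpurePl tpurePr scalerDr addrACA.
- by rewrite scaler0 addr0.
- by rewrite Es Et scalerDr addrACA.
- by rewrite Et scalerDr !scalerA mulrC.
Qed.

Fact tens_act_br x y t :
  tens_act (la_br x y) t = tens_act x (tens_act y t) - tens_act y (tens_act x t).
Proof.
rewrite -(rprK t) !tens_actE; move: (rpr t) => {t}; elim=> /= [v w||s Es t Et|a t Et];
  rewrite ?(tens_clsD, tens_clsZ, tens_cls0).
- rewrite !lm_act_br -!/(tpure _ _).
  have -> a b (c : W) : tpure (a - b) c = tpure a c - tpure b c.
    by rewrite addrC -scaleN1r tpurePl scaleN1r addrC.
  have -> (a : V) b c : tpure a (b - c) = tpure a b - tpure a c.
    by rewrite addrC -scaleN1r tpurePr scaleN1r addrC.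
  have ACA (T : zmodType) (a b c d p q : T) :
      a - b + (c - d) = a + p + (q + c) - (b + q + (p + d)).
    rewrite (addrC q c) [a + p + _]addrACA (addrC p d) [b + q + _]addrACA.
    by rewrite (addrC q p) opprD [RHS]addrACA subrr addr0 opprD addrACA.
  exact: ACA.
- by rewrite subr0.
- by rewrite Es Et opprD addrACA.
- by rewrite Et scalerBr.
Qed.

Definition tensor : lie_module g :=
  @LieModule F g tens tens_act tens_actPl tens_actPr tens_act_br.
End Tensor.

Section KacMoodyAlgebra.
Context (F : fieldType) (n k : nat).
Context (A : 'M[int]_n) (alpha : 'I_n -> 'rV[int]_(n + k)).

Inductive km_term : Type :=
| KMh of 'rV[F]_(n + k) | KMe of 'I_n | KMf of 'I_n
| KM0 | KMadd of km_term & km_term | KMscale of F & km_term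
| KMbr of km_term & km_term.

Definition KMad (p : nat) (x y : km_term) : km_term := iter p (KMbr x) y.

Inductive km_eqv : km_term -> km_term -> Prop :=
| km_refl x : km_eqv x x
| km_sym x y : km_eqv x y -> km_eqv y x
| km_trans x y z : km_eqv x y -> km_eqv y z -> km_eqv x z
| km_add x x' y y' : km_eqv x x' -> km_eqv y y' ->
    km_eqv (KMadd x y) (KMadd x' y')
| km_scale c x x' : km_eqv x x' -> km_eqv (KMscale c x) (KMscale c x')
| km_br x x' y y' : km_eqv x x' -> km_eqv y y' ->
    km_eqv (KMbr x y) (KMbr x' y')
| km_addA x y z : km_eqv (KMadd x (KMadd y z)) (KMadd (KMadd x y) z)
| km_addC x y : km_eqv (KMadd x y) (KMadd y x)
| km_add0 x : km_eqv (KMadd KM0 x) x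
| km_addN x : km_eqv (KMadd (KMscale (-1) x) x) KM0
| km_scaleA a b x : km_eqv (KMscale a (KMscale b x)) (KMscale (a * b) x)
| km_scale1 x : km_eqv (KMscale 1 x) x
| km_scaleDr a x y :
    km_eqv (KMscale a (KMadd x y)) (KMadd (KMscale a x) (KMscale a y))
| km_scaleDl a b x :
    km_eqv (KMscale (a + b) x) (KMadd (KMscale a x) (KMscale b x))
| km_brl c x y z : km_eqv (KMbr (KMadd (KMscale c x) y) z)
                          (KMadd (KMscale c (KMbr x z)) (KMbr y z))
| km_brr c x y z : km_eqv (KMbr z (KMadd (KMscale c x) y))
                          (KMadd (KMscale c (KMbr z x)) (KMbr z y))
| km_brxx x : km_eqv (KMbr x x) KM0
| km_jac x y z : km_eqv
    (KMadd (KMadd (KMbr x (KMbr y z)) (KMbr y (KMbr z x))) (KMbr z (KMbr x y)))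
    KM0
| km_h_lin c a b :
    km_eqv (KMh (c *: a + b)) (KMadd (KMscale c (KMh a)) (KMh b))
| km_hh a b : km_eqv (KMbr (KMh a) (KMh b)) KM0
| km_ef i j :
    km_eqv (KMbr (KMe i) (KMf j)) (if i == j then KMh (coroot k F i) else KM0)
| km_he h i : km_eqv (KMbr (KMh h) (KMe i))
                     (KMscale (weight_eval (alpha i) h) (KMe i))
| km_hf h i : km_eqv (KMbr (KMh h) (KMf i))
                     (KMscale (- weight_eval (alpha i) h) (KMf i))
| km_ee i j : i != j -> km_eqv (KMad `|1 - A i j|%N (KMe i) (KMe j)) KM0
| km_ff i j : i != j -> km_eqv (KMad `|1 - A i j|%N (KMf i) (KMf j)) KM0.

Definition km_setoid := Setoid km_refl km_sym km_trans.
Definition km_premodule : premodule F :=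
  @PreModule F km_setoid KM0 KMadd KMscale km_add km_scale km_addA km_addC
    km_add0 km_addN km_scaleA km_scale1 km_scaleDr km_scaleDl.

Local Notation Q := (pm_quot km_premodule).
Local Notation "[ t ]" := (cls (t : km_premodule) : Q).

Definition km_bracket (x y : Q) : Q := [KMbr (rpr x) (rpr y)].

Lemma km_clsD s t : [KMadd s t] = [s] + [t].
Proof. by rewrite [RHS](mqDE (M := km_premodule)). Qed.
Lemma km_clsZ c t : [KMscale c t] = c *: [t].
Proof. by rewrite [RHS](mqZE (M := km_premodule)). Qed.
Lemma km_clsB s t : [KMbr s t] = km_bracket [s] [t].
Proof.
by apply/clsP/km_br; apply: km_sym; apply: (@rpr_cls km_premodule).
Qed.

Fact km_brPl c x y z :
  km_bracket (c *: x + y) z = c *: km_bracket x z + km_bracket y z.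
Proof.
rewrite -(rprK x) -(rprK y) -(rprK z) -km_clsZ -km_clsD -!km_clsB.
by rewrite -km_clsZ -km_clsD; apply/clsP/km_brl.
Qed.
Fact km_brPr c x y z :
  km_bracket z (c *: x + y) = c *: km_bracket z x + km_bracket z y.
Proof.
rewrite -(rprK x) -(rprK y) -(rprK z) -km_clsZ -km_clsD -!km_clsB.
by rewrite -km_clsZ -km_clsD; apply/clsP/km_brr.
Qed.
Fact km_bracketxx x : km_bracket x x = 0.
Proof. by rewrite -(rprK x) -!km_clsB; apply/clsP/km_brxx. Qed.
Fact km_jacobi x y z :
  km_bracket x (km_bracket y z) + km_bracket y (km_bracket z x) +
  km_bracket z (km_bracket x y) = 0.
Proof.
rewrite -(rprK x) -(rprK y) -(rprK z) -!km_clsB -!km_clsD.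
exact/clsP/km_jac.
Qed.

Definition kac_moody : lie_algebra F :=
  @LieAlgebra F Q km_bracket km_brPl km_brPr km_bracketxx km_jacobi.

Definition km_h (h : 'rV[F]_(n + k)) : kac_moody := [KMh h].
Definition km_e (i : 'I_n) : kac_moody := [KMe i].
Definition km_f (i : 'I_n) : kac_moody := [KMf i].

Definition weight_space (V : lie_module kac_moody) (la : 'rV[int]_(n + k)) :
    set V :=
  [set v | forall h, lm_act (km_h h) v = weight_eval la h *: v].

Record is_irr_hw (La : 'rV[int]_(n + k)) (V : lie_module kac_moody) (v : V) :
    Prop := IsIrrHw {
  hw_neq0 : v <> 0;
  hw_e : forall i, lm_act (km_e i) v = 0;
  hw_h : weight_space La v;
  hw_gen : forall W : set V, is_submodule W -> W v -> W = setT;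
  hw_irr : forall W : set V, is_submodule W -> W = [set 0] \/ W = setT }.

(** The restricted dual, realized inside the full dual: for a module which is
    the direct sum of its weight spaces, an element of the direct sum of the
    duals of the weight spaces is a linear form vanishing on almost all weight
    spaces. *)
Definition restricted_dual (V : lie_module kac_moody) : set (V -> F) :=
  [set phi : V -> F | scalar phi /\
     exists s : seq 'rV[int]_(n + k), forall la, la \notin s ->
       forall v, weight_space la v -> phi v = 0].
End KacMoodyAlgebra.

Inductive addspan (V : nmodType) (X : set V) : set V :=
| addspan0 : addspan X 0
| addspanD x y : X x -> addspan X y -> addspan X (x + y).

(** A commutative algebra graded by a submonoid [ga_deg] of an abelian group
    [G]: a cancellative commutative monoid is viewed inside its group of
    differences.  [ga_comp La] is meaningful only for [La] in [ga_deg]. *)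
Record graded_alg (F : fieldType) (G : zmodType) := GradedAlg {
  ga_sort :> comAlgType F;
  ga_deg : set G;
  ga_comp : G -> set ga_sort;
  ga_deg0 : ga_deg 0;
  ga_degD : forall La N, ga_deg La -> ga_deg N -> ga_deg (La + N);
  ga_comp0 : forall La, ga_deg La -> ga_comp La 0;
  ga_compP : forall La c x y, ga_deg La -> ga_comp La x -> ga_comp La y ->
    ga_comp La (c *: x + y);
  ga_comp1 : ga_comp 0 1;
  ga_compM : forall La N x y, ga_deg La -> ga_deg N ->
    ga_comp La x -> ga_comp N y -> ga_comp (La + N) (x * y);
  ga_span : forall x,
    addspan [set y | exists2 La, ga_deg La & ga_comp La y] x;
  ga_indep : forall (s : seq G) (y : G -> ga_sort), uniq s ->
    (forall La, La \in s -> ga_deg La /\ ga_comp La (y La)) ->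
    \sum_(La <- s) y La = 0 -> forall La, La \in s -> y La = 0 }.

Section Proj.
Context (F : fieldType) (G : zmodType) (R : graded_alg F G).

(** Homogeneous elements with degree in [D]. *)
Definition homog_in (D : set G) : set R :=
  [set x | exists La, [/\ ga_deg R La, D La & ga_comp La x]].
Definition homog : set R := homog_in setT.

(** [\bigoplus_(La in D) R_La] *)
Definition deg_span (D : set G) : set R := addspan (homog_in D).

Definition is_ideal (a : set R) : Prop :=
  [/\ a 0, forall x y, a x -> a y -> a (x + y) & forall r x, a x -> a (r * x)].

Definition is_hideal (a : set R) : Prop :=
  is_ideal a /\ forall x, a x -> addspan (a `&` homog) x.

Definition is_hprime (Q : set R) : Prop :=
  [/\ is_hideal Q, ~ Q 1 & forall x y, Q (x * y) -> Q x \/ Q y].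

Record proj := ProjPoint { pt_ideal :> set R; ptP : is_hprime pt_ideal }.
HB.instance Definition _ := gen_eqMixin proj.
HB.instance Definition _ := gen_choiceMixin proj.

Lemma proj_eq (P Q : proj) : (P : set R) = Q -> P = Q.
Proof.
by case: P Q => [P pP] [Q pQ] /= E; case: _ / E pQ => pQ; congr ProjPoint;
   apply: Prop_irrelevance.
Qed.

Definition vanishing (a : set R) : set proj := [set Q | a `<=` (Q : set R)].

Definition proj_open : set (set proj) :=
  [set U | exists2 a, is_hideal a & U = ~` vanishing a].

Lemma addspan_sub (X Y : set R) :
  Y 0 -> (forall x y, Y x -> Y y -> Y (x + y)) -> X `<=` Y -> addspan X `<=` Y.
Proof. by move=> Y0 YD XY x; elim=> // {}x y /XY Xx _ Yy; apply: YD. Qed.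

Lemma sub_addspan (X : set R) : X `<=` addspan X.
Proof. by move=> x Xx; rewrite -(addr0 x); apply: addspanD => //; exact: addspan0. Qed.

Lemma addspan_add (X : set R) x y :
  addspan X x -> addspan X y -> addspan X (x + y).
Proof.
move=> + sy; elim; first by rewrite add0r.
by move=> u v Xu _ IH; rewrite -addrA; apply: addspanD.
Qed.

Lemma addspan_mono (X Y : set R) : X `<=` Y -> addspan X `<=` addspan Y.
Proof.
move=> XY; apply: addspan_sub; [exact: addspan0|exact: addspan_add|].
by move=> x /XY; exact: sub_addspan.
Qed.

Lemma homogE x : homog x <-> exists2 La, ga_deg R La & ga_comp La x.
Proof. by split=> [[La [? _ ?]]|[La ? ?]]; exists La. Qed.

Lemma homog_span x : addspan homog x.
Proof. by apply: addspan_mono (ga_span x) => y /homogE. Qed.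

Lemma homogM x y : homog x -> homog y -> homog (x * y).
Proof.
move=> /homogE[La dL cx] /homogE[N dN cy]; apply/homogE; exists (La + N).
  exact: ga_degD.
exact: ga_compM.
Qed.

Lemma homog1 : homog 1.
Proof. by apply/homogE; exists 0; [exact: ga_deg0|exact: ga_comp1]. Qed.

Definition ideal_gen (X : set R) : set R :=
  addspan [set z | exists r x, X x /\ z = r * x].

Lemma ideal_gen_ideal X : is_ideal (ideal_gen X).
Proof.
split; [exact: addspan0|exact: addspan_add|move=> r x].
elim=> [|_ y [s [u [Xu ->]]] _ IH]; first by rewrite mulr0; exact: addspan0.
by rewrite mulrDr; apply: addspanD => //; exists (r * s), u; rewrite mulrA.
Qed.

Lemma sub_ideal_gen X : X `<=` ideal_gen X.
Proof. by move=> x Xx; apply: sub_addspan; exists 1, x; rewrite mul1r. Qed.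

Lemma ideal_gen_sub (X a : set R) : is_ideal a -> X `<=` a -> ideal_gen X `<=` a.
Proof.
move=> [a0 aD aM] Xa; apply: addspan_sub => // _ [r [x [Xx ->]]].
exact/aM/Xa.
Qed.

Lemma ideal_gen_hideal X : X `<=` homog -> is_hideal (ideal_gen X).
Proof.
move=> hX; have [i0 iD iM] := ideal_gen_ideal X; split=> // x.
elim=> [|_ y [r [u [Xu ->]]] _ IH]; first exact: addspan0.
apply: addspan_add => //; elim: (homog_span r) => [|s t hs _ IHt].
  by rewrite mul0r; exact: addspan0.
rewrite mulrDl; apply: addspanD => //; split.
  exact/iM/sub_ideal_gen.
by apply: homogM => //; exact: hX.
Qed.

Fact proj_openT : proj_open setT.
Proof.
exists (ideal_gen homog); first exact: ideal_gen_hideal.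
apply/seteqP; split=> // Q _ /(_ 1); case: (ptP Q) => _ Q1 _; apply: contra_not Q1.
by apply; apply/sub_ideal_gen/homog1.
Qed.

Fact proj_openI : setI_closed proj_open.
Proof.
move=> _ _ [a [ia ha] ->] [b [ib hb] ->].
pose X := [set z | exists x y, [/\ (a `&` homog) x, (b `&` homog) y & z = x * y]].
exists (ideal_gen X).
  by apply: ideal_gen_hideal => _ [x [y [[_ hx] [_ hy] ->]]]; exact: homogM.
rewrite -setCU; congr (~` _); apply/seteqP; split=> Q.
  have [[[Q0 QD QM] _] _ _] := ptP Q.
  case=> /= sQ; apply: ideal_gen_sub => // _ [x [y [[ax _] [b_y _] ->]]].
    by rewrite mulrC; exact/QM/sQ.
  exact/QM/sQ.
have [[[Q0 QD QM] _] _ Qpr] := ptP Q => /= sQ.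
apply: contrapT => /not_orP[/= na nb].
have sub c : (forall x, c x -> addspan (c `&` homog) x) -> ~ c `<=` (Q : set R) ->
    exists2 x, (c `&` homog) x & ~ (Q : set R) x.
  move=> hc; apply: contra_notP => /forall2NP hn z /hc; apply: addspan_sub => //.
  by move=> x cx; have [//|/contrapT] := hn x.
have [x ax nx] := sub a ha na; have [y b_y ny] := sub b hb nb.
have /Qpr[//|//] : (Q : set R) (x * y).
by apply/sQ/sub_ideal_gen; exists x, y.
Qed.

Fact proj_open_bigU (I : Type) (U : I -> set proj) :
  (forall i, proj_open (U i)) -> proj_open (\bigcup_i U i).
Proof.
move=> oU; pose X := [set x | exists i a,
  [/\ is_hideal a, U i = ~` vanishing a & (a `&` homog) x]].
exists (ideal_gen X).
  by apply: ideal_gen_hideal => x [i [a [_ _ []]]].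
rewrite -[LHS]setCK setC_bigcup; congr (~` _).
apply/seteqP; split=> Q /=; have [[[Q0 QD QM] hQ] _ _] := ptP Q.
  move=> nU; apply: ideal_gen_sub => // x [i [a [ha Ea [ax _]]]].
  by have := nU i Logic.I; rewrite Ea setCK; apply.
move=> sQ i _; have [a [ia ha] Ea] := oU i; rewrite Ea setCK => x /ha.
apply: addspan_sub => // y ay; apply/sQ/sub_ideal_gen.
by exists i, a.
Qed.

HB.instance Definition _ :=
  isOpenTopological.Build proj proj_openT proj_openI proj_open_bigU.

Lemma proj_openE (U : set proj) : open U = proj_open U. Proof. by []. Qed.
End Proj.

(** Commutative algebras that may be zero, such as the sections over the empty
    set: a commutative ring with a structure morphism from [F]. *)
Record calg (F : fieldType) := CAlg {
  calg_ring :> comPzRingType;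
  calg_str : {rmorphism F -> calg_ring} }.

Definition is_alg_hom (F : fieldType) (A B : calg F) (f : A -> B) : Prop :=
  [/\ forall x y, f (x + y) = f x + f y, forall x y, f (x * y) = f x * f y &
      forall c, f (calg_str A c) = calg_str B c].

Record opens (X : topologicalType) := Opens {
  opens_set :> set X; opensP : open opens_set }.

Record presheaf (F : fieldType) (X : topologicalType) := Presheaf {
  sec :> opens X -> calg F;
  res : forall U V : opens X, V `<=` U -> sec U -> sec V;
  res_hom : forall (U V : opens X) (i : V `<=` U), is_alg_hom (res i);
  res_id : forall (U : opens X) (i : U `<=` U) s, res i s = s;
  res_res : forall (U V W : opens X) (i : V `<=` U) (j : W `<=` V) (k : W `<=` U) s,
    res j (res i s) = res k s }.

Definition opens_setT (X : topologicalType) : opens X := Opens openT.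
Definition opens_setI (X : topologicalType) (U V : opens X) : opens X :=
  Opens (openI (opensP U) (opensP V)).

Section AlgHom.
Context (F : fieldType) (A B : calg F) (f : A -> B) (hf : is_alg_hom f).
Lemma alg_homD x y : f (x + y) = f x + f y. Proof. by case: hf. Qed.
Lemma alg_homM x y : f (x * y) = f x * f y. Proof. by case: hf. Qed.
Lemma alg_hom_str c : f (calg_str A c) = calg_str B c. Proof. by case: hf. Qed.
Lemma alg_hom0 : f 0 = 0.
Proof. by rewrite -(rmorph0 (calg_str A)) alg_hom_str rmorph0. Qed.
Lemma alg_hom1 : f 1 = 1.
Proof. by rewrite -(rmorph1 (calg_str A)) alg_hom_str rmorph1. Qed.
Lemma alg_homN x : f (- x) = - f x.
Proof. by apply: (addrI (f x)); rewrite -alg_homD !subrr alg_hom0. Qed.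
End AlgHom.

Section Stalk.
Context (F : fieldType) (X : topologicalType) (O : presheaf F X) (x : X).

Record germ := Germ {
  germ_dom : opens X;
  germ_mem : (germ_dom : set X) x;
  germ_sec : O germ_dom }.

Definition germ_eqv (s t : germ) : Prop :=
  exists (W : opens X) (i : W `<=` germ_dom s) (j : W `<=` germ_dom t),
    (W : set X) x /\ res i (germ_sec s) = res j (germ_sec t).

Fact germ_refl s : germ_eqv s s.
Proof.
exists (germ_dom s), (@subset_refl _ _), (@subset_refl _ _).
by split; [exact: germ_mem|].
Qed.
Fact germ_sym s t : germ_eqv s t -> germ_eqv t s.
Proof. by move=> [W [i [j [Wx E]]]]; exists W, j, i. Qed.
Fact germ_trans s t u : germ_eqv s t -> germ_eqv t u -> germ_eqv s u.
Proof.
move=> [W [i [j [Wx E]]]] [W' [i' [j' [Wx' E']]]].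
pose V := opens_setI W W'.
have k : V `<=` W by move=> y [].
have k' : V `<=` W' by move=> y [].
exists V, (subset_trans k i), (subset_trans k' j'); split=> //.
rewrite -(res_res i k) E -(res_res j' k') -E'.
by rewrite (res_res j k (subset_trans k j)) (res_res i' k' (subset_trans k j)).
Qed.
Definition germ_setoid := Setoid germ_refl germ_sym germ_trans.

Definition germ_op2 (op : forall U, O U -> O U -> O U) (s t : germ) : germ :=
  let W := opens_setI (germ_dom s) (germ_dom t) in
  @Germ W (conj (germ_mem s) (germ_mem t))
    (op W (res (V := W) (@subIsetl _ _ _) (germ_sec s))
          (res (V := W) (@subIsetr _ _ _) (germ_sec t))).

Definition natural2 (op : forall U, O U -> O U -> O U) : Prop :=
  forall (U V : opens X) (i : V `<=` U) a b,
    res i (op U a b) = op V (res i a) (res i b).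

Lemma germ_op2_res op s t (W : opens X) (i : W `<=` germ_dom s)
    (j : W `<=` germ_dom t) (k : W `<=` germ_dom (germ_op2 op s t)) :
  natural2 op ->
  res k (germ_sec (germ_op2 op s t)) =
    op W (res i (germ_sec s)) (res j (germ_sec t)).
Proof.
by move=> nat_op; rewrite /= nat_op; congr op; [apply: res_res|apply: res_res].
Qed.

Lemma germ_op2_eqv op : natural2 op -> forall s s' t t',
  germ_eqv s s' -> germ_eqv t t' -> germ_eqv (germ_op2 op s t) (germ_op2 op s' t').
Proof.
move=> nat_op s s' t t' [W [i [i' [Wx E]]]] [V [j [j' [Vx E']]]].
pose Z := opens_setI W V.
have ZW : Z `<=` W by move=> y [].
have ZV : Z `<=` V by move=> y [].
have k : Z `<=` germ_dom (germ_op2 op s t).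
  by move=> y [/i ? /j ?]; split.
have k' : Z `<=` germ_dom (germ_op2 op s' t').
  by move=> y [/i' ? /j' ?]; split.
exists Z, k, k'; split=> //.
rewrite (germ_op2_res (subset_trans ZW i) (subset_trans ZV j) k nat_op).
rewrite (germ_op2_res (subset_trans ZW i') (subset_trans ZV j') k' nat_op).
by rewrite -!(res_res i ZW, res_res j ZV, res_res i' ZW, res_res j' ZV) E E'.
Qed.

Definition germ_add := germ_op2 (fun U => +%R).
Definition germ_mul := germ_op2 (fun U => *%R).
Definition germ_opp (s : germ) : germ := Germ (germ_mem s) (- germ_sec s).
Definition germ_cst (c : F) : germ :=
  @Germ (opens_setT X) Logic.I (calg_str (O (opens_setT X)) c).

Fact natural_add : natural2 (fun U => +%R).
Proof. by move=> U V i a b; rewrite (alg_homD (res_hom O i)). Qed.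
Fact natural_mul : natural2 (fun U => *%R).
Proof. by move=> U V i a b; rewrite (alg_homM (res_hom O i)). Qed.

Fact germ_opp_eqv s s' : germ_eqv s s' -> germ_eqv (germ_opp s) (germ_opp s').
Proof.
move=> [W [i [j [Wx E]]]]; exists W, i, j; split=> //=.
by rewrite !(alg_homN (res_hom O _)) E.
Qed.

Fact germ_op2A op : natural2 op -> (forall U, associative (op U)) ->
  forall s t u,
  germ_eqv (germ_op2 op s (germ_op2 op t u)) (germ_op2 op (germ_op2 op s t) u).
Proof.
move=> nat_op opA s t u; pose g := germ_op2 op (germ_op2 op s t) u.
have i : germ_dom g `<=` germ_dom (germ_op2 op s (germ_op2 op t u)).
  by move=> y [[]].
exists (germ_dom g), i, (@subset_refl _ _); split; first exact: (germ_mem g).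
have a : germ_dom g `<=` germ_dom s by move=> y [[]].
have b : germ_dom g `<=` germ_dom t by move=> y [[]].
have c : germ_dom g `<=` germ_dom u by move=> y [[]].
have ab : germ_dom g `<=` germ_dom (germ_op2 op s t) by move=> y [].
have bc : germ_dom g `<=` germ_dom (germ_op2 op t u) by move=> y [[]].
rewrite (germ_op2_res a bc i nat_op) (germ_op2_res ab c _ nat_op).
by rewrite (germ_op2_res b c bc nat_op) (germ_op2_res a b ab nat_op) opA.
Qed.

Fact germ_op2C op : natural2 op -> (forall U, commutative (op U)) ->
  forall s t, germ_eqv (germ_op2 op s t) (germ_op2 op t s).
Proof.
move=> nat_op opC s t; pose g := germ_op2 op s t.
have i : germ_dom g `<=` germ_dom (germ_op2 op t s) by move=> y [].
exists (germ_dom g), (@subset_refl _ _), i; split; first exact: (germ_mem g).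
have a : germ_dom g `<=` germ_dom s by move=> y [].
have b : germ_dom g `<=` germ_dom t by move=> y [].
by rewrite (germ_op2_res b a i nat_op) (germ_op2_res a b _ nat_op) opC.
Qed.

Fact germ_op2_cst op (c : F) : natural2 op ->
  (forall U, left_id (calg_str (O U) c) (op U)) ->
  forall s, germ_eqv (germ_op2 op (germ_cst c) s) s.
Proof.
move=> nat_op op1 s; pose g := germ_op2 op (germ_cst c) s.
have a : germ_dom g `<=` germ_dom (germ_cst c) by [].
have b : germ_dom g `<=` germ_dom s by move=> y [].
exists (germ_dom g), (@subset_refl _ _), b; split; first exact: (germ_mem g).
by rewrite (germ_op2_res a b _ nat_op) /= (alg_hom_str (res_hom O _)) op1.
Qed.

Fact germ_addN s : germ_eqv (germ_add (germ_opp s) s) (germ_cst 0).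
Proof.
pose g := germ_add (germ_opp s) s.
have a : germ_dom g `<=` germ_dom s by move=> y [].
have b : germ_dom g `<=` germ_dom (germ_cst 0) by [].
exists (germ_dom g), (@subset_refl _ _), b; split; first exact: (germ_mem g).
rewrite (germ_op2_res (s := germ_opp s) a a _ natural_add) /=.
by rewrite (alg_homN (res_hom O _)) addNr (alg_hom_str (res_hom O _)) rmorph0.
Qed.

Fact germ_mulDl s t u : germ_eqv (germ_mul (germ_add s t) u)
  (germ_add (germ_mul s u) (germ_mul t u)).
Proof.
pose g := germ_mul (germ_add s t) u.
have i : germ_dom g `<=` germ_dom (germ_add (germ_mul s u) (germ_mul t u)).
  by move=> y [[]].
exists (germ_dom g), (@subset_refl _ _), i; split; first exact: (germ_mem g).
have a : germ_dom g `<=` germ_dom s by move=> y [[]].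
have b : germ_dom g `<=` germ_dom t by move=> y [[]].
have c : germ_dom g `<=` germ_dom u by move=> y [[]].
have ab : germ_dom g `<=` germ_dom (germ_add s t) by move=> y [].
have ac : germ_dom g `<=` germ_dom (germ_mul s u) by move=> y [[]].
have bc : germ_dom g `<=` germ_dom (germ_mul t u) by move=> y [[]].
rewrite (germ_op2_res ac bc i natural_add) (germ_op2_res ab c _ natural_mul).
rewrite (germ_op2_res a b ab natural_add) (germ_op2_res a c ac natural_mul).
by rewrite (germ_op2_res b c bc natural_mul) mulrDl.
Qed.

Fact germ_cst0D s : germ_eqv (germ_add (germ_cst 0) s) s.
Proof.
by apply: germ_op2_cst natural_add _ _ => U a; rewrite rmorph0 add0r.
Qed.
Fact germ_cst1M s : germ_eqv (germ_mul (germ_cst 1) s) s.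
Proof.
by apply: germ_op2_cst natural_mul _ _ => U a; rewrite rmorph1 mul1r.
Qed.

Definition germ_prering : prering :=
  @PreRing germ_setoid (germ_cst 0) (germ_cst 1) germ_opp germ_add germ_mul
    germ_opp_eqv (fun s s' t t' => germ_op2_eqv natural_add (t' := t'))
    (fun s s' t t' => germ_op2_eqv natural_mul (t' := t'))
    (germ_op2A natural_add (fun U => @addrA _))
    (germ_op2C natural_add (fun U => @addrC _))
    germ_cst0D germ_addN
    (germ_op2A natural_mul (fun U => @mulrA _))
    (germ_op2C natural_mul (fun U => @mulrC _))
    germ_cst1M germ_mulDl.

Definition stalk_ring : comPzRingType := pr_quot germ_prering.
Definition stalk_cst (c : F) : stalk_ring := cls (germ_cst c : germ_prering).

Lemma stalk_cstE (c : F) (s : germ) (W : opens X) (i : W `<=` germ_dom s) :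
  (W : set X) x -> res i (germ_sec s) = calg_str (O W) c ->
  stalk_cst c = cls (s : germ_prering).
Proof.
move=> Wx E; apply/clsP; exists W, (@subsetT _ _), i; split=> //.
by rewrite /= (alg_hom_str (res_hom O _)) E.
Qed.

Fact stalk_cst_zmod : zmod_morphism stalk_cst.
Proof.
move=> a b; rewrite [X in _ = _ + X]pr_quotN [RHS]pr_quotD.
have i : opens_setT X `<=` germ_dom (germ_add (germ_cst a) (germ_opp (germ_cst b))).
  by move=> y.
apply: (stalk_cstE (W := opens_setT X) (i := i)) => //.
rewrite (germ_op2_res (s := germ_cst a) (t := germ_opp (germ_cst b))
  (@subset_refl _ _) (@subset_refl _ _) i natural_add) /=.
rewrite (alg_homN (res_hom O _)) !(alg_hom_str (res_hom O _)).
by rewrite rmorphB.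
Qed.
Fact stalk_cst_monoid : monoid_morphism stalk_cst.
Proof.
split=> [//|a b]; rewrite [RHS]pr_quotM.
have i : opens_setT X `<=` germ_dom (germ_mul (germ_cst a) (germ_cst b)) by [].
apply: (stalk_cstE (W := opens_setT X) (i := i)) => //.
rewrite (germ_op2_res (s := germ_cst a) (t := germ_cst b)
  (@subset_refl _ _) (@subset_refl _ _) i natural_mul) /=.
by rewrite !(alg_hom_str (res_hom O _)) rmorphM.
Qed.
HB.instance Definition _ := GRing.isZmodMorphism.Build F stalk_ring stalk_cst
  stalk_cst_zmod.
HB.instance Definition _ := GRing.isMonoidMorphism.Build F stalk_ring stalk_cst
  stalk_cst_monoid.
Definition stalk : calg F := CAlg stalk_cst.

Definition germ_of (U : opens X) (Ux : (U : set X) x) (s : O U) : stalk :=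
  cls (Germ Ux s : germ_prering).
End Stalk.

Lemma germ_of_eq (F : fieldType) (X : topologicalType) (O : presheaf F X) (x : X)
    (U V : opens X) (Ux : (U : set X) x) (Vx : (V : set X) x) (s : O U) (t : O V)
    (W : opens X) (i : W `<=` U) (j : W `<=` V) :
  (W : set X) x -> res i s = res j t -> germ_of Ux s = germ_of Vx t.
Proof. by move=> Wx E; apply/clsP; exists W, i, j. Qed.

Lemma germ_of_res (F : fieldType) (X : topologicalType) (O : presheaf F X) (x : X)
    (U V : opens X) (i : V `<=` U) (Ux : (U : set X) x) (Vx : (V : set X) x)
    (s : O U) :
  germ_of Ux s = germ_of Vx (res i s).
Proof.
apply: (@germ_of_eq F X O x U V Ux Vx s (res i s) V i (@subset_refl _ _)) => //.
by rewrite res_id.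
Qed.

Section GermOf.
Context (F : fieldType) (X : topologicalType) (O : presheaf F X) (x : X).
Context (U : opens X) (Ux : (U : set X) x).

Lemma germ_ofN (s : O U) : germ_of Ux (- s) = - germ_of Ux s.
Proof. by rewrite [RHS]pr_quotN. Qed.
Lemma germ_ofD (s t : O U) : germ_of Ux (s + t) = germ_of Ux s + germ_of Ux t.
Proof.
rewrite [RHS]pr_quotD; apply/clsP.
have i : U `<=` germ_dom (germ_add (Germ Ux s) (Germ Ux t)) by move=> y.
exists U, (@subset_refl _ _), i; split=> //.
rewrite (germ_op2_res (s := Germ Ux s) (t := Germ Ux t)
  (@subset_refl _ _) (@subset_refl _ _) i (@natural_add F X O)).
by rewrite !res_id.
Qed.
Lemma germ_ofM (s t : O U) : germ_of Ux (s * t) = germ_of Ux s * germ_of Ux t.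
Proof.
rewrite [RHS]pr_quotM; apply/clsP.
have i : U `<=` germ_dom (germ_mul (Germ Ux s) (Germ Ux t)) by move=> y.
exists U, (@subset_refl _ _), i; split=> //.
rewrite (germ_op2_res (s := Germ Ux s) (t := Germ Ux t)
  (@subset_refl _ _) (@subset_refl _ _) i (@natural_mul F X O)).
by rewrite !res_id.
Qed.
Lemma germ_of_cst c : germ_of Ux (calg_str (O U) c) = calg_str (stalk O x) c.
Proof.
apply/esym/(stalk_cstE (W := U) (s := Germ Ux _) (i := @subset_refl _ _)) => //.
by rewrite res_id.
Qed.
End GermOf.

Section Sheafification.
Context (F : fieldType) (X : topologicalType) (O : presheaf F X).

(** A section over [U] is a family of germs which is locally given by sections
    of the presheaf. *)
Definition locally_section (U : opens X)
    (s : forall x, (U : set X) x -> stalk O x) : Prop :=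
  forall x, (U : set X) x -> exists (V : opens X) (t : O V),
    [/\ (V : set X) x, V `<=` U &
        forall y (Uy : (U : set X) y) (Vy : (V : set X) y), s y Uy = germ_of Vy t].

Record sh_sec (U : opens X) := ShSec {
  sh_fun :> forall x, (U : set X) x -> stalk O x;
  sh_locP : locally_section sh_fun }.

Section Sections.
Context (U : opens X).
Implicit Types s t : sh_sec U.
HB.instance Definition _ := gen_eqMixin (sh_sec U).
HB.instance Definition _ := gen_choiceMixin (sh_sec U).

Lemma sh_secP s t : (forall x Ux, s x Ux = t x Ux) -> s = t.
Proof.
case: s t => [s ls] [t lt] /= E; have {}E : s = t.
  apply: functional_extensionality_dep => x.
  by apply: functional_extensionality_dep => Ux; exact: E.
by case: _ / E lt => lt; congr ShSec; apply: Prop_irrelevance.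
Qed.

Fact locally_cst c : @locally_section U (fun x _ => calg_str (stalk O x) c).
Proof.
move=> x Ux; exists U, (calg_str (O U) c); split=> // y Uy Vy.
by rewrite germ_of_cst.
Qed.
Fact locally_opp s : @locally_section U (fun x Ux => - s x Ux).
Proof.
move=> x /(sh_locP s)[V [t [Vx VU E]]]; exists V, (- t); split=> // y Uy Vy.
by rewrite E germ_ofN.
Qed.
Fact locally_add s t : @locally_section U (fun x Ux => s x Ux + t x Ux).
Proof.
move=> x Ux; have [V [a [Vx VU E]]] := sh_locP s Ux.
have [W [b [Wx WU E']]] := sh_locP t Ux.
pose Z := opens_setI V W.
have ZV : Z `<=` V by move=> y [].
have ZW : Z `<=` W by move=> y [].
exists Z, (res ZV a + res ZW b); split=> [//|y [/VU]//|y Uy [Vy Wy]].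
rewrite germ_ofD -(germ_of_res ZV Vy) -(germ_of_res ZW Wy).
by rewrite -(E _ Uy) -(E' _ Uy).
Qed.
Fact locally_mul s t : @locally_section U (fun x Ux => s x Ux * t x Ux).
Proof.
move=> x Ux; have [V [a [Vx VU E]]] := sh_locP s Ux.
have [W [b [Wx WU E']]] := sh_locP t Ux.
pose Z := opens_setI V W.
have ZV : Z `<=` V by move=> y [].
have ZW : Z `<=` W by move=> y [].
exists Z, (res ZV a * res ZW b); split=> [//|y [/VU]//|y Uy [Vy Wy]].
rewrite germ_ofM -(germ_of_res ZV Vy) -(germ_of_res ZW Wy).
by rewrite -(E _ Uy) -(E' _ Uy).
Qed.

Definition sh_cst c : sh_sec U := ShSec (locally_cst c).
Definition sh_opp s : sh_sec U := ShSec (locally_opp s).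
Definition sh_add s t : sh_sec U := ShSec (locally_add s t).
Definition sh_mul s t : sh_sec U := ShSec (locally_mul s t).

Fact sh_addA : associative sh_add.
Proof. by move=> s t u; apply: sh_secP => x Ux /=; rewrite addrA. Qed.
Fact sh_addC : commutative sh_add.
Proof. by move=> s t; apply: sh_secP => x Ux /=; rewrite addrC. Qed.
Fact sh_add0 : left_id (sh_cst 0) sh_add.
Proof. by move=> s; apply: sh_secP => x Ux /=; rewrite rmorph0 add0r. Qed.
Fact sh_addN : left_inverse (sh_cst 0) sh_opp sh_add.
Proof. by move=> s; apply: sh_secP => x Ux /=; rewrite rmorph0 addNr. Qed.
HB.instance Definition _ :=
  GRing.isZmodule.Build (sh_sec U) sh_addA sh_addC sh_add0 sh_addN.

Fact sh_mulA : associative sh_mul.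
Proof. by move=> s t u; apply: sh_secP => x Ux /=; rewrite mulrA. Qed.
Fact sh_mulC : commutative sh_mul.
Proof. by move=> s t; apply: sh_secP => x Ux /=; rewrite mulrC. Qed.
Fact sh_mul1 : left_id (sh_cst 1) sh_mul.
Proof. by move=> s; apply: sh_secP => x Ux /=; rewrite rmorph1 mul1r. Qed.
Fact sh_mulDl : left_distributive sh_mul +%R.
Proof. by move=> s t u; apply: sh_secP => x Ux /=; rewrite mulrDl. Qed.
HB.instance Definition _ := GRing.Zmodule_isComPzRing.Build (sh_sec U)
  sh_mulA sh_mulC sh_mul1 sh_mulDl.

Fact sh_cst_zmod : zmod_morphism sh_cst.
Proof. by move=> a b; apply: sh_secP => x Ux /=; rewrite rmorphB. Qed.
Fact sh_cst_monoid : monoid_morphism sh_cst.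
Proof. by split=> [//|a b]; apply: sh_secP => x Ux /=; rewrite rmorphM. Qed.
HB.instance Definition _ := GRing.isZmodMorphism.Build F (sh_sec U) sh_cst
  sh_cst_zmod.
HB.instance Definition _ := GRing.isMonoidMorphism.Build F (sh_sec U) sh_cst
  sh_cst_monoid.

Definition sh_calg : calg F := CAlg sh_cst.
End Sections.

Fact sh_res_loc (U V : opens X) (i : V `<=` U) (s : sh_sec U) :
  @locally_section V (fun x Vx => s x (i x Vx)).
Proof.
move=> x Vx; have [W [t [Wx WU E]]] := sh_locP s (i x Vx).
have ZW : opens_setI V W `<=` W by move=> y [].
exists (opens_setI V W), (res ZW t); split=> [//|y []//|y Vy [Vy' Wy]].
by rewrite -(germ_of_res ZW Wy) (E _ _ Wy).
Qed.
Definition sh_res (U V : opens X) (i : V `<=` U) (s : sh_calg U) : sh_calg V :=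
  ShSec (sh_res_loc i s).

Fact sh_res_hom (U V : opens X) (i : V `<=` U) : is_alg_hom (sh_res i).
Proof. by split=> *; apply: sh_secP. Qed.
Fact sh_res_id (U : opens X) (i : U `<=` U) s : sh_res i s = s.
Proof. by apply: sh_secP => x Ux /=; congr (sh_fun s _); apply: Prop_irrelevance. Qed.
Fact sh_res_res (U V W : opens X) (i : V `<=` U) (j : W `<=` V) (k : W `<=` U) s :
  sh_res j (sh_res i s) = sh_res k s.
Proof. by apply: sh_secP => x Wx /=; congr (sh_fun s _); apply: Prop_irrelevance. Qed.

Definition sheafify : presheaf F X := Presheaf sh_res_hom sh_res_id sh_res_res.
End Sheafification.

Record ringed_space (F : fieldType) := RingedSpace {
  rs_top :> topologicalType;
  rs_sheaf : presheaf F rs_top }.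

Definition is_sheaf (F : fieldType) (X : topologicalType) (O : presheaf F X) :
    Prop :=
  forall (U : opens X) (I : Type) (V : I -> opens X)
    (VU : forall i, V i `<=` U), U `<=` \bigcup_i (V i : set X) ->
  forall s : forall i, O (V i),
    (forall i j (W : opens X) (Wi : W `<=` V i) (Wj : W `<=` V j),
        res Wi (s i) = res Wj (s j)) ->
  exists! t : O U, forall i, res (VU i) t = s i.

Definition ring_ideal (A : comPzRingType) (m : set A) : Prop :=
  [/\ m 0, forall x y, m x -> m y -> m (x + y) & forall r x, m x -> m (r * x)].

Definition maximal_ideal (A : comPzRingType) (m : set A) : Prop :=
  [/\ ring_ideal m, ~ m 1 &
      forall a : set A, ring_ideal a -> m `<=` a -> ~ a 1 -> a = m].

Definition is_local_ring (A : comPzRingType) : Prop :=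
  exists! m : set A, maximal_ideal m.

Definition locally_ringed (F : fieldType) (X : ringed_space F) : Prop :=
  is_sheaf (rs_sheaf X) /\ forall x : X, is_local_ring (stalk (rs_sheaf X) x).

Definition opens_preim (X Y : topologicalType) (f : X -> Y) (cf : continuous f)
  (V : opens Y) : opens X :=
  Opens ((continuousP f).1 cf V (opensP V)).

(** An isomorphism of ringed spaces: a homeomorphism [ri_fun] and an isomorphism
    from the sheaf of [Y] to the direct image of the sheaf of [X].  It induces
    isomorphisms, hence local homomorphisms, on stalks. *)
Record rs_iso (F : fieldType) (X Y : ringed_space F) := RsIso {
  ri_fun : X -> Y;
  ri_inv : Y -> X;
  ri_funK : cancel ri_fun ri_inv;
  ri_invK : cancel ri_inv ri_fun;
  ri_cont : continuous ri_fun;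
  ri_inv_cont : continuous ri_inv;
  ri_sh : forall V : opens Y,
    rs_sheaf Y V -> rs_sheaf X (opens_preim ri_cont V);
  ri_hom : forall V, is_alg_hom (@ri_sh V);
  ri_bij : forall V, bijective (@ri_sh V);
  ri_res : forall (U V : opens Y) (i : V `<=` U)
    (j : opens_preim ri_cont V `<=` opens_preim ri_cont U) s,
    ri_sh (res i s) = res j (ri_sh s) }.

Section DirectImage.
Context (F : fieldType) (X Y : topologicalType) (f : X -> Y) (cf : continuous f).
Context (O : presheaf F X).

Fact preim_sub (U V : opens Y) : V `<=` U -> opens_preim cf V `<=` opens_preim cf U.
Proof. by move=> i x /i. Qed.

Definition direct_image : presheaf F Y :=
  @Presheaf F Y (fun V => O (opens_preim cf V)) (fun U V i => res (preim_sub i))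
    (fun U V i => res_hom O _) (fun U i => res_id _)
    (fun U V W i j k => res_res (preim_sub i) (preim_sub j) (preim_sub k)).
End DirectImage.

Section OpenSubspace.
Context (F : fieldType) (X : ringed_space F) (U : opens X).

Fact opens_im_open (V : opens (set_type U)) : open (set_val @` (V : set (set_type U))).
Proof.
case: V => /= _ [W oW <-].
suff -> : set_val @` (set_val @^-1` W : set (set_type U)) = W `&` U.
  by apply: openI => //; exact: opensP.
apply/seteqP; split=> [_ [x /= Wx <-]|x [Wx Ux]].
  by split=> //; exact: set_valP.
by exists (exist _ x (mem_set Ux)).
Qed.
Definition opens_im (V : opens (set_type U)) : opens X := Opens (opens_im_open V).

Fact opens_im_sub (V W : opens (set_type U)) : W `<=` V -> opens_im W `<=` opens_im V.
Proof. by move=> i; exact: image_subset. Qed.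

Definition open_subspace : ringed_space F :=
  @RingedSpace F (set_type U)
    (@Presheaf F (set_type U) (fun V => rs_sheaf X (opens_im V))
      (fun V W i => res (opens_im_sub i))
      (fun V W i => res_hom _ _) (fun V i => res_id _)
      (fun V W Z i j k =>
         res_res (opens_im_sub i) (opens_im_sub j) (opens_im_sub k))).
End OpenSubspace.

Section ProjSheaf.
Context (F : fieldType) (G : zmodType) (R : graded_alg F G).

Section Fractions.
Context (U : set (proj R)).

Definition nonvanishing (b : R) : Prop :=
  homog b /\ forall Q, U Q -> ~ (Q : set R) b.

Record frac := Frac {
  fr_deg : G;
  fr_num : R;
  fr_den : R;
  fr_degP : ga_deg R fr_deg;
  fr_numP : ga_comp fr_deg fr_num;
  fr_denP : ga_comp fr_deg fr_den;
  fr_den_nv : forall Q, U Q -> ~ (Q : set R) fr_den }.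

(** Equality of [a/b] and [a'/b'] in the localization of [R] at the
    multiplicative set [nonvanishing].  For [U] empty, [0] is nonvanishing and
    the fractions form the zero ring; this value does not enter the
    sheafification, whose germs are taken at points. *)
Definition frac_eqv (x y : frac) : Prop :=
  exists2 t, nonvanishing t &
    t * (fr_num x * fr_den y) = t * (fr_num y * fr_den x).

Lemma nv_mul s t : nonvanishing s -> nonvanishing t -> nonvanishing (s * t).
Proof.
move=> [hs ns] [ht nt]; split; first exact: homogM.
by move=> Q UQ; have [_ _ pr] := ptP Q => /pr[/(ns _ UQ)|/(nt _ UQ)].
Qed.
Lemma nv_one : nonvanishing 1.
Proof. by split; [exact: homog1|move=> Q _; case: (ptP Q)]. Qed.
Lemma nv_den x : nonvanishing (fr_den x).
Proof.
split; last exact: fr_den_nv.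
by apply/homogE; exists (fr_deg x); [exact: fr_degP|exact: fr_denP].
Qed.

Fact frac_refl x : frac_eqv x x. Proof. by exists 1 => //; exact: nv_one. Qed.
Fact frac_sym x y : frac_eqv x y -> frac_eqv y x.
Proof. by case=> t nt E; exists t. Qed.
Fact frac_trans x y z : frac_eqv x y -> frac_eqv y z -> frac_eqv x z.
Proof.
case=> t nt E [s ns E']; exists (s * t * fr_den y).
  by apply: nv_mul; [exact: nv_mul|exact: nv_den].
have -> : s * t * fr_den y * (fr_num x * fr_den z) =
  s * fr_den z * (t * (fr_num x * fr_den y)) by ring.
rewrite E; have -> : s * fr_den z * (t * (fr_num y * fr_den x)) =
  t * fr_den x * (s * (fr_num y * fr_den z)) by ring.
by rewrite E'; ring.
Qed.
Definition frac_setoid := Setoid frac_refl frac_sym frac_trans.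

Lemma ga_compD La (x y : R) :
  ga_deg R La -> ga_comp La x -> ga_comp La y -> ga_comp La (x + y).
Proof. by move=> dL cx cy; rewrite -(scale1r x); apply: ga_compP. Qed.
Lemma ga_compZ La c (x : R) :
  ga_deg R La -> ga_comp La x -> ga_comp La (c *: x).
Proof. by move=> dL cx; rewrite -(addr0 (c *: x)); apply/ga_compP/ga_comp0. Qed.
Lemma ga_compN La (x : R) : ga_deg R La -> ga_comp La x -> ga_comp La (- x).
Proof. by move=> dL cx; rewrite -scaleN1r; apply: ga_compZ. Qed.

Fact frac_den_mul x y Q : U Q -> ~ (Q : set R) (fr_den x * fr_den y).
Proof. exact: (nv_mul (nv_den x) (nv_den y)).2. Qed.

Fact frac_add_num x y : ga_comp (fr_deg x + fr_deg y)
  (fr_num x * fr_den y + fr_num y * fr_den x).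
Proof.
have [dx dy] := (fr_degP x, fr_degP y).
apply: ga_compD; first exact: ga_degD.
  by apply: ga_compM => //; [exact: fr_numP|exact: fr_denP].
rewrite addrC; apply: ga_compM => //; [exact: fr_numP|exact: fr_denP].
Qed.
Definition frac_add (x y : frac) : frac :=
  Frac (ga_degD (fr_degP x) (fr_degP y)) (frac_add_num x y)
    (ga_compM (fr_degP x) (fr_degP y) (fr_denP x) (fr_denP y))
    (@frac_den_mul x y).
Definition frac_mul (x y : frac) : frac :=
  Frac (ga_degD (fr_degP x) (fr_degP y))
    (ga_compM (fr_degP x) (fr_degP y) (fr_numP x) (fr_numP y))
    (ga_compM (fr_degP x) (fr_degP y) (fr_denP x) (fr_denP y))
    (@frac_den_mul x y).
Definition frac_opp (x : frac) : frac :=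
  Frac (fr_degP x) (ga_compN (fr_degP x) (fr_numP x)) (fr_denP x) (@fr_den_nv x).
Definition frac_cst (c : F) : frac :=
  Frac (ga_deg0 R) (ga_compZ c (ga_deg0 R) (ga_comp1 R)) (ga_comp1 R) nv_one.2.

Fact frac_opp_eqv x x' : frac_eqv x x' -> frac_eqv (frac_opp x) (frac_opp x').
Proof. by case=> t nt E; exists t => //=; rewrite !mulNr !mulrN E. Qed.
Fact frac_add_eqv x x' y y' : frac_eqv x x' -> frac_eqv y y' ->
  frac_eqv (frac_add x y) (frac_add x' y').
Proof.
case=> t nt E [s ns E']; exists (t * s); first exact: nv_mul.
rewrite /=; transitivity (s * fr_den y * fr_den y' * (t * (fr_num x * fr_den x')) +
  t * fr_den x * fr_den x' * (s * (fr_num y * fr_den y'))); first by ring.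
by rewrite E E'; ring.
Qed.
Fact frac_mul_eqv x x' y y' : frac_eqv x x' -> frac_eqv y y' ->
  frac_eqv (frac_mul x y) (frac_mul x' y').
Proof.
case=> t nt E [s ns E']; exists (t * s); first exact: nv_mul.
rewrite /=; transitivity ((t * (fr_num x * fr_den x')) *
  (s * (fr_num y * fr_den y'))); first by ring.
by rewrite E E'; ring.
Qed.

Lemma frac_eqv1 x y : fr_num x * fr_den y = fr_num y * fr_den x -> frac_eqv x y.
Proof. by move=> E; exists 1; [exact: nv_one|rewrite E]. Qed.

Fact frac_addA x y z :
  frac_eqv (frac_add x (frac_add y z)) (frac_add (frac_add x y) z).
Proof. by apply: frac_eqv1 => /=; ring. Qed.
Fact frac_addC x y : frac_eqv (frac_add x y) (frac_add y x).
Proof. by apply: frac_eqv1 => /=; ring. Qed.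
Fact frac_add0 x : frac_eqv (frac_add (frac_cst 0) x) x.
Proof. by apply: frac_eqv1; rewrite /= scale0r; ring. Qed.
Fact frac_addN x : frac_eqv (frac_add (frac_opp x) x) (frac_cst 0).
Proof. by apply: frac_eqv1; rewrite /= scale0r; ring. Qed.
Fact frac_mulA x y z :
  frac_eqv (frac_mul x (frac_mul y z)) (frac_mul (frac_mul x y) z).
Proof. by apply: frac_eqv1 => /=; ring. Qed.
Fact frac_mulC x y : frac_eqv (frac_mul x y) (frac_mul y x).
Proof. by apply: frac_eqv1 => /=; ring. Qed.
Fact frac_mul1 x : frac_eqv (frac_mul (frac_cst 1) x) x.
Proof. by apply: frac_eqv1; rewrite /= scale1r; ring. Qed.
Fact frac_mulDl x y z : frac_eqv (frac_mul (frac_add x y) z)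
  (frac_add (frac_mul x z) (frac_mul y z)).
Proof. by apply: frac_eqv1 => /=; ring. Qed.

Definition frac_prering : prering :=
  @PreRing frac_setoid (frac_cst 0) (frac_cst 1) frac_opp frac_add frac_mul
    frac_opp_eqv frac_add_eqv frac_mul_eqv frac_addA frac_addC frac_add0
    frac_addN frac_mulA frac_mulC frac_mul1 frac_mulDl.

Definition frac_ring : comPzRingType := pr_quot frac_prering.
Definition frac_str (c : F) : frac_ring := cls (frac_cst c : frac_prering).
Fact frac_str_zmod : zmod_morphism frac_str.
Proof.
move=> a b; rewrite [X in _ = _ + X]pr_quotN [RHS]pr_quotD.
by apply/clsP/frac_eqv1; rewrite /= scalerBl; ring.
Qed.
Fact frac_str_monoid : monoid_morphism frac_str.
Proof.
split=> [//|a b]; rewrite [RHS]pr_quotM; apply/clsP/frac_eqv1 => /=.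
by rewrite !mulr1 -scalerAl mul1r scalerA.
Qed.
HB.instance Definition _ := GRing.isZmodMorphism.Build F frac_ring frac_str
  frac_str_zmod.
HB.instance Definition _ := GRing.isMonoidMorphism.Build F frac_ring frac_str
  frac_str_monoid.
Definition frac_alg : calg F := CAlg frac_str.
End Fractions.

Definition frac_sub (U V : set (proj R)) (i : V `<=` U) (x : frac U) : frac V :=
  Frac (fr_degP x) (fr_numP x) (fr_denP x) (fun Q VQ => @fr_den_nv _ x Q (i Q VQ)).

Definition frac_res (U V : set (proj R)) (i : V `<=` U) (x : frac_alg U) :
  frac_alg V := cls (frac_sub i (rpr x) : frac_prering V).

Lemma frac_resE (U V : set (proj R)) (i : V `<=` U) (x : frac U) :
  frac_res i (cls (x : frac_prering U)) = cls (frac_sub i x : frac_prering V).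
Proof.
apply/clsP; have [t [ht nt] E] := @rpr_cls (frac_prering U) x; exists t => //.
by split=> // Q /i; exact: nt.
Qed.

Fact frac_res_hom (U V : set (proj R)) (i : V `<=` U) : is_alg_hom (frac_res i).
Proof.
split=> [x y|x y|c].
- rewrite -(rprK x) -(rprK y) pr_quotD !frac_resE [RHS]pr_quotD.
  by apply/clsP/frac_eqv1.
- rewrite -(rprK x) -(rprK y) pr_quotM !frac_resE [RHS]pr_quotM.
  by apply/clsP/frac_eqv1.
- by rewrite frac_resE; apply/clsP/frac_eqv1.
Qed.
Fact frac_res_id (U : set (proj R)) (i : U `<=` U) x : frac_res i x = x.
Proof. by rewrite -(rprK x) frac_resE; apply/clsP/frac_eqv1. Qed.
Fact frac_res_res (U V W : set (proj R)) (i : V `<=` U) (j : W `<=` V)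
  (k : W `<=` U) x : frac_res j (frac_res i x) = frac_res k x.
Proof. by rewrite -(rprK x) !frac_resE; apply/clsP/frac_eqv1. Qed.

Definition proj_presheaf : presheaf F (proj R) :=
  @Presheaf F (proj R) (fun U => frac_alg U) (fun U V i => frac_res i)
    (fun U V i => frac_res_hom i) (fun U i => frac_res_id i)
    (fun U V W i j k => frac_res_res i j k).

Definition Proj : ringed_space F := RingedSpace (sheafify proj_presheaf).
End ProjSheaf.

(** A face [D] of the degree monoid: a submonoid whose complement is an ideal. *)
Record deg_face (F : fieldType) (G : zmodType) (R : graded_alg F G) := DegFace {
  df_set :> set G;
  df0 : df_set 0;
  dfD : forall La N, ga_deg R La -> ga_deg R N ->
    df_set La -> df_set N -> df_set (La + N);
  df_ext : forall La N, ga_deg R La -> ga_deg R N ->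
    df_set (La + N) -> df_set La }.

Section FaceSubalgebra.
Context (F : fieldType) (G : zmodType) (R : graded_alg F G) (D : deg_face R).

Definition fsub_pred : {pred R} := fun x => `[< deg_span D x >].

Lemma fsub_predP x : reflect (deg_span D x) (x \in fsub_pred).
Proof. exact: asboolP. Qed.

Lemma homog_inZ (E : set G) c (x : R) : homog_in E x -> homog_in E (c *: x).
Proof. by case=> La [dL EL cx]; exists La; split=> //; exact: ga_compZ. Qed.

Lemma deg_spanZ (E : set G) c (x : R) : deg_span E x -> deg_span E (c *: x).
Proof.
elim=> [|y z hy _ IH]; first by rewrite scaler0; exact: addspan0.
by rewrite scalerDr; apply: addspanD => //; exact: homog_inZ.
Qed.

Lemma deg_spanM (E E' E'' : set G) (x y : R) :
  (forall La N, ga_deg R La -> ga_deg R N -> E La -> E' N -> E'' (La + N)) ->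
  deg_span E x -> deg_span E' y -> deg_span E'' (x * y).
Proof.
move=> EE; elim=> [|u v hu _ IH] sy; first by rewrite mul0r; exact: addspan0.
rewrite mulrDl; apply: addspan_add; last exact: IH.
case: hu => La [dL EL cu] {IH}.
elim: sy => [|s t [N [dN EN cs]] _ IH]; first by rewrite mulr0; exact: addspan0.
rewrite mulrDr; apply: addspanD => //; exists (La + N).
by split; [exact: ga_degD|exact: EE|exact: ga_compM].
Qed.

Fact fsub_closed : GRing.subalg_closed fsub_pred.
Proof.
split.
- apply/fsub_predP/sub_addspan; exists 0.
  by split; [exact: ga_deg0|exact: df0|exact: ga_comp1].
- move=> c x y /fsub_predP sx /fsub_predP sy; apply/fsub_predP.
  by apply: addspan_add => //; exact: deg_spanZ.
- move=> x y /fsub_predP sx /fsub_predP sy; apply/fsub_predP.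
  by apply: deg_spanM sx sy => La N; exact: dfD.
Qed.
HB.instance Definition _ := GRing.isSubalgClosed.Build F R fsub_pred fsub_closed.

Record fsub := FSub { fs_val : R; _ : fs_val \in fsub_pred }.
HB.instance Definition _ := [isSub for fs_val].
HB.instance Definition _ := [Choice of fsub by <:].
HB.instance Definition _ := [SubChoice_isSubComNzRing of fsub by <:].
HB.instance Definition _ := [SubZmodule_isSubLmodule of fsub by <:].
HB.instance Definition _ := [SubNzRing_SubLmodule_isSubLalgebra of fsub by <:].
HB.instance Definition _ := [SubLalgebra_isSubAlgebra of fsub by <:].

Fact fsub_comp0 La : (ga_deg R `&` D) La -> ga_comp La (\val (0 : fsub)).
Proof. by case=> dL _; exact: ga_comp0. Qed.
Fact fsub_compP La c (x y : fsub) : (ga_deg R `&` D) La ->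
  ga_comp La (\val x) -> ga_comp La (\val y) -> ga_comp La (\val (c *: x + y)).
Proof. by case=> dL _; exact: ga_compP. Qed.
Fact fsub_compM La N (x y : fsub) : (ga_deg R `&` D) La -> (ga_deg R `&` D) N ->
  ga_comp La (\val x) -> ga_comp N (\val y) -> ga_comp (La + N) (\val (x * y)).
Proof. by case=> dL _ [dN _]; exact: ga_compM. Qed.
Fact fsub_degD La N : (ga_deg R `&` D) La -> (ga_deg R `&` D) N ->
  (ga_deg R `&` D) (La + N).
Proof. by case=> dL DL [dN DN]; split; [exact: ga_degD|exact: dfD]. Qed.

Lemma fs_valP (x : fsub) : deg_span D (\val x).
Proof. exact/fsub_predP/(valP x). Qed.

Fact fsub_span (x : fsub) : addspan
  [set y : fsub | exists2 La, (ga_deg R `&` D) La & ga_comp La (\val y)] x.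
Proof.
have [y] : exists y, y = \val x by eexists.
move=> Ey; have := fs_valP x; rewrite -Ey => sy.
elim: sy x Ey => [|u v [La [dL DL cu]] sv IH] x Ex.
  by have -> : x = 0 by [apply: val_inj]; exact: addspan0.
have uD : u \in fsub_pred by apply/fsub_predP/sub_addspan; exists La.
have vD : v \in fsub_pred by apply/fsub_predP.
have -> : x = FSub uD + FSub vD by apply: val_inj; rewrite -Ex.
by apply: addspanD; [exists La|exact: IH].
Qed.

Fact fsub_indep (s : seq G) (y : G -> fsub) : uniq s ->
  (forall La, La \in s -> (ga_deg R `&` D) La /\ ga_comp La (\val (y La))) ->
  \sum_(La <- s) y La = 0 -> forall La, La \in s -> y La = 0.
Proof.
move=> us ys /(congr1 val); rewrite raddf_sum => E La sL; apply: val_inj.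
by apply: (ga_indep us _ E) => // N /ys[[]].
Qed.

(** [\bigoplus_(La in ga_deg R `&` D) R_La], graded by [ga_deg R `&` D]. *)
Definition face_subalg : graded_alg F G :=
  @GradedAlg F G fsub (ga_deg R `&` D) (fun La => [set x | ga_comp La (\val x)])
    (conj (ga_deg0 R) (df0 D)) fsub_degD fsub_comp0 fsub_compP (ga_comp1 R)
    fsub_compM fsub_span fsub_indep.

Definition off_face : set R := deg_span (~` D).

Lemma deg_span_indep (E : set G) (x : R) : deg_span E x ->
  exists (s : seq G) (y : G -> R), [/\ uniq s,
    forall La, La \in s -> [/\ ga_deg R La, E La & ga_comp La (y La)] &
    x = \sum_(La <- s) y La].
Proof.
elim=> [|u v [N [dN EN cu]] _ [s [y [us ys ->]]]].
  by exists [::], (fun=> 0); rewrite big_nil.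
have [sN|sN] := boolP (N \in s).
  exists s, (fun La => y La + (if La == N then u else 0)); split=> //.
    move=> La /ys[dL EL cL]; split=> //; case: eqP => [->|_]; last by rewrite addr0.
    by apply: ga_compD => //; have [] := ys N sN.
  rewrite big_split /= [RHS]addrC; congr (_ + _).
  by rewrite (bigD1_seq N) //= eqxx big1 ?addr0 // => La /negbTE ->.
exists (N :: s), (fun La => if La == N then u else y La); split=> /=.
- by rewrite sN.
- move=> La; rewrite inE; case: eqP => [-> _|_ /= /ys//]; by split.
- rewrite big_cons eqxx; congr (_ + _); apply: eq_big_seq => La sL.
  by case: eqP sL sN => // -> ->.
Qed.

Lemma on_off_face (x : R) : deg_span D x -> off_face x -> x = 0.
Proof.
move=> /deg_span_indep[s [y [us ys Ey]]] /deg_span_indep[t [z [ut zt Ez]]].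
have st La : La \in t -> La \notin s.
  by move=> /zt[_ nD _]; apply/negP => /ys[_ /nD].
pose w La := if La \in s then y La else - z La.
have ust : uniq (s ++ t).
  by rewrite cat_uniq us ut andbT; apply/hasPn => La /st.
have w0 : \sum_(La <- s ++ t) w La = 0.
  rewrite big_cat /= (eq_big_seq (y : G -> R)) -?Ey => [|La sL]; last by rewrite /w sL.
  rewrite (eq_big_seq (fun La => - z La)) => [|La /st/negbTE tL]; last by rewrite /w tL.
  by rewrite sumrN -Ez subrr.
rewrite Ey big_seq big1 // => La sL.
have := ga_indep ust _ w0 (La := La); rewrite /w mem_cat sL; apply=> // N.
rewrite mem_cat => /orP[sN|tN]; first by rewrite sN; have [] := ys _ sN.
by rewrite (negbTE (st _ tN)); have [? _ ?] := zt _ tN; split=> //; exact: ga_compN.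
Qed.

Lemma off_faceM (x r : R) : off_face r -> off_face (x * r).
Proof.
have sx : deg_span setT x by exact: homog_span.
apply: deg_spanM sx => La N dL dN _ nDN DLN; apply: nDN.
by apply: (df_ext dN dL); rewrite addrC.
Qed.

Lemma homog_face (x : R) : homog x ->
  (exists2 u : face_subalg, homog u & x = \val u) \/ homog_in (~` D) x.
Proof.
move=> /homogE[La dL cx]; have [DL|nDL] := pselect ((D : set G) La); [left|by right; exists La].
have xD : x \in fsub_pred by apply/fsub_predP/sub_addspan; exists La.
by exists (FSub xD) => //; apply/homogE; exists La.
Qed.

Lemma face_decomp (x : R) : exists (u : face_subalg) (r : R),
  off_face r /\ x = \val u + r.
Proof.
elim: (homog_span x) => [|y z hy _ [u [r [Or ->]]]].
  by exists 0, 0; split; [exact: addspan0|rewrite addr0].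
case: (homog_face hy) => [[v _ ->]|Oy].
  by exists (v + u), r; split=> //; rewrite addrA.
exists u, (y + r); split; first exact: addspanD.
by rewrite addrCA.
Qed.

(** [Q ↦ Q ⊕ \bigoplus_(La notin D) R_La] *)
Definition face_ext_set (Q : set face_subalg) : set R :=
  [set x | exists (u : face_subalg) (r : R), [/\ Q u, off_face r & x = \val u + r]].

Section FaceExt.
Context (Q : proj face_subalg).
Local Notation E := (face_ext_set Q).

Lemma face_ext_val (u : face_subalg) : E (\val u) -> (Q : set _) u.
Proof.
case=> v [r [Qv Or Ev]]; suff -> : u = v by [].
apply: val_inj; apply/eqP; rewrite -subr_eq0; apply/eqP/on_off_face.
  by have := fs_valP (u - v); rewrite raddfB.
by rewrite Ev addrAC subrr add0r.
Qed.

Fact face_ext_ideal : is_ideal E.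
Proof.
have [[[Q0 QD QM] _] _ _] := ptP Q; split.
- by exists 0, 0; split=> //; [exact: addspan0|rewrite addr0].
- move=> _ _ [u [r [Qu Or ->]]] [v [s [Qv Os ->]]]; exists (u + v), (r + s).
  by split; [exact: QD|exact: addspan_add|rewrite [RHS]addrACA].
- move=> x _ [u [r [Qu Or ->]]]; have [v [s [Os ->]]] := face_decomp x.
  exists (v * u), (\val u * s + (\val v + s) * r); split; first exact: QM.
    by apply: addspan_add; apply: off_faceM.
  by rewrite mulrDr mulrDl -addrA (mulrC s).
Qed.

Fact face_ext_hprime : is_hprime E.
Proof.
have [[[Q0 QD QM] hQ] Q1 Qpr] := ptP Q; have [E0 ED EM] := face_ext_ideal.
split; first split; first exact: face_ext_ideal.
- move=> _ [u [r [Qu Or ->]]]; apply: addspan_add.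
    elim: (hQ u Qu) => [|v w [Qv hv] _ IH]; first exact: addspan0.
    apply: addspanD => //; split.
      by exists v, 0; split=> //; [exact: addspan0|rewrite addr0].
    by move/homogE: hv => [La [dL DL] cv]; apply/homogE; exists La.
  apply: addspan_mono Or => s hs; split.
    by exists 0, s; split=> //; [exact: sub_addspan|rewrite add0r].
  by case: hs => La [dL _ cs]; exists La.
- by move=> E1; apply/Q1/face_ext_val.
- move=> x y; have [u [r [Or ->]]] := face_decomp x.
  have [v [s [Os ->]]] := face_decomp y => Exy.
  have /face_ext_val/Qpr : E (\val (u * v : face_subalg)).
    have -> : \val (u * v : face_subalg) = (\val u + r) * (\val v + s) +
        (-1) * (\val u * s + (\val v + s) * r).
      by rewrite /=; ring.
    apply: ED => //; apply: EM; exists 0, (\val u * s + (\val v + s) * r).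
    split=> //; last by rewrite add0r.
    by apply: addspan_add; apply: off_faceM.
  by case=> [Qu|Qv]; [left; exists u, r|right; exists v, s].
Qed.
End FaceExt.

Definition face_ext (Q : proj face_subalg) : proj R := ProjPoint (face_ext_hprime Q).

Fact face_ext_cont : continuous face_ext.
Proof.
apply/continuousP => _ [a [ia ha] ->].
pose X := [set u : face_subalg | homog u /\ a (\val u)].
exists (ideal_gen X); first by apply: ideal_gen_hideal => u [].
congr (~` _); apply/seteqP; split=> Q; have [[[Q0 QD QM] hQ] _ _] := ptP Q.
  move=> /= aQ; apply: ideal_gen_sub => // u [hu au].
  exact/face_ext_val/aQ.
have [[[E0 ED EM] _] _ _] := ptP (face_ext Q).
move=> /= XQ x /ha; apply: addspan_sub => // y [ay] /homog_face[[u hu Eu]|hy].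
  exists u, 0; split; [apply/XQ/sub_ideal_gen|exact: addspan0|by rewrite addr0].
  by split=> //; rewrite -Eu.
by exists 0, y; split=> //; [exact: sub_addspan|rewrite add0r].
Qed.

(** The closed subset of [proj R] attached to [D], with the structure sheaf
    transported along the homeomorphism [face_ext]. *)
Definition face_closed : set (proj R) := vanishing off_face.

Fact face_ext_closed (Q : proj face_subalg) : face_ext Q \in face_closed.
Proof.
apply/mem_set => r Or; have [[[Q0 _ _] _] _ _] := ptP Q.
by exists 0, r; split=> //; rewrite add0r.
Qed.
Definition face_homeo (Q : proj face_subalg) : set_type face_closed :=
  exist _ (face_ext Q) (face_ext_closed Q).

Fact face_homeo_cont : continuous face_homeo.
Proof.
apply/continuousP => _ [B oB <-].
exact: (continuousP face_ext).1 face_ext_cont B oB.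
Qed.

Definition face_closed_space : ringed_space F :=
  @RingedSpace F (set_type face_closed)
    (direct_image face_homeo_cont (rs_sheaf (Proj face_subalg))).
End FaceSubalgebra.

Section Spec.
Context (F : fieldType) (A : comAlgType F).

Fact triv_degD (La N : int) : [set 0 : int] La -> [set 0 : int] N ->
  [set 0 : int] (La + N).
Proof. by move=> -> ->; rewrite /= addr0. Qed.
Fact triv_span (x : A) :
  addspan [set y : A | exists2 La : int, [set 0 : int] La & setT y] x.
Proof. by rewrite -(addr0 x); apply: addspanD; [exists 0|exact: addspan0]. Qed.
Fact triv_indep (s : seq int) (y : int -> A) : uniq s ->
  (forall La, La \in s -> [set 0 : int] La /\ [set: A] (y La)) ->
  \sum_(La <- s) y La = 0 -> forall La, La \in s -> y La = 0.
Proof.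
move=> us ys E La sL; rewrite -E (bigD1_seq La) //= big_seq_cond big1 ?addr0 //.
move=> N /andP[/ys[-> _]]; have [-> _] := ys _ sL.
by rewrite eqxx.
Qed.

Definition triv_graded : graded_alg F int :=
  @GradedAlg F int A [set 0] (fun _ => setT) erefl triv_degD
    (fun _ _ => Logic.I) (fun _ _ _ _ _ _ _ => Logic.I) Logic.I
    (fun _ _ _ _ _ _ _ _ => Logic.I) triv_span triv_indep.

(** For this grading every ideal is homogeneous, so the points are all the prime
    ideals of [A] with the Zariski topology, and the presheaf of fractions is
    [U ↦ S_U^-1 A], [S_U] the complement of the union of the primes in [U]. *)
Definition Spec : ringed_space F := Proj triv_graded.
End Spec.

Definition is_affine (F : fieldType) (X : ringed_space F) : Prop :=
  exists A : comAlgType F, inhabited (rs_iso X (Spec A)).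

(** Schemes, in the category of locally ringed spaces of [F]-algebras. *)
Definition is_scheme (F : fieldType) (X : ringed_space F) : Prop :=
  locally_ringed X /\
  forall x : X, exists U : opens X,
    (U : set X) x /\ is_affine (open_subspace U).

Section CartanAlgebra.
Context (F : fieldType) (n k : nat) (A : 'M[int]_n).
Context (alpha : 'I_n -> 'rV[int]_(n + k)).
Local Notation P := 'rV[int]_(n + k).
Local Notation g := (kac_moody F A alpha).

(** [CA] is the direct sum of the restricted duals of the [L La], for a family
    of modules [L La] with fixed vectors [v La] (only [La] in [Pplus] matters):
    its component of degree [La] is a copy, under [ca_in La], of the restricted dual of [L La],
    and the product of [phi] and [psi] is [(phi ⊗ psi) ∘ ca_Phi].  These
    conditions determine [ca_Phi] on [Pplus], hence the graded algebra, up to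
    unique isomorphism. *)
Record cartan_algebra (L : P -> lie_module g) (v : forall La, L La) :=
  CartanAlgebra {
  ca_graded :> graded_alg F P;
  ca_deg : ga_deg ca_graded = @Pplus n k;
  ca_in : forall La, (L La -> F) -> ca_graded;
  ca_in_lin : forall La c phi psi, Pplus La ->
    restricted_dual phi -> restricted_dual psi ->
    @ca_in La (fun w => c * phi w + psi w) = c *: ca_in phi + ca_in psi;
  ca_in_inj : forall La phi psi, Pplus La ->
    restricted_dual phi -> restricted_dual psi ->
    @ca_in La phi = ca_in psi -> phi = psi;
  ca_comp : forall La, Pplus La ->
    @ga_comp _ _ ca_graded La = @ca_in La @` @restricted_dual F n k A alpha (L La);
  ca_Phi : forall La N, L (La + N) -> tensor (L La) (L N);
  ca_Phi_hom : forall La N, Pplus La -> Pplus N -> is_lie_hom (@ca_Phi La N);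
  ca_Phi_hw : forall La N, Pplus La -> Pplus N ->
    @ca_Phi La N (v (La + N)) = tpure (v La) (v N);
  ca_mul : forall La N phi psi, Pplus La -> Pplus N ->
    restricted_dual phi -> restricted_dual psi ->
    @ca_in La phi * @ca_in N psi =
    @ca_in (La + N) (fun w => tens_fun phi psi (ca_Phi w)) }.

Context (L : P -> lie_module g) (v : forall La, L La).
Context (CA : cartan_algebra v) (J : {set 'I_n}).

Fact face0 : face J (0 : P).
Proof. by split=> i _; rewrite /at_coroot mxE. Qed.
Fact faceD (La N : P) : ga_deg CA La -> ga_deg CA N ->
  face J La -> face J N -> face J (La + N).
Proof.
move=> _ _ [zL pL] [zN pN]; split=> i iJ; rewrite /at_coroot mxE.
  by rewrite [X in X + _]zL // [X in _ + X]zN.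
by apply: addr_ge0; [exact: pL|exact: pN].
Qed.
Fact face_ext_deg (La N : P) : ga_deg CA La -> ga_deg CA N ->
  face J (La + N) -> face J La.
Proof.
rewrite ca_deg => pL pN [z _]; split=> i iJ; last exact: pL.
have /eqP := z i iJ; rewrite /at_coroot mxE paddr_eq0; last exact: (pN i).
  by case/andP => /eqP.
exact: (pL i).
Qed.
Definition ca_face : deg_face CA := DegFace face0 faceD face_ext_deg.

Definition Orbar : set (proj CA) := face_closed ca_face.
Definition Orbar_space : ringed_space F := face_closed_space ca_face.
End CartanAlgebra.
Arguments Orbar {F n k A alpha L v} CA J.
Arguments Orbar_space {F n k A alpha L v} CA J.

Section Strata.
Context (F : fieldType) (n k : nat) (A : 'M[int]_n).
Context (alpha : 'I_n -> 'rV[int]_(n + k)).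
Context (L : 'rV[int]_(n + k) -> lie_module (kac_moody F A alpha)).
Context (v : forall La, L La) (CA : cartan_algebra v) (J : {set 'I_n}).

Definition Or : set (proj CA) :=
  Orbar CA J `\` \bigcup_(K in [set K : {set 'I_n} | J \proper K]) Orbar CA K.

Lemma vanishing_hideal_closed (G : zmodType) (R : graded_alg F G) (a : set R) :
  is_hideal a -> closed (vanishing a).
Proof. by move=> ha; rewrite -openC; exists a. Qed.

Lemma off_face_hideal (G : zmodType) (R : graded_alg F G) (D : deg_face R) :
  is_hideal (off_face D).
Proof.
split; first split; [exact: addspan0|exact: addspan_add|exact: off_faceM|].
move=> x; apply: addspan_mono => y hy; split; first exact: sub_addspan.
by case: hy => La [dL _ cy]; exists La.
Qed.

Fact Or_open : open ([set x | Or (set_val x)] : set (Orbar_space CA J)).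
Proof.
pose B := \bigcup_(K in [set K : {set 'I_n} | J \proper K]) Orbar CA K.
exists (~` B).
  apply: closed_openC; apply: closed_bigcup => [|K _].
    exact: finite_finset.
  exact/vanishing_hideal_closed/off_face_hideal.
apply/seteqP; split=> x /=; last by case.
by split=> //; exact: set_valP.
Qed.

Definition Or_space : ringed_space F :=
  open_subspace (Opens Or_open).
End Strata.
Arguments Or {F n k A alpha L v} CA J.
Arguments Or_space {F n k A alpha L v} CA J.

(* Main.v *)
(** Let [S] be the sum of the restricted duals [L(La)^*] for [La] in [face J].
    A point of [Or(J)] is a homogeneous prime [Q] of [S] which, for each [i]
    not in [J], misses some homogeneous element whose degree is positive on
    [h_i]; the product [b] of such elements has its degree [Lb] in the
    relative interior of the face, and [{b <> 0}] is an open neighbourhood of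
    [Q] inside [Or(J)].

    The products of elements of [L(La)^*] and [L(N)^*] span [L(La + N)^*]:
    their common kernel in [L(La + N)] is a submodule which does not contain
    the highest weight vector, so it is zero, and weight spaces are finite
    dimensional. As [m Lb - N] lies in the face for every degree [N] of [S]
    and large [m], every homogeneous prime not containing [b] misses an
    element of degree [m Lb - N]. This is exactly what makes [{b <> 0}]
    isomorphic to the spectrum of the ring of fractions of degree [0] with
    denominators vanishing nowhere on [{b <> 0}]. *)
From HB Require Import structures.
From mathcomp Require Import all_boot all_order all_algebra.
From mathcomp Require Import ring.
From mathcomp Require Import mathcomp_extra boolp classical_sets functions.
From mathcomp Require Import topology_structure initial_topology subtype_topology.
Require Import Defs.

Set Implicit Arguments.
Unset Strict Implicit.
Unset Printing Implicit Defensive.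

Import Order.TTheory GRing.Theory Num.Theory.
Local Open Scope classical_set_scope.
Local Open Scope ring_scope.

(** * Sheaves and local stalks *)

(** The degrees do not form a monoid of rank one, and this shapes the charts. In rank one, the prime
    belonging to a point [p] of the chart consists of the [x] with [x^d / b^e] in [p]. Here no power
    of [x] need have a multiple of [Lb] as its degree, so membership of [x] is tested on all
    fractions with a numerator [x * y]. An element [y] outside [Q] of degree complementary to that
    of [x] turns [x] into the fraction [x y / b^m] of degree 0 and loses nothing at [Q]; this device
    serves both for points and for sections. Primality is required for all elements, while the test
    controls homogeneous ones only; a total order on the group [P] closes the gap. Structure sheaves
    are sheafifications, so locality of stalks and bijectivity on sections are checked on fractions
    near one point and then transferred. For the modules, characteristic 0 keeps distinct integral
    weights distinct on [H ⊗ F], and independence of the simple roots leaves finitely many words in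
    the [f_i] for each weight. *)

Section SheafCondition.
Context (F : fieldType).

Lemma sh_fun_irr (X : topologicalType) (O : presheaf F X) (U : opens X)
    (s : sh_sec O U) x (p q : (U : set X) x) : sh_fun s p = sh_fun s q.
Proof. by congr (sh_fun s _); exact: Prop_irrelevance. Qed.

Lemma sheafify_is_sheaf (X : topologicalType) (O : presheaf F X) :
  is_sheaf (sheafify O).
Proof.
move=> U I V VU cov s comp.
have ex x : (U : set X) x -> exists i, (V i : set X) x by case/cov=> i _; exists i.
(* The germ at [x] is read off in an arbitrary [V i] containing [x]; compatibility on pairwise
   intersections makes the choice immaterial, which is [tE]. *)
pose t x (Ux : (U : set X) x) : stalk O x :=
  sh_fun (s (projT1 (cid (ex x Ux)))) (projT2 (cid (ex x Ux))).
have tE i x (Ux : (U : set X) x) (Vx : (V i : set X) x) : t x Ux = sh_fun (s i) Vx.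
  rewrite /t; case: cid => j Vjx /=.
  pose W := opens_setI (V j) (V i).
  have Wj : W `<=` V j by move=> y [].
  have Wi : W `<=` V i by move=> y [].
  have /= := congr1 (fun z : sh_sec O W => sh_fun z (conj Vjx Vx)) (comp j i W Wj Wi).
  move=> E; exact: eq_trans (sh_fun_irr (s j) _ (Wj _ _))
    (eq_trans E (sh_fun_irr (s i) _ Vx)).
have tloc : locally_section t.
  move=> x Ux; have [i Vx] := ex x Ux.
  have [W [p [Wx WV E]]] := sh_locP (s i) Vx.
  exists W, p; split=> //; first exact: subset_trans WV (VU i).
  by move=> y Uy Wy; rewrite (tE i _ _ (WV _ Wy)); exact: E.
exists (ShSec tloc); split=> [i|t' t'E]; first by apply: sh_secP => x Vx; exact: tE.
apply: sh_secP => x Ux; have [i Vx] := ex x Ux.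
rewrite [LHS](tE i x Ux Vx) -(t'E i) /=.
exact: sh_fun_irr.
Qed.

Lemma direct_image_is_sheaf (X Y : topologicalType) (f : X -> Y)
    (cf : continuous f) (O : presheaf F X) :
  is_sheaf O -> is_sheaf (direct_image cf O).
Proof.
move=> sO U I V VU cov s comp.
apply: (sO (opens_preim cf U) I (fun i => opens_preim cf (V i))) => [x /cov//|].
(* An open set [W] of [X] need not be a preimage, while compatibility is known over open sets of [Y]
   only; it is used on the intersection of [V i] and [V j], whose preimage contains [W], and then
   restricted. *)
move=> i j W Wi Wj; pose Z := opens_setI (V i) (V j).
have Zi : Z `<=` V i by move=> y [].
have Zj : Z `<=` V j by move=> y [].
have WZ : W `<=` opens_preim cf Z by move=> y Wy; split; [exact: Wi|exact: Wj].
rewrite -(res_res (preim_sub (cf := cf) Zi) WZ) -(res_res (preim_sub (cf := cf) Zj) WZ).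
by congr (res _ _); exact: (comp i j Z Zi Zj).
Qed.

Lemma open_subspace_is_sheaf (X : ringed_space F) (U : opens X) :
  is_sheaf (rs_sheaf X) -> is_sheaf (rs_sheaf (open_subspace U)).
Proof.
move=> sO V I W WV cov s comp.
apply: (sO (opens_im V) I (fun i => opens_im (W i))) => [_ [x /cov[i _ Wx] <-]|].
  by exists i => //; exists x.
move=> i j Z Zi Zj; pose T := opens_setI (W i) (W j).
have Ti : T `<=` W i by move=> y [].
have Tj : T `<=` W j by move=> y [].
have ZT : Z `<=` opens_im T.
  move=> y Zy; have [x Wx xy] := Zi y Zy; have [x' Wx' x'y] := Zj y Zy.
  by exists x => //; split=> //; rewrite (val_inj (etrans xy (esym x'y))).
rewrite -(res_res (opens_im_sub Ti) ZT) -(res_res (opens_im_sub Tj) ZT).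
by congr (res _ _); exact: (comp i j T Ti Tj).
Qed.

End SheafCondition.

(** * Locality of the stalks, tested on sections *)

Section LocalStalks.
Context (F : fieldType).

(** A ring is local iff it is nonzero and, for every [a], one of [a] and [1 - a]
    is invertible; this is that condition for the stalk at [x], spelled out on
    sections. *)
Definition local_sections (X : topologicalType) (O : presheaf F X) (x : X) : Prop :=
  (forall W : opens X, (W : set X) x -> (1 : O W) <> 0) /\
  (forall (U : opens X) (s : O U), (U : set X) x ->
     exists (W : opens X) (i : W `<=` U) (t : O W),
       (W : set X) x /\ (res i s * t = 1 \/ (1 - res i s) * t = 1)).

Lemma is_local_ringP (A : comPzRingType) : (1 : A) <> 0 ->
  (forall a : A, exists b, a * b = 1 \/ (1 - a) * b = 1) -> is_local_ring A.
Proof.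
move=> A10 Aloc; pose m := [set a : A | forall b, a * b <> 1].
have mM r a : m a -> m (r * a) by move=> ma b; rewrite mulrAC mulrC; exact: ma.
have im : ring_ideal m.
  split=> //; first by move=> b; rewrite mul0r; exact/nesym.
  (* If [(a + b) c = 1], then [1 - a c = b c], so [a c] or [b c] is invertible, and with it [a] or
     [b]. *)
  move=> a b ma mb c abc; have [d [E|E]] := Aloc (a * c).
    by apply: (ma (c * d)); rewrite mulrA.
  apply: (mb (c * d)); rewrite mulrA -E; congr (_ * d).
  by rewrite -abc mulrDl [RHS]addrAC subrr add0r.
have m1 : ~ m 1 by move/(_ 1); rewrite mulr1.
have sub (a : set A) : ring_ideal a -> ~ a 1 -> a `<=` m.
  move=> [_ _ aM] a1 x ax b xb; apply: a1; rewrite -xb mulrC; exact: aM.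
exists m; split=> [|m' [im' m'1 max']].
  by split=> // a ia ma a1; apply/seteqP; split=> //; exact: sub.
by rewrite (max' m im (sub _ im' m'1) m1).
Qed.

Lemma stalk_is_local (X : topologicalType) (O : presheaf F X) (x : X) :
  local_sections O x -> is_local_ring (stalk O x).
Proof.
move=> [nz loc]; apply: is_local_ringP.
  move=> /(clsP (T := germ_setoid O x))[W [i [j [Wx]]]] /=.
  rewrite !(alg_hom_str (res_hom O _)) rmorph1 rmorph0; exact: nz.
move=> a; rewrite -(rprK a); case: (rpr a) => U Ux s {a}.
have [W [i [t [Wx E]]]] := loc U s Ux; exists (germ_of Wx t).
rewrite -/(germ_of Ux s) (germ_of_res i Ux Wx s).
have g1 : germ_of Wx (1 : O W) = 1.
  by rewrite -(rmorph1 (calg_str (O W))) germ_of_cst rmorph1.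
case: E => E; [left|right]; first by rewrite -germ_ofM E g1.
by rewrite -[X in X - _]g1 -germ_ofN -germ_ofD -germ_ofM E g1.
Qed.

(** The inverse found in [O] lives on an open set of [X] that need not be a preimage; the
    neighbourhood hypothesis shrinks it to one. *)
Lemma direct_image_local_sections (X Y : topologicalType) (f : X -> Y)
    (cf : continuous f) (O : presheaf F X) (x : X) :
  (forall U : opens X, (U : set X) x ->
     exists V : opens Y, (V : set Y) (f x) /\ f @^-1` V `<=` U) ->
  local_sections O x -> local_sections (direct_image cf O) (f x).
Proof.
move=> nb [nz loc]; split=> [W Wx|U s Ux]; first exact: nz (opens_preim cf W) Wx.
have [W [i [t [Wx E]]]] := loc (opens_preim cf U) s Ux.
have [V [Vx VW]] := nb W Wx; pose Z := opens_setI V U.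
have ZU : Z `<=` U by move=> y [].
have ZW : opens_preim cf Z `<=` W by move=> y [/VW].
exists Z, ZU, (res ZW t); split=> //=.
have rs : res (preim_sub (cf := cf) ZU) s = res ZW (res i s).
  by rewrite -(res_res i ZW).
have r1 : res ZW 1 = 1 := alg_hom1 (res_hom O ZW).
case: E => E; [left|right].
  by rewrite rs -(alg_homM (res_hom O ZW)) E.
rewrite rs -[X in X - _]r1 -(alg_homN (res_hom O ZW)).
by rewrite -(alg_homD (res_hom O ZW)) -(alg_homM (res_hom O ZW)) E.
Qed.

Lemma open_subspace_local_sections (X : ringed_space F) (U : opens X)
    (x : open_subspace U) :
  local_sections (rs_sheaf X) (set_val x) ->
  local_sections (rs_sheaf (open_subspace U)) x.
Proof.
move=> [nz loc]; split=> [W Wx|V s Vx]; first by apply: (nz (opens_im W)); exists x.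
have Vx' : (opens_im V : set X) (set_val x) by exists x.
have [W [i [t [Wx E]]]] := loc (opens_im V) s Vx'.
have oZ : open (set_val @^-1` (W : set X) : set (set_type U)).
  by exists W => //; exact: opensP.
pose Z : opens (open_subspace U) := Opens oZ.
have ZW : opens_im Z `<=` W by move=> _ [y Wy <-].
have ZV : Z `<=` V.
  by move=> y /i[z Vz /val_inj <-].
exists Z, ZV, (res ZW t); split=> //=.
set O := rs_sheaf X in s t E *.
have rs : res (opens_im_sub ZV) s = res ZW (res i s).
  by rewrite -(res_res i ZW).
have r1 : res ZW (1 : O W) = 1 := alg_hom1 (res_hom O ZW).
case: E => E; [left|right].
  by rewrite rs -(alg_homM (res_hom O ZW)) E.
rewrite rs -[X in X - _]r1 -(alg_homN (res_hom O ZW)).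
by rewrite -(alg_homD (res_hom O ZW)) -(alg_homM (res_hom O ZW)) E.
Qed.
End LocalStalks.

Section SheafifyLocal.
Context (F : fieldType) (X : topologicalType) (O : presheaf F X).

Lemma germ_of1 (U : opens X) x (Ux : (U : set X) x) : germ_of Ux (1 : O U) = 1.
Proof. by rewrite -(rmorph1 (calg_str (O U))) germ_of_cst rmorph1. Qed.

Fact germs_locally_section (U : opens X) (t : O U) :
  locally_section (fun x (Ux : (U : set X) x) => germ_of Ux t).
Proof.
move=> x Ux; exists U, t; split=> // y Uy Vy.
by congr germ_of; exact: Prop_irrelevance.
Qed.
Definition to_sheafify (U : opens X) (t : O U) : sheafify O U :=
  ShSec (germs_locally_section t).

Lemma germ_of_eqP x (U V : opens X) (Ux : (U : set X) x) (Vx : (V : set X) x)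
    (s : O U) (t : O V) :
  germ_of Ux s = germ_of Vx t ->
  exists (W : opens X) (i : W `<=` U) (j : W `<=` V),
    (W : set X) x /\ res i s = res j t.
Proof. by move/(clsP (T := germ_setoid O x)). Qed.

(** Near [x] a section of the sheafification comes from a section of [O], and the required inverse
    is found there; hence locality of [Proj] can be checked on fractions. *)
Lemma sheafify_local_sections (x : X) :
  local_sections O x -> local_sections (sheafify O) x.
Proof.
move=> [nz loc]; split=> [W Wx E|U s Ux].
  have : (1 : stalk O x) = 0 := congr1 (fun z : sh_sec O W => sh_fun z Wx) E.
  rewrite -(rmorph1 (calg_str (stalk O x))) -(rmorph0 (calg_str (stalk O x))).
  rewrite -!(germ_of_cst O Wx) => /germ_of_eqP[Z [i [j [Zx]]]].
  by rewrite !(alg_hom_str (res_hom O _)) rmorph1 rmorph0; exact: nz.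
have [V [p [Vx VU E]]] := sh_locP s Ux.
have [W [i [t [Wx Et]]]] := loc V p Vx.
exists W, (subset_trans i VU), (to_sheafify t); split=> //.
have sE y (Wy : (W : set X) y) Uy : sh_fun s Uy = germ_of Wy (res i p).
  by rewrite (E _ _ (i _ Wy)) -(germ_of_res i (i _ Wy) Wy).
case: Et => Et; [left|right]; apply: sh_secP => y Wy /=.
  by rewrite (sE y Wy) -germ_ofM Et germ_of1 [RHS]rmorph1.
rewrite (sE y Wy) rmorph1 -[X in X - _](germ_of1 Wy) -germ_ofN -germ_ofD -germ_ofM.
by rewrite Et germ_of1.
Qed.
End SheafifyLocal.

(** * Basic open sets of projective spectra and locality of fractions *)

Section ProjLocal.
Context (F : fieldType) (G : zmodType) (R : graded_alg F G).

Lemma ptM (Q : proj R) x y : (Q : set R) (x * y) <-> (Q : set R) x \/ (Q : set R) y.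
Proof.
have [[[Q0 QD QM] _] _ Qpr] := ptP Q; split; first exact: Qpr.
by case=> [Qx|Qy]; [rewrite mulrC|]; exact: QM.
Qed.

Lemma pt0 (Q : proj R) : (Q : set R) 0. Proof. by have [[[]]] := ptP Q. Qed.
Lemma pt1 (Q : proj R) : ~ (Q : set R) 1. Proof. by have [] := ptP Q. Qed.
Lemma ptD (Q : proj R) x y : (Q : set R) x -> (Q : set R) y -> (Q : set R) (x + y).
Proof. have [[[_ QD _] _] _ _] := ptP Q; exact: QD. Qed.

Lemma ptN (Q : proj R) x : (Q : set R) x -> (Q : set R) (- x).
Proof. by have [[[_ _ QM] _] _ _] := ptP Q; rewrite -mulN1r; exact: QM. Qed.

Lemma ptX (Q : proj R) x m : ~ (Q : set R) x -> ~ (Q : set R) (x ^+ m).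
Proof.
move=> nQ; elim: m => [|m IH]; first exact: pt1.
by rewrite exprS => /ptM[].
Qed.

Lemma dopen_open (b : R) : homog b -> open [set Q : proj R | ~ (Q : set R) b].
Proof.
move=> hb; exists (ideal_gen [set b]); first by apply: ideal_gen_hideal => _ ->.
congr (~` _); apply/seteqP; split=> Q; have [[iQ _] _ _] := ptP Q => /=.
  by move=> Qb; apply: ideal_gen_sub => // _ ->.
by move=> sQ; apply/sQ/sub_ideal_gen.
Qed.
Definition dopen (b : R) (hb : homog b) : opens (proj R) := Opens (dopen_open hb).

Lemma hideal_notin (a : set R) (Q : set R) : is_hideal a -> Q 0 ->
  (forall x y, Q x -> Q y -> Q (x + y)) -> ~ a `<=` Q ->
  exists2 b, homog b & a b /\ ~ Q b.
Proof.
move=> [_ ha] Q0 QD; apply: contra_notP => /forall2NP hn z /ha.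
apply: addspan_sub => // x [ax hx]; have [//|] := hn x.
by move=> /not_andP[//|/contrapT].
Qed.

Lemma proj_basis (U : opens (proj R)) (Q : proj R) : (U : set _) Q ->
  exists2 b, homog b & ~ (Q : set R) b /\
    forall Q' : proj R, ~ (Q' : set R) b -> (U : set _) Q'.
Proof.
case: U => _ /= [a ha ->] /(hideal_notin ha (@pt0 Q) (@ptD Q))[b hb [ab nQ]].
by exists b => //; split=> // Q' nQ' aQ'; apply/nQ'/aQ'.
Qed.

Section FracCls.
Context (U : set (proj R)).
Implicit Types x y : frac U.
Definition fcls x : frac_alg U := cls (x : frac_prering U).
Lemma fcls_rpr (s : frac_alg U) : fcls (rpr (s : pr_quot (frac_prering U))) = s.
Proof. exact: rprK. Qed.
Lemma fcls_surj (s : frac_alg U) : exists x, s = fcls x.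
Proof. by exists (rpr (s : pr_quot (frac_prering U))); rewrite fcls_rpr. Qed.
Lemma fclsD x y : fcls x + fcls y = fcls (frac_add x y).
Proof. exact: (pr_quotD (A := frac_prering U)). Qed.
Lemma fclsM x y : fcls x * fcls y = fcls (frac_mul x y).
Proof. exact: (pr_quotM (A := frac_prering U)). Qed.
Lemma fclsN x : - fcls x = fcls (frac_opp x).
Proof. exact: (pr_quotN (A := frac_prering U)). Qed.
Lemma fcls_cst c : calg_str (frac_alg U) c = fcls (frac_cst U c).
Proof. by []. Qed.
Lemma fcls1 : 1 = fcls (frac_cst U 1). Proof. by []. Qed.
Lemma fclsP x y : fcls x = fcls y <-> frac_eqv x y.
Proof. exact: (clsP (T := frac_setoid U)). Qed.
End FracCls.

Lemma proj_local_sections (Q : proj R) : local_sections (proj_presheaf R) Q.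
Proof.
split=> [W WQ /fclsP[t [_ nt]] /=|U s UQ].
  rewrite scale1r scale0r !mulr1 mulr0 => t0; apply: (nt Q WQ); rewrite t0; exact: pt0.
rewrite -(fcls_rpr s); move: (rpr _) => {s} [La a c dL ca cc nc].
have ha : homog a by apply/homogE; exists La.
have cac : ga_comp La (c - a) by apply: ga_compD => //; exact: ga_compN.
have hac : homog (c - a) by apply/homogE; exists La.
(* If [a] lies in [Q], then [c - a] does not, and [c / (c - a)] inverts [1 - a / c] near [Q];
   otherwise [c / a] inverts [a / c]. *)
have [Qa|nQa] := pselect ((Q : set R) a).
  pose W := opens_setI U (dopen hac).
  have WU : W `<=` U by move=> y [].
  have nW Q' : (W : set _) Q' -> ~ (Q' : set R) (c - a) by case.
  exists W, WU, (fcls (Frac dL cc cac nW)); split.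
    split=> //= Qac; apply: (nc Q UQ); rewrite -(subrK a c); exact: ptD.
  right; rewrite [res _ _]frac_resE -/(fcls _) fclsN [1]fcls1 fclsD fclsM.
  by apply/fclsP/frac_eqv1 => /=; rewrite !scale1r; ring.
pose W := opens_setI U (dopen ha).
have WU : W `<=` U by move=> y [].
have nW Q' : (W : set _) Q' -> ~ (Q' : set R) a by case.
exists W, WU, (fcls (Frac dL cc ca nW)); split=> //.
left; rewrite [res _ _]frac_resE -/(fcls _) fclsM.
by apply/fclsP/frac_eqv1 => /=; rewrite !scale1r; ring.
Qed.
End ProjLocal.

(** * Isomorphisms of sheafifications *)

Section SheafComparison.
Context (F : fieldType) (T Y : topologicalType).
Context (P : presheaf F T) (P' : presheaf F Y).
Context (D : set T) (f : T -> Y) (h : Y -> T).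
Hypotheses (fK : forall t, D t -> h (f t) = t) (hK : cancel h f) (hD : forall y, D (h y)).
Hypothesis f_cont : forall V : opens Y, open (D `&` f @^-1` V).
Hypothesis h_cont : continuous h.

(** [f] is total but meaningful on [D] only, hence the intersection with [D]. Comparison over all
    such pairs, not only over full preimages, lets either open set be shrunk separately. *)
Definition maps_into (W : opens T) (V : opens Y) := W `<=` D `&` f @^-1` V.

Context (psi : forall (V : opens Y) (W : opens T), maps_into W V -> P' V -> P W).
Hypothesis psi_hom : forall V W (i : maps_into W V), is_alg_hom (psi i).
Hypothesis psi_res : forall V W V' W' (i : maps_into W V) (i' : maps_into W' V')
  (j : V' `<=` V) (k : W' `<=` W) s, res k (psi i s) = psi i' (res j s).
Hypothesis psi_inj : forall y (V : opens Y) (W : opens T) (i : maps_into W V) s s',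
  (V : set Y) y -> (W : set T) (h y) -> psi i s = psi i s' ->
  exists (V' : opens Y) (j : V' `<=` V), (V' : set Y) y /\ res j s = res j s'.
Hypothesis psi_surj : forall y (W : opens T) (p : P W), (W : set T) (h y) ->
  exists (V : opens Y) (W' : opens T) (j : W' `<=` W) (i : maps_into W' V) q,
    [/\ (V : set Y) y, (W' : set T) (h y) & psi i q = res j p].

Definition preim_in_D (V : opens Y) : opens T := Opens (f_cont V).

Lemma preim_in_D_maps V : maps_into (preim_in_D V) V. Proof. by []. Qed.

Lemma preim_in_D_mem t (Dt : D t) (V : opens Y) :
  (V : set Y) (f t) -> (preim_in_D V : set T) t.
Proof. by split. Qed.

Definition stalk_map t (Dt : D t) (x : stalk P' (f t)) : stalk P t :=
  let g := rpr (x : pr_quot (germ_prering P' (f t))) in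
  germ_of (preim_in_D_mem Dt (germ_mem g)) (psi (@preim_in_D_maps _) (germ_sec g)).

(** The sections agree on some [V] around [y], so their images agree on the part of [W1] and [W2]
    lying over [V]. The equality [f t = y] is a hypothesis so that germs at points which are only
    provably equal can be compared. *)
Lemma germ_psi_eq t y (V1 V2 : opens Y) (W1 W2 : opens T) (i1 : maps_into W1 V1)
    (i2 : maps_into W2 V2) (V1y : (V1 : set Y) y) (V2y : (V2 : set Y) y)
    (W1t : (W1 : set T) t) (W2t : (W2 : set T) t) s1 s2 : f t = y ->
  germ_of V1y s1 = germ_of V2y s2 ->
  germ_of W1t (psi i1 s1) = germ_of W2t (psi i2 s2).
Proof.
move=> ft /germ_of_eqP[V [j1 [j2 [Vy E]]]].
have oW : open ((W1 : set T) `&` W2 `&` (D `&` f @^-1` V)).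
  by apply: openI; [apply: openI; exact: opensP|exact: f_cont].
pose W := Opens oW.
have k1 : W `<=` W1 by move=> ? [[]].
have k2 : W `<=` W2 by move=> ? [[]].
have i : maps_into W V by move=> ? [].
have Wt : (W : set T) t by split=> //; split; [case: (i1 _ W1t)|rewrite /= ft].
rewrite (germ_of_res k1 W1t Wt) (germ_of_res k2 W2t Wt).
by rewrite (psi_res i1 i j1) (psi_res i2 i j2) E.
Qed.

Lemma stalk_mapE t (Dt : D t) (V : opens Y) (W : opens T) (i : maps_into W V)
    (Vy : (V : set Y) (f t)) (Wt : (W : set T) t) s :
  stalk_map Dt (germ_of Vy s) = germ_of Wt (psi i s).
Proof.
apply: (@germ_psi_eq t (f t) _ _ _ _ _ i (germ_mem _) Vy) => //.
by apply/(clsP (T := germ_setoid P' (f t))); exact: (rpr_cls (T := germ_setoid P' (f t))).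
Qed.

Lemma stalkP (X : topologicalType) (O : presheaf F X) x (a : stalk O x) :
  exists (U : opens X) (Ux : (U : set X) x) (s : O U), a = germ_of Ux s.
Proof. by rewrite -(rprK a); case: (rpr a) => U Ux s; exists U, Ux, s. Qed.

Lemma stalkP2 (X : topologicalType) (O : presheaf F X) x (a b : stalk O x) :
  exists (U : opens X) (Ux : (U : set X) x) (s t : O U),
    a = germ_of Ux s /\ b = germ_of Ux t.
Proof.
have [U [Ux [s ->]]] := stalkP a; have [V [Vx [t ->]]] := stalkP b.
pose W := opens_setI U V.
have WU : W `<=` U by move=> ? [].
have WV : W `<=` V by move=> ? [].
have Wx : (W : set X) x by split.
exists W, Wx, (res WU s), (res WV t).
by rewrite -(germ_of_res WU Ux Wx) -(germ_of_res WV Vx Wx).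
Qed.

Lemma stalk_map_hom t (Dt : D t) : is_alg_hom (stalk_map Dt).
Proof.
split=> [a b|a b|c].
- have [V [Vy [s [s' [-> ->]]]]] := stalkP2 a b; pose i := @preim_in_D_maps V.
  rewrite -germ_ofD !(stalk_mapE Dt i Vy (preim_in_D_mem Dt Vy)) -germ_ofD.
  by rewrite (alg_homD (psi_hom i)).
- have [V [Vy [s [s' [-> ->]]]]] := stalkP2 a b; pose i := @preim_in_D_maps V.
  rewrite -germ_ofM !(stalk_mapE Dt i Vy (preim_in_D_mem Dt Vy)) -germ_ofM.
  by rewrite (alg_homM (psi_hom i)).
- have Vy : (opens_setT Y : set Y) (f t) by [].
  rewrite -(germ_of_cst P' Vy) (stalk_mapE Dt (@preim_in_D_maps _) Vy (preim_in_D_mem Dt Vy)).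
  by rewrite (alg_hom_str (psi_hom _)) germ_of_cst.
Qed.

Lemma germ_psi_inj t y (V1 V2 : opens Y) (W1 W2 : opens T) (i1 : maps_into W1 V1)
    (i2 : maps_into W2 V2) (V1y : (V1 : set Y) y) (V2y : (V2 : set Y) y)
    (W1t : (W1 : set T) t) (W2t : (W2 : set T) t) s1 s2 : t = h y ->
  germ_of W1t (psi i1 s1) = germ_of W2t (psi i2 s2) ->
  germ_of V1y s1 = germ_of V2y s2.
Proof.
move=> et /germ_of_eqP[W [k1 [k2 [Wt E]]]]; pose V := opens_setI V1 V2.
have j1 : V `<=` V1 by move=> ? [].
have j2 : V `<=` V2 by move=> ? [].
have i : maps_into W V.
  by move=> x Wx; have [Dx V1x] := i1 _ (k1 _ Wx); have [_ V2x] := i2 _ (k2 _ Wx).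
have Vy : (V : set Y) y by [].
move: E; rewrite (psi_res i1 i j1) (psi_res i2 i j2) => E.
have Wh : (W : set T) (h y) by rewrite -et.
have [V' [j [V'y E']]] := psi_inj Vy Wh E.
rewrite (germ_of_res j1 V1y Vy) (germ_of_res j2 V2y Vy).
by rewrite (germ_of_res j Vy V'y) E' -(germ_of_res j Vy V'y).
Qed.

Section Sections.
Context (V : opens Y) (W : opens T) (WV : maps_into W V).

Fact sh_map_loc (s : sh_sec P' V) : locally_section
  (fun t (Wt : (W : set T) t) => stalk_map (WV Wt).1 (sh_fun s (WV Wt).2)).
Proof.
move=> t Wt; have [Dt Vft] := WV Wt.
have [V1 [q [V1y V1V E]]] := sh_locP s Vft.
pose W1 := opens_setI W (preim_in_D V1).
have i : maps_into W1 V1 by move=> x [].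
exists W1, (psi i q); split=> [//|x []//|x Wx W1x].
have V1x := (i x W1x).2.
by rewrite (E _ _ V1x) (stalk_mapE _ i V1x W1x).
Qed.
Definition sh_map (s : sh_sec P' V) : sh_sec P W := ShSec (sh_map_loc s).

Lemma sh_map_hom : is_alg_hom (sh_map : sheafify P' V -> sheafify P W).
Proof.
split=> [a b|a b|c]; apply: sh_secP => t Wt /=.
- exact: alg_homD (stalk_map_hom _) _ _.
- exact: alg_homM (stalk_map_hom _) _ _.
- exact: alg_hom_str (stalk_map_hom _) _.
Qed.

Hypothesis VW : forall y, (V : set Y) y -> (W : set T) (h y).

Lemma sh_map_inj : injective sh_map.
Proof.
move=> s s' E; apply: sh_secP => y Vy; have Wt := VW Vy.
have {E} : sh_fun (sh_map s) Wt = sh_fun (sh_map s') Wt by rewrite E.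
rewrite /=; set Dt := proj1 _; set Vft := proj2 _.
have [V1 [V1y [q Eq]]] := stalkP (sh_fun s Vft).
have [V2 [V2y [q' Eq']]] := stalkP (sh_fun s' Vft).
rewrite Eq Eq' (stalk_mapE Dt (@preim_in_D_maps _) V1y (preim_in_D_mem Dt V1y)).
rewrite (stalk_mapE Dt (@preim_in_D_maps _) V2y (preim_in_D_mem Dt V2y)).
move/(germ_psi_inj V1y V2y) => /(_ (esym (congr1 h (hK y)))); rewrite -Eq -Eq'.
(* The germs sit at [f (h y)]; once nothing else depends on [Vft], rewriting moves them to [y]. *)
move: {Eq Eq' V1y V2y} Vft => /=; rewrite (hK y) => Vy'.
by rewrite !(sh_fun_irr _ Vy' Vy).
Qed.

Lemma sh_map_surj (u : sh_sec P W) : exists s, sh_map s = u.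
Proof.
(* The stalk map at [h y] starts from the stalk at [f (h y)], whose type differs from that of the
   stalk at [y]; a relation avoids the transport. *)
pose rel y (x : stalk P' y) (a : stalk P (h y)) :=
  exists (V0 : opens Y) (V0y : (V0 : set Y) y) (q : P' V0) (W0 : opens T)
    (i : maps_into W0 V0) (W0y : (W0 : set T) (h y)),
    x = germ_of V0y q /\ a = germ_of W0y (psi i q).
have ex y (Vy : (V : set Y) y) : exists x, rel y x (sh_fun u (VW Vy)).
  have [W0 [p [W0y _ E]]] := sh_locP u (VW Vy).
  have [V1 [W1 [j [i [q [V1y W1y Eq]]]]]] := psi_surj p W0y.
  exists (germ_of V1y q), V1, V1y, q, W1, i, W1y; split=> //.
  by rewrite Eq -(germ_of_res j W0y); exact: E.
pose s y (Vy : (V : set Y) y) := projT1 (cid (ex y Vy)).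
have sP y Vy : rel y (s y Vy) (sh_fun u (VW Vy)) := projT2 (cid (ex y Vy)).
have sloc : locally_section s.
  move=> y Vy; have [W0 [p [W0y W0W E]]] := sh_locP u (VW Vy).
  have [V1 [W1 [j [i [q [V1y W1y Eq]]]]]] := psi_surj p W0y.
  (* On this set the chosen germs are those of [q]: both are sent to the germs of [u], and
     [germ_psi_inj] makes the preimage unique. *)
  have oV : open (V `&` (V1 `&` h @^-1` W1)).
    apply: openI; first exact: opensP.
    apply: openI; first exact: opensP.
    exact: (continuousP h).1 h_cont _ (opensP W1).
  pose V2 := Opens oV.
  have j2 : V2 `<=` V1 by move=> ? [? []].
  exists V2, (res j2 q); split=> [//|z []//|z Vz V2z].
  have V1z := j2 z V2z; have W1z : (W1 : set T) (h z) by case: V2z => _ [].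
  rewrite -(germ_of_res j2 V1z V2z).
  have [V0 [V0z [q0 [W3 [i0 [W3z [-> E0]]]]]]] := sP z Vz.
  apply: (@germ_psi_inj (h z) z _ _ _ _ i0 i V0z V1z W3z W1z) => //.
  by rewrite -E0 Eq -(germ_of_res j (j _ W1z)); exact: E.
exists (ShSec sloc); apply: sh_secP => t Wt /=.
set Dt := proj1 _; set Vft := proj2 _.
have [V0 [V0z [q0 [W3 [i0 [W3z [-> E0]]]]]]] := sP (f t) Vft.
rewrite (stalk_mapE Dt (@preim_in_D_maps _) V0z (preim_in_D_mem Dt V0z)).
move: (VW Vft) W3z E0; rewrite (fK Dt) => Wt' W3t; rewrite (sh_fun_irr u Wt' Wt) => ->.
exact: (@germ_psi_eq t (f t) _ _ _ _ _ _ V0z V0z).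
Qed.

Lemma sh_map_bij : bijective sh_map.
Proof.
have [g gK] := choice sh_map_surj; exists g => // s.
exact/sh_map_inj/gK.
Qed.
End Sections.

Lemma sh_map_res (V V' : opens Y) (W W' : opens T) (i : maps_into W V)
    (i' : maps_into W' V') (j : V' `<=` V) (k : W' `<=` W) (s : sheafify P' V) :
  sh_map i' (res j s) = res k (sh_map i s : sheafify P W).
Proof.
apply: sh_secP => t Wt /=.
set Dt := proj1 _; set Dt' := proj1 _; rewrite (Prop_irrelevance Dt Dt').
by congr (stalk_map _ _); exact: sh_fun_irr.
Qed.
End SheafComparison.

(** * Homogeneous components *)

Section Components.
Context (F : fieldType) (G : zmodType) (R : graded_alg F G).
Implicit Types (x y z : R) (La N : G).

Lemma ga_decomp x : exists sy : seq G * (G -> R), [/\ uniq sy.1,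
  forall La, La \in sy.1 -> ga_deg R La /\ ga_comp La (sy.2 La) &
  x = \sum_(La <- sy.1) sy.2 La].
Proof.
have [s [y [us ys E]]] := deg_span_indep (homog_span x).
by exists (s, y); split=> // La /ys[].
Qed.

(** The list comes from a chosen decomposition and may contain degrees with zero component; the
    values of [gcomp] do not depend on the choice, by [gcomp_unique]. *)
Definition gsupp x : seq G := (projT1 (cid (ga_decomp x))).1.

Definition gcomp La x : R :=
  if La \in gsupp x then (projT1 (cid (ga_decomp x))).2 La else 0.

Lemma gsupp_uniq x : uniq (gsupp x).
Proof. by rewrite /gsupp; case: cid => ? []. Qed.

Lemma gsupp_deg x La : La \in gsupp x -> ga_deg R La.
Proof. by rewrite /gsupp; case: cid => ? [? h ?] /= /h[]. Qed.

Lemma gcomp_sum x : x = \sum_(La <- gsupp x) gcomp La x.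
Proof.
rewrite [LHS](_ : _ = \sum_(La <- gsupp x) (projT1 (cid (ga_decomp x))).2 La).
  by apply: eq_big_seq => La sL; rewrite /gcomp sL.
by rewrite /gsupp; case: cid => ? [].
Qed.

Lemma gcompP La x : ga_deg R La -> ga_comp La (gcomp La x).
Proof.
rewrite /gcomp => dL; case: ifP => [|_]; last exact: ga_comp0.
by rewrite /gsupp; case: cid => ? [? h ?] /= /h[].
Qed.

Lemma gcomp_out La x : La \notin gsupp x -> gcomp La x = 0.
Proof. by rewrite /gcomp => /negbTE->. Qed.

Lemma gcomp_homog La x : homog (gcomp La x).
Proof.
have [sL|/gcomp_out->] := boolP (La \in gsupp x).
  by apply/homogE; exists La; [exact: gsupp_deg sL|apply: gcompP; exact: gsupp_deg sL].
by apply/homogE; exists 0; [exact: ga_deg0|apply: ga_comp0; exact: ga_deg0].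
Qed.

(** Two decompositions of the same element differ by a family over the union of their supports with
    sum zero, and independence of the components kills it. *)
Lemma gcomp_unique (s : seq G) (y : G -> R) La : uniq s ->
  (forall N, N \in s -> ga_deg R N /\ ga_comp N (y N)) ->
  gcomp La (\sum_(N <- s) y N) = if La \in s then y La else 0.
Proof.
move=> us ys; set x := \sum_(N <- s) y N.
pose t := undup (gsupp x ++ s).
pose z N := gcomp N x - (if N \in s then y N else 0).
have zt N : N \in t -> ga_deg R N /\ ga_comp N (z N).
  rewrite mem_undup mem_cat => Nt.
  have dN : ga_deg R N by case/orP: Nt => [/gsupp_deg|/ys[]].
  split=> //; apply: ga_compD => //; first exact: gcompP.
  by apply: ga_compN => //; case: ifP => [/ys[]//|_]; exact: ga_comp0.
have sub (u : seq G) (w : G -> R) : uniq u -> {subset u <= t} ->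
    \sum_(N <- t) (if N \in u then w N else 0) = \sum_(N <- u) w N.
  move=> uu ut; rewrite -big_mkcond -big_filter; apply: perm_big.
  apply: uniq_perm => //; first by rewrite filter_uniq ?undup_uniq.
  by move=> N; rewrite mem_filter; case: (boolP (N \in u)) => // /ut->.
have z0 : \sum_(N <- t) z N = 0.
  rewrite sumrB (sub s y) //; last by move=> N Ns; rewrite mem_undup mem_cat Ns orbT.
  rewrite (eq_bigr (fun N => if N \in gsupp x then gcomp N x else 0)).
    rewrite (sub _ (gcomp^~ x)) -?gcomp_sum ?subrr //; first exact: gsupp_uniq.
    by move=> N Ns; rewrite mem_undup mem_cat Ns.
  by move=> N _; case: ifP => // /negbT/gcomp_out.
have [Lt|] := boolP (La \in t).
  have := ga_indep (undup_uniq _) zt z0 Lt.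
  by move/eqP; rewrite subr_eq0 => /eqP.
by rewrite mem_undup mem_cat negb_or => /andP[/gcomp_out-> /negbTE->].
Qed.

Lemma gcomp_hom La N x : ga_deg R La -> ga_comp La x ->
  gcomp N x = if N == La then x else 0.
Proof.
move=> dL cx; have := @gcomp_unique [:: La] (fun=> x) N isT.
rewrite big_seq1 inE => -> // M; by rewrite inE => /eqP->.
Qed.

Lemma gcomp_id La x : ga_deg R La -> ga_comp La x -> gcomp La x = x.
Proof. by move=> dL cx; rewrite (gcomp_hom _ dL cx) eqxx. Qed.

Lemma gcompD La x y : gcomp La (x + y) = gcomp La x + gcomp La y.
Proof.
pose t := undup (gsupp x ++ gsupp y).
have tE z : {subset gsupp z <= t} -> z = \sum_(N <- t) gcomp N z.
  move=> zt; rewrite [LHS]gcomp_sum [LHS]big_seq big_mkcond /=.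
  rewrite -[LHS]big_mkcond -[LHS]big_filter [RHS](bigID (mem (gsupp z))) /=.
  rewrite [X in _ = _ + X]big1 ?addr0; last by move=> N /gcomp_out.
  rewrite -[RHS]big_filter; apply: perm_big; apply: uniq_perm.
  - by rewrite filter_uniq ?gsupp_uniq.
  - by rewrite filter_uniq ?undup_uniq.
  - by move=> N; rewrite !mem_filter /=; case: (boolP (N \in gsupp z)) => // /zt->.
have Ex : x = \sum_(N <- t) gcomp N x.
  by apply: tE => N; rewrite mem_undup mem_cat => ->.
have Ey : y = \sum_(N <- t) gcomp N y.
  by apply: tE => N; rewrite mem_undup mem_cat => ->; rewrite orbT.
rewrite {1}Ex {1}Ey -big_split gcomp_unique ?undup_uniq //=; last first.
  move=> N; rewrite mem_undup mem_cat => Nt.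
  have dN : ga_deg R N by case/orP: Nt => /gsupp_deg.
  by split=> //; apply: ga_compD => //; exact: gcompP.
case: ifP => //; rewrite mem_undup mem_cat => /negbT; rewrite negb_or.
by case/andP => /gcomp_out-> /gcomp_out->; rewrite addr0.
Qed.

Lemma gcomp0 La : gcomp La 0 = 0.
Proof. by apply: (addrI (gcomp La 0)); rewrite -gcompD !addr0. Qed.

Lemma gcomp_bigsum La (I : Type) (r : seq I) (y : I -> R) :
  gcomp La (\sum_(i <- r) y i) = \sum_(i <- r) gcomp La (y i).
Proof. by apply: big_morph; [exact: gcompD|exact: gcomp0]. Qed.

(** Translation by [La] is injective on [G], so no two components of [z] end in the same degree. [N]
    may lie outside the degree monoid, where both sides vanish; this permits degrees such as
    [M - La] below. *)
Lemma gcompM_hom La N r : ga_deg R La -> ga_comp La r ->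
  (forall z, gcomp (N + La) (z * r) = gcomp N z * r).
Proof.
move=> dL cr z; rewrite [in LHS](gcomp_sum z) mulr_suml gcomp_bigsum.
rewrite (eq_big_seq (fun M => if N == M then gcomp M z * r else 0)) => [|M Ms].
  have [sN|sN] := boolP (N \in gsupp z).
    rewrite (bigD1_seq N) ?gsupp_uniq //= eqxx big1 ?addr0 // => M /negbTE.
    by rewrite eq_sym => ->.
  rewrite (gcomp_out sN) mul0r big_seq big1 // => M Ms.
  by case: eqP => // E; rewrite E Ms in sN.
have dM := gsupp_deg Ms.
rewrite (gcomp_hom _ (ga_degD dM dL) (ga_compM dM dL (gcompP _ dM) cr)).
by rewrite (inj_eq (addIr La)).
Qed.

Lemma hideal_gcomp (a : set R) La x : is_hideal a -> a x -> a (gcomp La x).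
Proof.
move=> [[a0 aD aM] ha] /ha; elim=> [|y z [ay /homogE[N dN cy]] _ IH].
  by rewrite gcomp0.
rewrite gcompD; apply: aD => //.
by rewrite (gcomp_hom _ dN cy); case: ifP.
Qed.

Lemma gcomp_hideal (a : set R) : is_ideal a ->
  (forall x La, a x -> a (gcomp La x)) -> is_hideal a.
Proof.
move=> ia ha; split=> // x ax; rewrite [x]gcomp_sum.
elim: (gsupp x) => [|La s IH]; first by rewrite big_nil; exact: addspan0.
by rewrite big_cons; apply: addspanD => //; split; [exact: ha|exact: gcomp_homog].
Qed.

Lemma ideal_sum (a : set R) (I : eqType) (r : seq I) (P : pred I) (y : I -> R) :
  is_ideal a -> (forall i, i \in r -> P i -> a (y i)) -> a (\sum_(i <- r | P i) y i).
Proof.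
move=> [a0 aD _]; elim: r => [|i r IH] ay; first by rewrite big_nil.
have IH' : a (\sum_(i <- r | P i) y i).
  by apply: IH => j jr; apply: ay; rewrite inE jr orbT.
rewrite big_cons; case: ifP => // Pi; apply: aD => //.
by apply: ay; rewrite ?inE ?eqxx.
Qed.

(** * Primality tested on homogeneous elements, over an ordered group of degrees *)

Section Ordered.
Context (pos : G -> Prop).
Hypotheses (posD : forall a b, pos a -> pos b -> pos (a + b)) (pos0 : ~ pos 0)
  (pos_total : forall a, [\/ a = 0, pos a | pos (- a)]).

Lemma max_degree (s : seq G) (p : G -> Prop) : (exists2 La, La \in s & p La) ->
  exists2 La, La \in s & p La /\ forall N, N \in s -> p N -> ~ pos (N - La).
Proof.
elim: s => [[La]//|M s IH] [La sLa pLa].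
have [[N sN pN]|ns] := pselect (exists2 N, N \in s & p N); last first.
  have EM N : N \in M :: s -> p N -> N = M.
    by rewrite inE => /orP[/eqP//|sN pN]; case: ns; exists N.
  exists M; first by rewrite inE eqxx.
  rewrite -{1}(EM La) //; split=> // N sN pN.
  by rewrite (EM N sN pN) subrr.
have [|N' sN' [pN' maxN']] := IH; first by exists N.
have [pM|npM] := pselect (p M); last first.
  exists N'; first by rewrite inE sN' orbT.
  by split=> // N''; rewrite inE => /orP[/eqP->//|]; exact: maxN'.
have [posM|nposM] := pselect (pos (M - N')); last first.
  exists N'; first by rewrite inE sN' orbT.
  by split=> // N''; rewrite inE => /orP[/eqP->//|]; exact: maxN'.
exists M; first by rewrite inE eqxx.
split=> // N''; rewrite inE => /orP[/eqP-> _|sN'' pN'']; first by rewrite subrr.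
move=> /(posD posM); rewrite [X in pos X](_ : _ = N'' - N'); first exact: maxN'.
by rewrite [LHS]addrC addrA subrK.
Qed.

(** Leading terms: the product of the components of maximal degree outside [Q]
    is, modulo [Q], a component of the product. *)
Lemma hprime_homog (Q : set R) : is_hideal Q -> ~ Q 1 ->
  (forall x y, homog x -> homog y -> Q (x * y) -> Q x \/ Q y) -> is_hprime Q.
Proof.
move=> hQ Q1 Qpr; split=> // x y Qxy; have [iQ _] := hQ; have [Q0 QD QM] := iQ.
have top z : ~ Q z -> exists La, [/\ La \in gsupp z, ~ Q (gcomp La z) &
    forall N, N \in gsupp z -> pos (N - La) -> Q (gcomp N z)].
  move=> nQ; have [|La sLa [nLa maxLa]] :=
      @max_degree (gsupp z) (fun La => ~ Q (gcomp La z)).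
    apply: contrapT => nex; apply: nQ; rewrite [z]gcomp_sum.
    by apply: ideal_sum => // La sLa _; apply: contrapT => nLa; apply: nex; exists La.
  by exists La; split=> // N sN pN; apply: contrapT => /(maxLa N sN).
apply: contrapT => /not_orP[/top[La [sLa nLa maxLa]] /top[N [sN nN maxN]]].
have := hideal_gcomp (La + N) hQ Qxy.
have -> : x * y = \sum_(p <- [seq (i, j) | i <- gsupp x, j <- gsupp y])
    gcomp p.1 x * gcomp p.2 y.
  rewrite [x in LHS]gcomp_sum [y in LHS]gcomp_sum big_allpairs mulr_suml.
  by apply: eq_bigr => i _; rewrite mulr_sumr.
rewrite gcomp_bigsum (bigD1_seq (La, N)) /=; last 2 first.
- by apply/allpairsP; exists (La, N).
- by apply: allpairs_uniq; rewrite ?gsupp_uniq // => -[? ?] [? ?] _ _ [-> ->].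
rewrite gcomp_id; last 2 first.
- by apply: ga_degD; exact: gsupp_deg sN || exact: gsupp_deg sLa.
- by apply: ga_compM; try apply: gcompP;
    exact: gsupp_deg sN || exact: gsupp_deg sLa.
set rest := \sum_(p <- _ | _) _.
have Qrest : Q rest.
  apply: ideal_sum => // -[i j] /allpairsP[[i' j'] /= [si sj [-> ->]]] nij {i j}.
  rewrite (gcomp_hom _ (ga_degD (gsupp_deg si) (gsupp_deg sj))
    (ga_compM (gsupp_deg si) (gsupp_deg sj)
      (gcompP _ (gsupp_deg si)) (gcompP _ (gsupp_deg sj)))).
  (* Another pair of degrees with sum [La + N] has [i'] above [La] or [j'] above [N], and by
     maximality that component lies in [Q]. *)
  case: eqP => [E|_]; last exact: Q0.
  have Eij : i' - La = - (j' - N).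
    by apply/eqP; rewrite opprB subr_eq addrAC -subr_eq opprK -E addrC eq_sym.
  have [E0|pi|pj] := pos_total (i' - La).
  - case/negP: nij; apply/eqP; congr (_, _); apply/eqP; rewrite -subr_eq0.
      by rewrite E0.
    by rewrite -oppr_eq0 -Eij E0.
  - by rewrite mulrC; apply/QM/maxLa.
  - by apply/QM/maxN; rewrite // -(opprK (j' - N)) -Eij.
move=> QL; have : Q (gcomp La x * gcomp N y).
  rewrite -[_ * _](addrK rest); apply: QD => //.
  by rewrite -mulN1r; exact: QM.
by case/(Qpr _ _ (gcomp_homog _ _) (gcomp_homog _ _)).
Qed.
End Ordered.
End Components.

Section LexicographicOrder.
Context (d : nat).
Implicit Types a b : 'rV[int]_d.

(** The positive cone of the lexicographic order; it provides the [pos] of [hprime_homog] for the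
    degree group [P]. *)
Definition lex_pos a : Prop :=
  exists j, 0 < a 0 j /\ forall i : 'I_d, (i < j)%N -> a 0 i = 0.

Lemma lex_posD a b : lex_pos a -> lex_pos b -> lex_pos (a + b).
Proof.
move=> [i [ai az]] [j [bj bz]]; case: (ltngtP i j) => [ij|ji|/val_inj ij].
- exists i; split=> [|k ki]; first by rewrite mxE bz // addr0.
  by rewrite mxE az // bz // (ltn_trans ki).
- exists j; split=> [|k kj]; first by rewrite mxE az // add0r.
  by rewrite mxE bz // az // (ltn_trans kj).
- subst j; exists i; split=> [|k ki]; first by rewrite mxE addr_gt0.
  by rewrite mxE az // bz.
Qed.

Lemma lex_pos0 : ~ lex_pos 0.
Proof. by case=> j []; rewrite mxE ltxx. Qed.

Lemma lex_pos_total a : [\/ a = 0, lex_pos a | lex_pos (- a)].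
Proof.
have [->|/eqP/rowP a0] := eqVneq a 0; first by constructor 1.
have /existsP[i0 ai0] : [exists i, a 0 i != 0].
  apply: contrapT => /negP; rewrite negb_exists => /forallP h; apply: a0 => i.
  by have := h i; rewrite negbK mxE => /eqP.
case: (@arg_minnP _ i0 (fun i => a 0 i != 0) (fun i => val i) ai0) => j aj jmin.
have az (i : 'I_d) : (i < j)%N -> a 0 i = 0.
  by move=> ij; apply/eqP; apply: contraTT ij => /jmin; rewrite -leqNgt.
move: aj; rewrite neq_lt => /orP[aj|aj]; [constructor 3|constructor 2]; exists j.
  by split=> [|i /az E]; rewrite mxE ?oppr_gt0 // E oppr0.
by split.
Qed.
End LexicographicOrder.

(** * Affine charts of projective spectra *)

Section FractionAlgebra.
Context (F : fieldType) (G : zmodType) (R : graded_alg F G).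
Context (U : set (proj R)) (Q0 : proj R) (UQ0 : U Q0).

(** The point [Q0] of [U] is there to make the ring nontrivial, as a [comAlgType]
    has to be. *)
Definition frac_comalg of U Q0 : Type := frac_ring U.
Local Notation A := (frac_comalg UQ0).
HB.instance Definition _ := GRing.ComPzRing.on A.

Definition aff (x : frac U) : A := fcls x.

Lemma affP x y : aff x = aff y <-> frac_eqv x y. Proof. exact: fclsP. Qed.
Lemma aff_surj (a : A) : exists x, a = aff x.
Proof. by exists (rpr (a : pr_quot (frac_prering U))); rewrite /aff fcls_rpr. Qed.
Lemma affD x y : aff x + aff y = aff (frac_add x y). Proof. exact: fclsD. Qed.
Lemma affM x y : aff x * aff y = aff (frac_mul x y). Proof. exact: fclsM. Qed.
Lemma aff1 : 1 = aff (frac_cst U 1). Proof. by []. Qed.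
Lemma aff0 : 0 = aff (frac_cst U 0). Proof. by []. Qed.

Fact aff_neq0 : (1 : A) != 0.
Proof.
apply/eqP; rewrite aff1 aff0 => /affP[t [_ nt]] /=.
rewrite scale1r scale0r !mulr1 mulr0 => t0; apply: (nt Q0 UQ0).
by rewrite t0; exact: pt0.
Qed.
HB.instance Definition _ := GRing.PzSemiRing_isNonZero.Build A aff_neq0.

Definition aff_scale (c : F) (a : A) : A := (calg_str (frac_alg U) c : A) * a.
Fact aff_scaleA c d a : aff_scale c (aff_scale d a) = aff_scale (c * d) a.
Proof. by rewrite /aff_scale rmorphM -mulrA. Qed.
Fact aff_scale1 : left_id 1 aff_scale.
Proof. by move=> a; rewrite /aff_scale rmorph1 mul1r. Qed.
Fact aff_scaleDr : right_distributive aff_scale +%R.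
Proof. by move=> c a a'; rewrite /aff_scale mulrDr. Qed.
Fact aff_scaleDl a : {morph aff_scale^~ a : c d / c + d}.
Proof. by move=> c d; rewrite /aff_scale rmorphD mulrDl. Qed.
HB.instance Definition _ := GRing.Zmodule_isLmodule.Build F A
  aff_scaleA aff_scale1 aff_scaleDr aff_scaleDl.
Fact aff_scaleAl (c : F) (a a' : A) : c *: (a * a') = c *: a * a'.
Proof. exact: mulrA. Qed.
HB.instance Definition _ := GRing.Lmodule_isLalgebra.Build F A aff_scaleAl.
HB.instance Definition _ := GRing.Lalgebra_isComAlgebra.Build F A.

Lemma aff_cst (c : F) : c%:A = aff (frac_cst U c).
Proof. by rewrite [LHS]mulr1. Qed.

End FractionAlgebra.
Arguments affP {F G R U Q0 UQ0 x y}.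
Arguments affD {F G R U Q0 UQ0}.
Arguments affM {F G R U Q0 UQ0}.
Arguments aff_surj {F G R U Q0 UQ0}.

Section AffineChart.
Context (F : fieldType) (G : zmodType) (R : graded_alg F G).
Context (b : R) (Lb : G) (dLb : ga_deg R Lb) (cb : ga_comp Lb b).
Context (Q0 : proj R) (Q0b : ~ (Q0 : set R) b).
Hypothesis hprimeG : forall Q : set R, is_hideal Q -> ~ Q 1 ->
  (forall x y, homog x -> homog y -> Q (x * y) -> Q x \/ Q y) -> is_hprime Q.
Hypothesis relevant : forall (Q : proj R) N, ~ (Q : set R) b -> ga_deg R N ->
  exists m N' y, [/\ ga_deg R N', ga_comp N' y, ~ (Q : set R) y & N + N' = Lb *+ m].

Local Notation D := [set Q : proj R | ~ (Q : set R) b].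
Local Notation A := (@frac_comalg F G R D Q0 Q0b).
Local Notation B := (triv_graded A).
Implicit Types (Q : proj R) (p : proj B) (z : frac D).
Local Notation aff := (@aff F G R D Q0 Q0b).

Lemma homog_triv (a : B) : homog a.
Proof. by apply/homogE; exists 0. Qed.

Lemma hideal_triv (a : set B) : is_ideal a -> is_hideal a.
Proof. by move=> ia; split=> // x ax; apply: sub_addspan; split=> //; exact: homog_triv. Qed.

Lemma hideal_ext (a a' : set R) : is_hideal a -> is_hideal a' ->
  (forall x, homog x -> a x <-> a' x) -> a = a'.
Proof.
move=> [[a0 aD _] ha] [[a'0 a'D _] ha'] E; apply/seteqP; split=> x.
  by move=> /ha; apply: addspan_sub => // y [ay hy]; exact/E.
by move=> /ha'; apply: addspan_sub => // y [ay hy]; exact/E.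
Qed.

Lemma fr_num_homog z : homog (fr_num z).
Proof. by apply/homogE; exists (fr_deg z); [exact: fr_degP|exact: fr_numP]. Qed.

Definition chart_set Q : set B := [set a | exists2 z, a = aff z & (Q : set R) (fr_num z)].

(** Independence of the representative: the denominators and the element clearing the equality of
    fractions vanish nowhere on [D], so they lie outside [Q]. *)
Lemma chart_setE Q z : ~ (Q : set R) b -> chart_set Q (aff z) <-> (Q : set R) (fr_num z).
Proof.
move=> Qb; split=> [[z' /affP[t [_ nt] E] Qz']|Qz]; last by exists z.
have : (Q : set R) (t * (fr_num z * fr_den z')).
  by rewrite E; apply/ptM; right; apply/ptM; left.
by move=> /ptM[/(nt Q Qb)//|/ptM[//|/(fr_den_nv Qb)]].
Qed.

Fact chart_hprime Q : ~ (Q : set R) b -> is_hprime (chart_set Q).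
Proof.
move=> Qb; split.
- apply: hideal_triv; split.
  + by rewrite (@aff0 _ _ _ D _ Q0b); apply/chart_setE => //=; rewrite scale0r; exact: pt0.
  + move=> x y; have [z ->] := aff_surj x; have [z' ->] := aff_surj y.
    move=> /(chart_setE _ Qb) Qz /(chart_setE _ Qb) Qz'; rewrite affD.
    by apply/chart_setE => //=; apply: ptD; apply/ptM; left.
  + move=> x y; have [z ->] := aff_surj x; have [z' ->] := aff_surj y.
    by move=> /(chart_setE _ Qb) Qz'; rewrite affM; apply/chart_setE => //=; apply/ptM; right.
- by rewrite (@aff1 _ _ _ D _ Q0b) => /(chart_setE _ Qb) /=; rewrite scale1r; exact: pt1.
- move=> x y; have [z ->] := aff_surj x; have [z' ->] := aff_surj y.
  rewrite affM => /(chart_setE _ Qb) /ptM[Qz|Qz']; [left|right]; exact/chart_setE.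
Qed.

(** Only meaningful on [D], where [b] is not in [Q]. *)
Definition chart Q : proj B :=
  match pselect (~ (Q : set R) b) with
  | left Qb => ProjPoint (chart_hprime Qb)
  | right _ => ProjPoint (chart_hprime Q0b)
  end.

Lemma chartE Q z : ~ (Q : set R) b ->
  (chart Q : set B) (aff z) <-> (Q : set R) (fr_num z).
Proof. by move=> Qb; rewrite /chart; case: pselect => // Qb'; exact: chart_setE. Qed.

(** For homogeneous [x]: all the fractions [x y / c] on [D] lie in [p]. *)
Definition chart_inv_hset p : set R :=
  [set x | forall z y, fr_num z = x * y -> (p : set B) (aff z)].
Definition chart_inv_set p : set R := [set x | forall La, chart_inv_hset p (gcomp La x)].

Lemma chart_inv_hset0 p : chart_inv_hset p 0.
Proof.
move=> z y; rewrite mul0r => z0; have -> : aff z = 0; last exact: pt0.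
by rewrite (@aff0 _ _ _ D _ Q0b); apply/affP/frac_eqv1 => /=; rewrite z0 scale0r !mul0r.
Qed.

Lemma chart_inv_hom p La x : ga_deg R La -> ga_comp La x -> chart_inv_set p x <-> chart_inv_hset p x.
Proof.
move=> dL cx; split=> [/(_ La)|px N]; first by rewrite gcomp_id.
by rewrite (gcomp_hom _ dL cx); case: ifP => // _; exact: chart_inv_hset0.
Qed.

Lemma chart_inv_hsetD p La x y : ga_deg R La -> ga_comp La x -> ga_comp La y ->
  chart_inv_hset p x -> chart_inv_hset p y -> chart_inv_hset p (x + y).
Proof.
move=> dL cx cy px py z r Ez; pose M := fr_deg z; have dM := fr_degP z.
(* [r] need not be homogeneous, but only its component of degree [M - La] contributes to the
   numerator; with it, [x r'] and [y r'] both have the degree [M] of the denominator. *)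
pose r' := gcomp (M - La) r.
have gM w : ga_comp La w -> gcomp M (w * r) = w * r'.
  by move=> cw; rewrite mulrC -[M](subrK La) (gcompM_hom _ dL cw) mulrC.
have cM w : ga_comp La w -> ga_comp M (w * r').
  by move=> /gM <-; exact: gcompP.
pose zx := Frac dM (cM x cx) (fr_denP z) (@fr_den_nv _ _ _ _ z).
pose zy := Frac dM (cM y cy) (fr_denP z) (@fr_den_nv _ _ _ _ z).
have -> : aff z = aff zx + aff zy.
  rewrite affD; apply/affP/frac_eqv1 => /=.
  rewrite -(gcomp_id dM (fr_numP z)) Ez -/M mulrDl gcompD !gM //.
  by ring.
by apply: ptD; [exact: (px zx r')|exact: (py zy r')].
Qed.

Lemma chart_inv_setD p x y : chart_inv_set p x -> chart_inv_set p y -> chart_inv_set p (x + y).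
Proof.
move=> px py La; rewrite gcompD.
have [dL|ndL] := pselect (ga_deg R La).
  exact: (chart_inv_hsetD dL (gcompP _ dL) (gcompP _ dL)).
have g0 (w : R) : gcomp La w = 0.
  by apply: gcomp_out; apply/negP => /gsupp_deg/ndL.
by rewrite !g0 addr0; exact: chart_inv_hset0.
Qed.

Lemma chart_inv_set0 p : chart_inv_set p 0.
Proof. by move=> La; rewrite gcomp0; exact: chart_inv_hset0. Qed.

Fact chart_inv_hprime p : is_hprime (chart_inv_set p).
Proof.
have cM r x : chart_inv_set p x -> chart_inv_set p (r * x).
  move=> px; rewrite (gcomp_sum r) mulr_suml big_seq.
  elim/big_ind: _ => [|u w|M /gsupp_deg dM]; [exact: chart_inv_set0|exact: chart_inv_setD|].
  move=> La; rewrite mulrC -(subrK M La) (gcompM_hom _ dM (gcompP _ dM)).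
  by move=> z y; rewrite -mulrA; exact: px.
apply: hprimeG.
- apply: gcomp_hideal; first by split=> //; [exact: chart_inv_set0|exact: chart_inv_setD].
  move=> x La px N; have [sL|/gcomp_out->] := boolP (La \in gsupp x).
    have dL := gsupp_deg sL.
    rewrite (gcomp_hom _ dL (gcompP _ dL)); case: ifP => _ //; exact: chart_inv_hset0.
  by rewrite gcomp0; exact: chart_inv_hset0.
- move=> /(chart_inv_hom p (ga_deg0 R) (ga_comp1 R)) /(_ (frac_cst D 1) 1) /=.
  by rewrite scale1r mulr1 => /(_ erefl); exact: pt1.
- move=> x y /homogE[La dL cx] /homogE[N dN cy].
  move=> /(chart_inv_hom p (ga_degD dL dN) (ga_compM dL dN cx cy)) pxy.
  (* Fractions [x u / c] and [y u' / c'] outside [p] have a product outside [p], and its numerator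
     is a multiple of [x y]. *)
  apply: contrapT => /not_orP[].
  move=> /(chart_inv_hom p dL cx)/existsNP[z]/existsNP[u]/not_implyP[Ez nz].
  move=> /(chart_inv_hom p dN cy)/existsNP[z']/existsNP[u']/not_implyP[Ez' nz'].
  have : (p : set B) (aff z * aff z').
    by rewrite affM; apply: (pxy _ (u * u')) => /=; rewrite Ez Ez'; ring.
  by move=> /ptM[].
Qed.
Definition chart_inv p : proj R := ProjPoint (chart_inv_hprime p).

Lemma chart_invP p x : homog x -> (chart_inv p : set R) x <-> chart_inv_hset p x.
Proof. by move=> /homogE[La dL cx]; exact: (chart_inv_hom p dL cx). Qed.

Lemma chart_inv_D p : ~ (chart_inv p : set R) b.
Proof.
have hb : homog b by apply/homogE; exists Lb.
have nb Q : D Q -> ~ (Q : set R) b by [].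
move=> /(chart_invP p hb)/(_ (Frac dLb cb cb nb) 1); rewrite mulr1 => /(_ erefl).
have -> : aff (Frac dLb cb cb nb) = 1; last exact: pt1.
by rewrite (@aff1 _ _ _ D _ Q0b); apply/affP/frac_eqv1 => /=; rewrite scale1r mulr1 mul1r.
Qed.

Lemma ga_compX m : ga_comp (Lb *+ m) (b ^+ m).
Proof.
elim: m => [|m IH]; first exact: ga_comp1.
rewrite mulrS exprS; apply: ga_compM => //.
by elim: m {IH} => [|m IH]; [exact: ga_deg0|rewrite mulrS; exact: ga_degD].
Qed.

Lemma ga_degX m : ga_deg R (Lb *+ m).
Proof. by elim: m => [|m IH]; [exact: ga_deg0|rewrite mulrS; exact: ga_degD]. Qed.

Definition over_bX m x (cx : ga_comp (Lb *+ m) x) : frac D :=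
  Frac (ga_degX m) cx (ga_compX m) (fun Q (Qb : D Q) => @ptX _ _ _ Q b m Qb).

Lemma chart_inv_num p z : (chart_inv p : set R) (fr_num z) <-> (p : set B) (aff z).
Proof.
split=> [/(chart_invP p (fr_num_homog z))/(_ z 1)|pz]; first by rewrite mulr1; apply.
apply/(chart_invP p (fr_num_homog z)) => z' y Ez'.
pose M := fr_deg z; pose M' := fr_deg z'; have [dM dM'] := (fr_degP z, fr_degP z').
pose y' := gcomp (M' - M) y.
have gM w : ga_comp M w -> gcomp M' (w * y) = w * y'.
  by move=> cw; rewrite mulrC -[M'](subrK M) (gcompM_hom _ dM cw) mulrC.
(* For [z = n / c] and [z' = n y / c'] the cofactor is [w = c y' / c']: then [z' = z w], so [z']
   lies in [p] along with [z]. *)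
have cw : ga_comp M' (fr_den z * y').
  by rewrite -gM; [exact: gcompP|exact: fr_denP].
pose w := Frac dM' cw (fr_denP z') (@fr_den_nv _ _ _ _ z').
have -> : aff z' = aff z * aff w.
  rewrite affM; apply/affP/frac_eqv1 => /=.
  rewrite -{1}(gcomp_id dM' (fr_numP z')) Ez' -/M' gM; last exact: fr_numP.
  by ring.
by apply/ptM; left.
Qed.

Lemma chart_invK : cancel chart_inv chart.
Proof.
move=> p; apply: proj_eq; apply/seteqP; split=> a; have [z ->] := aff_surj a.
  by move=> /(chartE _ (@chart_inv_D p)) /chart_inv_num.
by move=> /chart_inv_num /(chartE _ (@chart_inv_D p)).
Qed.

Lemma relevant_frac Q x : ~ (Q : set R) b -> homog x ->
  exists y m (c : ga_comp (Lb *+ m) (x * y)), homog y /\ ~ (Q : set R) y.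
Proof.
move=> Qb /homogE[N dN cx]; have [m [N' [y [dN' cy Qy E]]]] := relevant Qb dN.
have c : ga_comp (Lb *+ m) (x * y) by rewrite -E; exact: ga_compM.
by exists y, m, c; split=> //; apply/homogE; exists N'.
Qed.

(** Here the points need relevance: if [x] passes the test for [chart Q], the fraction [x y / b^m]
    with [y] outside [Q] puts [x y], hence [x], in [Q]. *)
Lemma chartK Q : D Q -> chart_inv (chart Q) = Q.
Proof.
move=> Qb; apply: proj_eq; have [hQ _ _] := ptP Q; have [hC _ _] := ptP (chart_inv (chart Q)).
apply: hideal_ext => // x hx; split=> [/(chart_invP _ hx) Cx|Qx].
  have [y [m [c [_ Qy]]]] := relevant_frac Qb hx.
  have /(chartE _ Qb)/= := Cx (over_bX c) y erefl.
  by move=> /ptM[].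
by apply/(chart_invP _ hx) => z y Ez; apply/chartE => //; rewrite Ez; apply/ptM; left.
Qed.

Lemma chart_cont (V : opens (proj B)) : open (D `&` chart @^-1` V).
Proof.
case: V => _ /= [a ha ->].
(* The factor [b] builds the intersection with [D] into the ideal: a prime containing [b] contains
   all of [X]. *)
pose X := [set x : R | exists2 z, a (aff z) & x = b * fr_num z].
have hb : homog b by apply/homogE; exists Lb.
exists (ideal_gen X).
  by apply: ideal_gen_hideal => _ [z az ->]; apply: homogM => //; exact: fr_num_homog.
apply/seteqP; split=> Q.
  move=> [Qb na] XQ; apply: na => x; have [z ->] := aff_surj x => az.
  have : (Q : set R) (b * fr_num z) by apply/XQ/sub_ideal_gen; exists z.
  by move=> /ptM[//|Qz]; apply/chartE.
move=> nX; have Qb : D Q.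
  move=> Qb; apply: nX; have [[iQ _] _ _] := ptP Q.
  by apply: ideal_gen_sub => // _ [z _ ->]; apply/ptM; left.
split=> // aQ; apply: nX; have [[iQ _] _ _] := ptP Q.
apply: ideal_gen_sub => // _ [z /aQ/(chartE _ Qb) Qz ->].
by apply/ptM; right.
Qed.

Lemma chart_inv_cont : continuous chart_inv.
Proof.
apply/continuousP => _ [a ha ->].
pose X := [set t : B | exists z x y, [/\ t = aff z, a x, homog x & fr_num z = x * y]].
exists (ideal_gen X); first by apply: ideal_gen_hideal => t _; exact: homog_triv.
apply/seteqP; split=> p /=.
  move=> /(hideal_notin ha (@pt0 _ _ _ _) (@ptD _ _ _ _))[x hx [ax nx]] sX; apply: nx.
  by apply/(chart_invP _ hx) => z y Ez; apply/sX/sub_ideal_gen; exists z, x, y.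
move=> nX sa; apply: nX; have [[iQ _] _ _] := ptP p.
apply: ideal_gen_sub => // _ [z [x [y [-> /sa + hx Ez]]]].
by move=> /(chart_invP _ hx) /(_ _ _ Ez).
Qed.

(** * Fractions over the chart compared with graded fractions *)

Local Notation into W V := (maps_into D chart W V).

Section Comparison.
Context (V : opens (proj B)) (W : opens (proj R)) (WV : into W V).
Implicit Types (x : frac (V : set (proj B))).

Fact quot_nv (n d : frac D) (nd : forall p, (V : set _) p -> ~ (p : set B) (aff d)) Q :
  (W : set _) Q -> ~ (Q : set R) (fr_den n * fr_num d).
Proof.
move=> WQ; have [Qb VQ] := WV WQ.
move=> /ptM[/(fr_den_nv Qb)//|Qd]; apply: (nd _ VQ).
exact/chartE.
Qed.

(** The fraction [(n1 / n2) / (d1 / d2)] in the form [n1 d2 / (n2 d1)]. *)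
Definition quot_frac (n d : frac D) nd : frac (W : set (proj R)) :=
  Frac (ga_degD (fr_degP n) (fr_degP d))
    (ga_compM (fr_degP n) (fr_degP d) (fr_numP n) (fr_denP d))
    (ga_compM (fr_degP n) (fr_degP d) (fr_denP n) (fr_numP d))
    (@quot_nv n d nd).

Definition arep (a : A) : frac D := projT1 (cid (aff_surj a)).
Lemma arepK a : aff (arep a) = a.
Proof. by rewrite /arep; case: cid. Qed.

Fact arep_nv x p : (V : set _) p -> ~ (p : set B) (aff (arep (fr_den x))).
Proof. by rewrite arepK; exact: fr_den_nv. Qed.

Definition frac_pull (s : proj_presheaf B V) : proj_presheaf R W :=
  let x := rpr (s : pr_quot (frac_prering (V : set (proj B)))) in
  fcls (@quot_frac (arep (fr_num x)) (arep (fr_den x)) (@arep_nv x)).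

Lemma frac_pullE x (n d : frac D) nd : fr_num x = aff n -> fr_den x = aff d ->
  frac_pull (fcls x) = fcls (@quot_frac n d nd).
Proof.
move=> En Ed; apply/fclsP; rewrite /frac_pull.
have := rpr_cls (T := frac_setoid (V : set (proj B))) x.
set x' := rpr _ => -[t [_ nt]] E.
set n' := arep (fr_num x'); set d' := arep (fr_den x'); set t' := arep t.
have {}E : aff t' * (aff n' * aff d) = aff t' * (aff n * aff d').
  by rewrite !arepK -En -Ed.
move: E; rewrite (affM n') (affM n) !(affM t') => /affP[s [hs ns] /= E].
(* [s] clears the equality in [A], and [t] the one of fractions over [V]. The numerator of [t']
   vanishes nowhere on [W], because the chart maps [W] into [V]. *)
exists (s * (fr_num t' * fr_den t')); last first.
  rewrite /=; transitivity (s * (fr_num t' * (fr_num n' * fr_num d) *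
    (fr_den t' * (fr_den n * fr_den d')))); first by ring.
  by rewrite E; ring.
split.
  apply: homogM => //; apply: homogM; first exact: fr_num_homog.
  exact: (nv_den t').1.
move=> Q WQ; have [Qb VQ] := WV WQ.
move=> /ptM[/(ns _ Qb)//|/ptM[Qt|/(fr_den_nv Qb)//]].
by apply: (nt _ VQ); rewrite -(arepK t); apply/chartE.
Qed.

Lemma frac_pull_arep x : frac_pull (fcls x) =
  fcls (@quot_frac (arep (fr_num x)) (arep (fr_den x)) (@arep_nv x)).
Proof. by apply: frac_pullE; rewrite arepK. Qed.

Lemma frac_pull_hom : is_alg_hom frac_pull.
Proof.
split=> [s s'|s s'|c].
- have [x ->] := fcls_surj s; have [x' ->] := fcls_surj s'.
  rewrite [fcls x + _]fclsD (frac_pull_arep x) (frac_pull_arep x') [RHS]fclsD.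
  pose n := arep (fr_num x); pose d := arep (fr_den x).
  pose n' := arep (fr_num x'); pose d' := arep (fr_den x').
  have ndd p : (V : set _) p -> ~ (p : set B) (aff (frac_mul d d')).
    by move=> Vp; rewrite -affM => /ptM[]; exact: arep_nv.
  rewrite (@frac_pullE _ (frac_add (frac_mul n d') (frac_mul n' d)) (frac_mul d d') ndd).
  + by apply/fclsP/frac_eqv1 => /=; ring.
  + by rewrite -affD -!affM !arepK.
  + by rewrite -affM !arepK.
- have [x ->] := fcls_surj s; have [x' ->] := fcls_surj s'.
  rewrite [fcls x * _]fclsM (frac_pull_arep x) (frac_pull_arep x') [RHS]fclsM.
  pose n := arep (fr_num x); pose d := arep (fr_den x).
  pose n' := arep (fr_num x'); pose d' := arep (fr_den x').
  have ndd p : (V : set _) p -> ~ (p : set B) (aff (frac_mul d d')).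
    by move=> Vp; rewrite -affM => /ptM[]; exact: arep_nv.
  rewrite (@frac_pullE _ (frac_mul n n') (frac_mul d d') ndd).
  + by apply/fclsP/frac_eqv1 => /=; ring.
  + by rewrite -!affM !arepK.
  + by rewrite -affM !arepK.
- have nd p : (V : set _) p -> ~ (p : set B) (aff (frac_cst D 1)).
    by move=> _; exact: pt1.
  rewrite [calg_str _ c]fcls_cst (@frac_pullE _ (frac_cst D c) (frac_cst D 1) nd) //.
    by rewrite [RHS]fcls_cst; apply/fclsP/frac_eqv1 => /=; rewrite scale1r; ring.
  by rewrite /= -aff_cst.
Qed.
End Comparison.

Lemma frac_pull_res (V : opens (proj B)) (W : opens (proj R)) (V' : opens (proj B))
    (W' : opens (proj R)) (i : into W V) (i' : into W' V') (j : V' `<=` V) (k : W' `<=` W) s :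
  frac_res k (frac_pull i s) = frac_pull i' (frac_res j s).
Proof.
have [x ->] := fcls_surj s; rewrite (frac_pull_arep i) [in LHS]/fcls frac_resE.
rewrite [in RHS]/fcls frac_resE -/(fcls _).
have nd p : (V' : set _) p -> ~ (p : set B) (aff (arep (fr_den x))).
  by move=> /j; exact: arep_nv.
rewrite (@frac_pullE _ _ i' _ (arep (fr_num x)) (arep (fr_den x)) nd) ?arepK //.
exact/fclsP/frac_eqv1.
Qed.

(** The element [t] clearing the equality in [R] has arbitrary degree. Relevance completes it to
    [u = t y / b^m] in [A], which does not vanish at [p]; the sections agree where [u] is
    nonzero. *)
Lemma frac_pull_inj p (V : opens (proj B)) (W : opens (proj R)) (i : into W V)
    (s s' : proj_presheaf B V) :
  (V : set _) p -> (W : set _) (chart_inv p) -> frac_pull i s = frac_pull i s' ->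
  exists (V' : opens (proj B)) (j : V' `<=` V), (V' : set _) p /\
    frac_res j s = frac_res j s'.
Proof.
have [x ->] := fcls_surj s; have [x' ->] := fcls_surj s' => Vp Wp.
rewrite !frac_pull_arep => /fclsP[t [ht nt] /= E].
set n := arep (fr_num x) in E *; set d := arep (fr_den x) in E *.
set n' := arep (fr_num x') in E *; set d' := arep (fr_den x') in E *.
have Cb := @chart_inv_D p; have Ct := nt _ Wp.
have [y [m [c [_ Cy]]]] := relevant_frac Cb ht.
pose u := aff (over_bX c).
have pu : ~ (p : set B) u by move=> /chart_inv_num /ptM[].
pose V' := opens_setI V (dopen (homog_triv u)).
have j : V' `<=` V by move=> ? [].
exists V', j; split=> //; rewrite ![frac_res _ _]frac_resE.
apply/fclsP; exists u; first by split; [exact: homog_triv|move=> Q []].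
rewrite /= -(arepK (fr_num x)) -(arepK (fr_den x')) -(arepK (fr_num x')) -(arepK (fr_den x)).
rewrite -/n -/n' -/d -/d' (affM n) (affM n') !(affM (over_bX c)).
apply/affP/frac_eqv1 => /=.
transitivity (t * (fr_num n * fr_den d * (fr_den n' * fr_num d')) * (y * b ^+ m)).
  by ring.
by rewrite E; ring.
Qed.

(** A fraction [a / c] of any degree is rewritten near the point as [(a y / b^m) / (c y / b^m)], a
    quotient of elements of [A], with [y] of complementary degree. *)
Lemma frac_pull_surj p (W : opens (proj R)) (q : proj_presheaf R W) :
  (W : set _) (chart_inv p) ->
  exists (V : opens (proj B)) (W' : opens (proj R)) (j : W' `<=` W) (i : into W' V) s,
    [/\ (V : set _) p, (W' : set _) (chart_inv p) & frac_pull i s = frac_res j q].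
Proof.
have [w ->] := fcls_surj q => Wp; pose N := fr_deg w.
have Cb := @chart_inv_D p; have Cw := fr_den_nv Wp (f := w).
have [m [N' [y [dN' cy Cy E]]]] := relevant Cb (fr_degP w).
have cn : ga_comp (Lb *+ m) (fr_num w * y).
  by rewrite -E; apply: ga_compM => //; [exact: fr_degP|exact: fr_numP].
have cd : ga_comp (Lb *+ m) (fr_den w * y).
  by rewrite -E; apply: ga_compM => //; [exact: fr_degP|exact: fr_denP].
pose n := over_bX cn; pose d := over_bX cd.
have pd : ~ (p : set B) (aff d) by move=> /chart_inv_num /ptM[].
pose V := dopen (homog_triv (aff d)).
pose W' := opens_setI W (preim_in_D chart_cont V); have j : W' `<=` W by move=> ? [].
have i : into W' V by move=> ? [].
pose x : frac (V : set (proj B)) :=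
  @Frac _ _ B (V : set (proj B)) 0 (aff n) (aff d) erefl Logic.I Logic.I (fun _ VQ => VQ).
exists V, W', j, i, (fcls x); split=> //.
  by split=> //; split=> //=; rewrite chart_invK.
rewrite (@frac_pullE _ _ i x n d (fun _ VQ => VQ)) // frac_resE.
by apply/fclsP/frac_eqv1 => /=; ring.
Qed.
End AffineChart.

(** * Charts of closed faces *)

Section FaceContraction.
Context (F : fieldType) (G : zmodType) (R : graded_alg F G) (D : deg_face R).
Local Notation S := (face_subalg D).

Lemma gcomp_val La (u : S) : gcomp La (\val u) = \val (gcomp La u).
Proof.
rewrite {1}(gcomp_sum u) raddf_sum gcomp_unique ?gsupp_uniq //; last first.
  move=> N /[dup] /gsupp_deg [dN DN] Ns; split=> //.
  exact: (gcompP u (conj dN DN : ga_deg S N)).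
by case: ifP => // /negbT/gcomp_out ->.
Qed.

Lemma homog_val (u : S) : homog u -> homog (\val u).
Proof. by move=> /homogE[La [dL _] cu]; apply/homogE; exists La. Qed.

Fact face_contr_hprime (Q : proj R) : is_hprime [set u : S | (Q : set R) (\val u)].
Proof.
split; first apply: gcomp_hideal.
- split=> [|u w Qu Qw|r u Qu] /=; first exact: pt0.
    exact: ptD.
  by apply/ptM; right.
- move=> u La /= Qu; rewrite -gcomp_val.
  by have [hQ _ _] := ptP Q; exact: hideal_gcomp.
- exact: pt1.
- by move=> u w /ptM.
Qed.
Definition face_contr (Q : proj R) : proj S := ProjPoint (face_contr_hprime Q).

Lemma face_contrK (Q : proj R) : face_closed D Q -> face_ext (face_contr Q) = Q.
Proof.
move=> cQ; apply: proj_eq; apply/seteqP; split=> x.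
  by move=> [u [r [Qu /cQ Qr ->]]]; exact: ptD.
have [u [r [Or ->]]] := face_decomp D x => Qx; exists u, r; split=> //=.
by rewrite -(addrK r (\val u)); apply: ptD => //; exact/ptN/cQ.
Qed.

Lemma face_ext_sub (Q : proj S) (u : S) : (Q : set S) u -> (face_ext Q : set R) (\val u).
Proof. by move=> Qu; exists u, 0; split=> //; [exact: addspan0|rewrite addr0]. Qed.

Lemma face_extK : cancel (@face_ext _ _ _ D) face_contr.
Proof.
move=> Q; apply: proj_eq; apply/seteqP; split=> u; first exact: face_ext_val.
exact: face_ext_sub.
Qed.

Lemma face_contr_cont : continuous face_contr.
Proof.
apply/continuousP => _ [a [ia ha] ->].
pose X := [set x : R | exists2 u : S, homog u /\ a u & x = \val u].
exists (ideal_gen X).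
  by apply: ideal_gen_hideal => _ [u [hu _] ->]; exact: homog_val.
apply/seteqP; split=> Q /=; apply: contra_not => XQ.
  by move=> u /ha; apply: addspan_sub => [|x y|w [aw hw]];
    [exact: pt0|exact: ptD|apply/XQ/sub_ideal_gen; exists w].
have [[iQ _] _ _] := ptP Q.
by apply: ideal_gen_sub => // _ [u [_ au] ->]; exact: XQ.
Qed.

(** A basic open set of [proj S] given by [b] is the preimage of the one given by [\val b], so
    preimages form a neighbourhood basis, as [direct_image_local_sections] requires. *)
Lemma face_homeo_local (Q : proj S) :
  local_sections (rs_sheaf (face_closed_space D)) (face_homeo Q).
Proof.
apply: direct_image_local_sections; last exact/sheafify_local_sections/proj_local_sections.
move=> U /proj_basis[b hb [Qb bU]].
have oV : open (set_val @^-1` (dopen (homog_val hb) : set _) : set (set_type (face_closed D))).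
  by exists (dopen (homog_val hb)) => //; exact: opensP.
exists (Opens oV); split=> [/= /face_ext_val//|Q' /= nQ']; apply: bU => Q'b.
exact/nQ'/face_ext_sub.
Qed.

Lemma face_homeo_surj (x : face_closed_space D) : face_homeo (face_contr (set_val x)) = x.
Proof. by apply: val_inj; rewrite /= face_contrK //; exact: set_valP. Qed.

Lemma face_closed_local (x : face_closed_space D) :
  local_sections (rs_sheaf (face_closed_space D)) x.
Proof. by rewrite -(face_homeo_surj x); exact: face_homeo_local. Qed.

Lemma face_closed_is_sheaf : is_sheaf (rs_sheaf (face_closed_space D)).
Proof. exact/direct_image_is_sheaf/sheafify_is_sheaf. Qed.

Lemma open_face_locally_ringed (O : opens (face_closed_space D)) :
  locally_ringed (open_subspace O).
Proof.
split=> [|x]; first exact/open_subspace_is_sheaf/face_closed_is_sheaf.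
exact/stalk_is_local/open_subspace_local_sections/face_closed_local.
Qed.
End FaceContraction.

(** * Transport of an affine chart to an open part of a closed face *)

Section FaceChart.
Context (F : fieldType) (G : zmodType) (R : graded_alg F G) (D : deg_face R).
Local Notation S := (face_subalg D).
Context (O : opens (face_closed_space D)).
Context (b : S) (Lb : G) (dLb : ga_deg S Lb) (cb : ga_comp Lb b).
Context (Q0 : proj S) (Q0b : ~ (Q0 : set S) b).
Hypothesis hprimeG : forall Q : set S, is_hideal Q -> ~ Q 1 ->
  (forall x y, homog x -> homog y -> Q (x * y) -> Q x \/ Q y) -> is_hprime Q.
Hypothesis relevant : forall (Q : proj S) N, ~ (Q : set S) b -> ga_deg S N ->
  exists m N' y, [/\ ga_deg S N', ga_comp N' y, ~ (Q : set S) y & N + N' = Lb *+ m].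
Hypothesis bO : forall Q : proj S, ~ (Q : set S) b -> (O : set _) (face_homeo Q).

Local Notation Db := [set Q : proj S | ~ (Q : set S) b].
Local Notation A := (@frac_comalg F G S Db Q0 Q0b).

Definition face_pt (x : open_subspace O) : proj R := set_val (set_val x).

Fact face_chart_open : open [set x : open_subspace O | ~ (face_pt x : set R) (\val b)].
Proof.
have hb : homog b by apply/homogE; exists Lb.
pose W := dopen (homog_val hb).
by exists (set_val @^-1` (W : set (proj R))) => //; exists W => //; exact: opensP.
Qed.
Definition face_chart_dom : opens (open_subspace O) := Opens face_chart_open.
Local Notation X := (open_subspace face_chart_dom).

Definition face_chart_pt (x : X) : proj S := face_contr D (face_pt (set_val x)).

Lemma face_chart_ptE (x : X) : face_ext (face_chart_pt x) = face_pt (set_val x).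
Proof. by apply: face_contrK; exact: set_valP. Qed.

Lemma face_chart_ptb (x : X) : Db (face_chart_pt x).
Proof. exact: (set_valP x). Qed.

Lemma face_chart_pt_cont : continuous face_chart_pt.
Proof.
apply/continuousP => W /((continuousP _).1 (@face_contr_cont _ _ _ D)) oW.
pose W1 := face_contr D @^-1` W.
exists (set_val @^-1` (set_val @^-1` W1)) => //.
by exists (set_val @^-1` W1) => //; exists W1.
Qed.

Definition face_chart (x : X) : Spec A := chart Q0b (face_chart_pt x).

Definition face_chart_inv_sub (p : Spec A) : open_subspace O :=
  exist _ (face_homeo (chart_inv hprimeG p))
    (mem_set (bO (@chart_inv_D _ _ _ _ _ dLb cb _ Q0b hprimeG p))).

Lemma face_chart_inv_mem p : (face_chart_dom : set _) (face_chart_inv_sub p).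
Proof.
move=> Cb; apply: (@chart_inv_D _ _ _ _ _ dLb cb _ Q0b hprimeG p).
exact: face_ext_val Cb.
Qed.

Definition face_chart_inv (p : Spec A) : X :=
  exist _ (face_chart_inv_sub p) (mem_set (@face_chart_inv_mem p)).

Lemma face_chart_inv_pt p : face_chart_pt (face_chart_inv p) = chart_inv hprimeG p.
Proof. exact: face_extK. Qed.

Lemma face_chart_pt_inj : injective face_chart_pt.
Proof.
move=> x y /(congr1 (@face_ext _ _ _ D)); rewrite !face_chart_ptE.
(* A point of [X] is wrapped in three subtypes: the closed set, [O] and the chart domain. *)
by move=> E; do 3 apply: val_inj.
Qed.

Lemma face_chartK : cancel face_chart face_chart_inv.
Proof.
move=> x; apply: face_chart_pt_inj; rewrite face_chart_inv_pt.
by apply: (chartK dLb cb) => //; exact: face_chart_ptb.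
Qed.

Lemma face_chart_invK : cancel face_chart_inv face_chart.
Proof. by move=> p; rewrite /face_chart face_chart_inv_pt (chart_invK dLb cb). Qed.

Lemma face_chart_cont : continuous face_chart.
Proof.
apply/continuousP => V oV.
have := (continuousP _).1 face_chart_pt_cont _ (@chart_cont _ _ _ _ _ dLb cb _ Q0b (Opens oV)).
congr open; apply/seteqP; split=> x; first by case.
by split=> //; exact: face_chart_ptb.
Qed.

Lemma face_chart_inv_cont : continuous face_chart_inv.
Proof.
apply/continuousP => _ [_ [_ [W oW <-] <-] <-].
have := (continuousP _).1 (@face_ext_cont _ _ _ D) _ oW.
by move/((continuousP _).1 (@chart_inv_cont _ _ _ _ _ Q0b hprimeG)).
Qed.

(** Sections of [X] over the preimage of [V] are, by unfolding, sections of [Proj S] over this open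
    set. *)
Definition face_chart_im (V : opens (Spec A)) : opens (proj S) :=
  opens_preim (@face_homeo_cont _ _ _ D)
    (opens_im (opens_im (opens_preim face_chart_cont V))).

Lemma face_chart_im_into V : maps_into Db (chart Q0b) (face_chart_im V) V.
Proof.
move=> Q [y [x Vx <-] E].
have -> : Q = face_chart_pt x.
  rewrite /face_chart_pt -(face_extK Q); congr (face_contr D _).
  exact: (congr1 (fun z : set_type (face_closed D) => set_val z) (esym E)).
by split; [exact: face_chart_ptb|].
Qed.

Lemma face_chart_im_inv (V : opens (Spec A)) p :
  (V : set _) p -> (face_chart_im V : set _) (chart_inv hprimeG p).
Proof.
move=> Vp; exists (set_val (face_chart_inv p)); last exact: val_inj.
by exists (face_chart_inv p) => //=; rewrite face_chart_invK.
Qed.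

Definition face_chart_sh (V : opens (Spec A)) :
    rs_sheaf (Spec A) V -> rs_sheaf X (opens_preim face_chart_cont V) :=
  @sh_map F (proj S) (Spec A) (proj_presheaf S) (proj_presheaf (triv_graded A))
    Db (chart Q0b) (@chart_cont _ _ _ _ _ dLb cb _ Q0b) (@frac_pull _ _ _ _ _ Q0b)
    (@frac_pull_res _ _ _ _ _ Q0b) V _ (@face_chart_im_into V).

Lemma face_chart_sh_hom V : is_alg_hom (@face_chart_sh V).
Proof. by apply: sh_map_hom => *; exact: frac_pull_hom. Qed.

Lemma face_chart_sh_bij V : bijective (@face_chart_sh V).
Proof.
apply: (@sh_map_bij _ _ _ _ _ Db (chart Q0b) (chart_inv hprimeG)).
- by move=> t Dt; exact: (chartK dLb cb).
- by move=> p; exact: (chart_invK dLb cb).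
- exact: chart_inv_cont.
- by move=> p V1 W i s s' Vp Wp; exact: (@frac_pull_inj _ _ _ _ _ dLb cb _ Q0b hprimeG).
- by move=> p W q; exact: (@frac_pull_surj _ _ _ _ _ dLb cb _ Q0b hprimeG).
- by move=> p; exact: face_chart_im_inv.
Qed.

Lemma face_chart_sh_res (U V : opens (Spec A)) (i : V `<=` U)
    (j : opens_preim face_chart_cont V `<=` opens_preim face_chart_cont U) s :
  face_chart_sh (res i s) = res j (face_chart_sh s).
Proof. exact: sh_map_res. Qed.

Definition face_chart_iso : rs_iso X (Spec A) :=
  @RsIso F X (Spec A) face_chart face_chart_inv face_chartK face_chart_invK
    face_chart_cont face_chart_inv_cont face_chart_sh face_chart_sh_hom
    face_chart_sh_bij face_chart_sh_res.
End FaceChart.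

(** * Modules over the Kac-Moody algebra *)

Section LinearAlgebra.
Context (F : fieldType).

(** Take a matrix of maximal rank with row space inside [Y]: an element of [Y] outside that row
    space could be adjoined and would raise the rank. *)
Lemma subspace_rows d (Y : set 'rV[F]_d) : Y 0 ->
  (forall c y z, Y y -> Y z -> Y (c *: y + z)) ->
  exists M : 'M[F]_d, forall y, Y y <-> (y <= M)%MS.
Proof.
move=> Y0 YP.
pose p r := `[< exists M : 'M[F]_d,
  (forall y : 'rV_d, (y <= M)%MS -> Y y) /\ \rank M = r >].
have ex : exists r, p r.
  exists 0%N; apply/asboolP; exists 0; rewrite mxrank0; split=> // y.
  by rewrite submx0 => /eqP->.
have ub r : p r -> (r <= d)%N by move=> /asboolP[M [_ <-]]; exact: rank_leq_row.
case: (ex_maxnP ex ub) => r /asboolP[M [MY rM]] rmax.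
exists M => y; split=> [Yy|]; last exact: MY.
apply: contrapT => /negP yM; have /rmax : p (\rank (M + y)%MS).
  apply/asboolP; exists (M + y)%MS; split=> // z /sub_addsmxP[[u w] ->] /=.
  rewrite (mx11_scalar w) mul_scalar_mx addrC; apply: YP => //.
  exact/MY/submxMl.
have : (M < M + y)%MS.
  by rewrite /ltmx addsmxSl; apply: contra yM; apply: submx_trans; exact: addsmxSr.
by rewrite ltmxErank -rM ltnNge => /andP[_ /negbTE->].
Qed.

Lemma subspace_separate d (Y : set 'rV[F]_d) u : Y 0 ->
  (forall c y z, Y y -> Y z -> Y (c *: y + z)) -> ~ Y u ->
  exists c : 'I_d -> F, (forall y, Y y -> \sum_j y 0 j * c j = 0) /\
    \sum_j u 0 j * c j <> 0.
Proof.
move=> Y0 YP; have [M YM] := subspace_rows Y0 YP.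
rewrite YM submxE => nu; apply: contrapT => nex; apply: nu.
apply/eqP/rowP => k; rewrite !mxE; apply: contrapT => ne.
apply: nex; exists (fun j => cokermx M j k); split=> // y /YM.
by rewrite submxE => /eqP/matrixP/(_ 0 k); rewrite !mxE.
Qed.

Lemma intr_inj_pchar0 : [pchar F] =i pred0 -> injective (fun z : int => z%:~R : F).
Proof.
move=> /pcharf0P ch a b /eqP; rewrite -subr_eq0 -intrB => E.
apply/eqP; rewrite -subr_eq0; case: (a - b) E => m.
  by rewrite -pmulrn ch => /eqP->.
by rewrite NegzE mulrNz oppr_eq0 -pmulrn ch.
Qed.
End LinearAlgebra.

Section LieModules.
Context (F : fieldType) (g : lie_algebra F) (V : lie_module g).
Implicit Types (x y : g) (v w : V).

Lemma lm_actDr x v w : lm_act x (v + w) = lm_act x v + lm_act x w.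
Proof. by rewrite -[v]scale1r lm_actPr !scale1r. Qed.
Lemma lm_act0r x : lm_act x (0 : V) = 0.
Proof. by apply: (addrI (lm_act x 0)); rewrite -lm_actDr !addr0. Qed.
Lemma lm_actZr x c v : lm_act x (c *: v) = c *: lm_act x v.
Proof. by rewrite -[c *: v]addr0 lm_actPr lm_act0r addr0. Qed.
Lemma lm_actDl x y v : lm_act (x + y) v = lm_act x v + lm_act y v.
Proof. by rewrite -[x]scale1r lm_actPl !scale1r. Qed.
Lemma lm_act0l v : lm_act (0 : g) v = 0.
Proof. by apply: (addrI (lm_act 0 v)); rewrite -lm_actDl !addr0. Qed.
Lemma lm_actZl c x v : lm_act (c *: x) v = c *: lm_act x v.
Proof. by rewrite -[c *: x]addr0 lm_actPl lm_act0l addr0. Qed.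

Definition lspan (X : set V) : set V :=
  addspan [set w : V | exists c v, X v /\ w = c *: v].

Lemma lspan0 X : lspan X 0. Proof. exact: addspan0. Qed.
Lemma lspan_add X v w : lspan X v -> lspan X w -> lspan X (v + w).
Proof.
move=> + sw; elim=> [|y z Xy _ IH]; first by rewrite add0r.
by rewrite -addrA; exact: addspanD.
Qed.
Lemma lspanZ X c v : lspan X v -> lspan X (c *: v).
Proof.
elim=> [|y z [d [x [Xx ->]]] _ IH]; first by rewrite scaler0; exact: addspan0.
by rewrite scalerDr scalerA; apply: addspanD => //; exists (c * d), x.
Qed.
Lemma sub_lspan (X : set V) v : X v -> lspan X v.
Proof.
move=> Xv; rewrite -[v]addr0; apply: addspanD; last exact: addspan0.
by exists 1, v; rewrite scale1r.
Qed.
Lemma lspan_act (X Y : set V) x v : (forall w, X w -> lspan Y (lm_act x w)) ->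
  lspan X v -> lspan Y (lm_act x v).
Proof.
move=> XY; elim=> [|_ z [c [u [Xu ->]]] _ IH]; first by rewrite lm_act0r; exact: lspan0.
by rewrite lm_actDr lm_actZr; apply: lspan_add => //; apply: lspanZ; exact: XY.
Qed.
End LieModules.

Section KacMoodyModules.
Context (F : fieldType) (charF : [pchar F] =i pred0).
Context (n k : nat) (A : 'M[int]_n) (alpha : 'I_n -> 'rV[int]_(n + k)).
Local Notation P := 'rV[int]_(n + k).
Local Notation g := (kac_moody F A alpha).
Local Notation hh := (@km_h F n k A alpha).
Local Notation ee := (@km_e F n k A alpha).
Local Notation ff := (@km_f F n k A alpha).
Implicit Types (la mu : P) (h : 'rV[F]_(n + k)).

Lemma weight_evalD la mu h : weight_eval (la + mu) h = weight_eval la h + weight_eval mu h.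
Proof.
by rewrite -big_split /=; apply: eq_bigr => j _; rewrite mxE intrD mulrDl.
Qed.
Lemma weight_evalN la h : weight_eval (- la) h = - weight_eval la h.
Proof. by rewrite -sumrN; apply: eq_bigr => j _; rewrite mxE intrN mulNr. Qed.
Lemma weight_evalB la mu h : weight_eval (la - mu) h = weight_eval la h - weight_eval mu h.
Proof. by rewrite weight_evalD weight_evalN. Qed.

(** A basis vector reads off a coordinate where the weights differ; characteristic 0 keeps the two
    integers distinct in [F]. *)
Lemma weight_sep la mu : la <> mu ->
  exists h, weight_eval la h - weight_eval mu h != 0 :> F.
Proof.
move=> ne; have /existsP[j nj] : [exists j, la 0 j != mu 0 j].
  apply: contrapT => /negP; rewrite negb_exists => /forallP E; apply: ne.
  by apply/rowP => j; have := E j; rewrite negbK => /eqP.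
exists (delta_mx 0 j).
have ev nu : weight_eval nu (delta_mx 0 j : 'rV[F]_(n + k)) = (nu 0 j)%:~R.
  rewrite /weight_eval (bigD1 j) //= mxE !eqxx mulr1 big1 ?addr0 // => i ij.
  by rewrite mxE (negbTE ij) andbF mulr0.
by rewrite !ev subr_eq0; apply: contra nj => /eqP/(intr_inj_pchar0 charF)/eqP.
Qed.

Section Module.
Context (V : lie_module g).
Implicit Types (v w : V).

Lemma act_h_e h i v :
  lm_act (hh h) (lm_act (ee i) v) =
  lm_act (ee i) (lm_act (hh h) v) + weight_eval (alpha i) h *: lm_act (ee i) v.
Proof.
rewrite -lm_actZl; have -> : weight_eval (alpha i) h *: ee i = la_br (hh h) (ee i).
  by rewrite -km_clsZ [RHS]/= -km_clsB; apply/esym/clsP/km_he.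
by rewrite lm_act_br addrCA subrr addr0.
Qed.

Lemma act_h_f h i v :
  lm_act (hh h) (lm_act (ff i) v) =
  lm_act (ff i) (lm_act (hh h) v) - weight_eval (alpha i) h *: lm_act (ff i) v.
Proof.
rewrite -scaleNr -lm_actZl; have -> : (- weight_eval (alpha i) h) *: ff i = la_br (hh h) (ff i).
  by rewrite -km_clsZ [RHS]/= -km_clsB; apply/esym/clsP/km_hf.
by rewrite lm_act_br addrCA subrr addr0.
Qed.

Lemma act_e_f i j v :
  lm_act (ee i) (lm_act (ff j) v) =
  lm_act (ff j) (lm_act (ee i) v) + if i == j then lm_act (hh (coroot k F i)) v else 0.
Proof.
have := lm_act_br (ee i) (ff j) v.
have -> : la_br (ee i) (ff j) = if i == j then hh (coroot k F i) else 0.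
  rewrite [LHS]/= -km_clsB.
  have -> : (if i == j then hh (coroot k F i) else 0) =
      cls ((if i == j then KMh (coroot k F i) else KM0 F n k) : km_premodule F A alpha).
    by case: ifP.
  by apply/clsP; exact: km_ef.
move=> E; have -> : (if i == j then lm_act (hh (coroot k F i)) v else 0) =
    lm_act (if i == j then hh (coroot k F i) else 0) v.
  by case: ifP => //; rewrite lm_act0l.
by rewrite E addrCA subrr addr0.
Qed.

(** Induction on a term representing the element of the algebra; a bracket acts as a commutator. *)
Lemma generators_submodule (W : set V) : W 0 ->
  (forall c v w, W v -> W w -> W (c *: v + w)) ->
  (forall h v, W v -> W (lm_act (hh h) v)) ->
  (forall i v, W v -> W (lm_act (ee i) v)) ->
  (forall i v, W v -> W (lm_act (ff i) v)) -> is_submodule W.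
Proof.
move=> W0 WP Wh We Wf; split=> // x.
have WD v w : W v -> W w -> W (v + w).
  by move=> Wv Ww; rewrite -[v]scale1r; exact: WP.
have WZ c v : W v -> W (c *: v).
  by move=> Wv; rewrite -[c *: v]addr0; exact: WP.
rewrite -(rprK (x : pm_quot (km_premodule F A alpha))); move: (rpr _) => {x}.
elim=> [h|i|i||s IHs t IHt|c s IHs|s IHs t IHt] v Wv.
- exact: Wh.
- exact: We.
- exact: Wf.
- by rewrite [X in lm_act X _](_ : _ = (0 : g)) // lm_act0l.
- by rewrite km_clsD lm_actDl; apply: WD; [exact: IHs|exact: IHt].
- by rewrite km_clsZ lm_actZl; apply: WZ; exact: IHs.
- rewrite km_clsB [lm_act _ _](lm_act_br (g := g)); apply: WD.
    exact/IHs/IHt.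
  by rewrite -scaleN1r; apply/WZ/IHt/IHs.
Qed.

(** On a sum of weight spaces these are the forms on the weight space of [la], extended by zero. The
    formulation by the action of [h] needs no decomposition of [V]. *)
Definition hdual la (phi : V -> F) : Prop :=
  scalar phi /\ forall h w, phi (lm_act (hh h) w) = weight_eval la h * phi w.

Lemma scalar0 (phi : V -> F) : scalar phi -> phi 0 = 0.
Proof. by move=> /(_ (-1) 0 0); rewrite scaler0 addr0 mulN1r addNr. Qed.
End Module.
End KacMoodyModules.

(** * Weight forms, weight projectors and words in highest weight modules *)

Section HighestWeight.
Context (F : fieldType) (charF : [pchar F] =i pred0).
Context (n k : nat) (A : 'M[int]_n) (alpha : 'I_n -> 'rV[int]_(n + k)).
Local Notation P := 'rV[int]_(n + k).
Local Notation g := (kac_moody F A alpha).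
Local Notation hh := (@km_h F n k A alpha).
Local Notation ee := (@km_e F n k A alpha).
Local Notation ff := (@km_f F n k A alpha).
Implicit Types (la mu : P) (h : 'rV[F]_(n + k)).

Section WeightSpaces.
Context (V : lie_module g).
Implicit Types (v w : V) (phi : V -> F).

Lemma weight_spaceZ la c v : weight_space la v -> weight_space la (c *: v).
Proof. by move=> vl h; rewrite lm_actZr vl !scalerA mulrC. Qed.

Lemma weight_space_f la i v :
  weight_space la v -> weight_space (la - alpha i) (lm_act (ff i) v).
Proof. by move=> vl h; rewrite act_h_f vl lm_actZr weight_evalB scalerBl. Qed.

Lemma act_sum (x : g) (I : Type) (r : seq I) (u : I -> V) :
  lm_act x (\sum_(i <- r) u i) = \sum_(i <- r) lm_act x (u i).
Proof. by apply: big_morph; [exact: lm_actDr|exact: lm_act0r]. Qed.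

Lemma weight_sum_eq0 (r : seq (P * V)) la v : weight_space la v ->
  (forall p, p \in r -> weight_space p.1 p.2 /\ p.1 <> la) ->
  v = \sum_(p <- r) p.2 -> v = 0.
Proof.
elim: {r}(size r) {-2}r v (erefl (size r)) => [|m IH] [|[mu w] r] // v.
  by move=> _ _ _ ->; rewrite big_nil.
move=> [sr] vl rP E.
have [wm /nesym/(weight_sep charF)[h dh]] : weight_space mu w /\ mu <> la.
  by apply: (rP (mu, w)); rewrite inE eqxx.
(* [h - mu(h)] kills the first summand and rescales every other one; since [d la] is nonzero,
   induction on the number of summands applies. *)
pose d (nu : P) : F := weight_eval nu h - weight_eval mu h.
have rP' p : p \in r -> weight_space p.1 p.2 /\ p.1 <> la.
  by move=> pr; apply: rP; rewrite inE pr orbT.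
have : d la *: v = 0.
  apply: (IH [seq (p.1, d p.1 *: p.2) | p <- r]); first by rewrite size_map.
  - exact: weight_spaceZ.
  - move=> _ /mapP[p /rP'[pw np] ->]; split=> //; exact: weight_spaceZ.
  rewrite big_map (eq_big_seq (fun p => lm_act (hh h) p.2 - weight_eval mu h *: p.2)).
    rewrite sumrB -act_sum -scaler_sumr scalerBl -vl [in LHS]E big_cons /=.
    by rewrite lm_actDr wm scalerDr opprD addrACA subrr add0r.
  by move=> p /rP'[pw _]; rewrite scalerBl pw.
by move/eqP; rewrite scaler_eq0 (negbTE dh) => /eqP.
Qed.

Lemma hdual_weight la mu phi v : hdual la phi -> weight_space mu v -> mu <> la ->
  phi v = 0.
Proof.
move=> [lphi hphi] vm /(weight_sep charF)[h dh].
have := hphi h v; rewrite vm -[_ *: v]addr0 lphi (scalar0 lphi) addr0 => /eqP.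
by rewrite -subr_eq0 -mulrBl mulf_eq0 (negbTE dh) => /eqP.
Qed.

Lemma hdual_restricted la phi : hdual la phi -> restricted_dual phi.
Proof.
move=> hphi; split; first by case: hphi.
exists [:: la] => mu; rewrite inE => /eqP ne v vm.
exact: hdual_weight hphi vm ne.
Qed.

Lemma hdual_e la i phi : hdual la phi -> hdual (la - alpha i) (phi \o lm_act (ee i)).
Proof.
move=> [lphi hphi]; split=> [c v w|h w] /=; first by rewrite lm_actPr lphi.
have -> : lm_act (ee i) (lm_act (hh h) w) =
    (- weight_eval (alpha i) h) *: lm_act (ee i) w + lm_act (hh h) (lm_act (ee i) w).
  by rewrite act_h_e scaleNr addrCA addNr addr0.
by rewrite lphi hphi weight_evalB mulrBl mulNr addrC.
Qed.

Lemma hdual_f la i phi : hdual la phi -> hdual (la + alpha i) (phi \o lm_act (ff i)).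
Proof.
move=> [lphi hphi]; split=> [c v w|h w] /=; first by rewrite lm_actPr lphi.
have -> : lm_act (ff i) (lm_act (hh h) w) =
    weight_eval (alpha i) h *: lm_act (ff i) w + lm_act (hh h) (lm_act (ff i) w).
  by rewrite act_h_f addrCA subrr addr0.
by rewrite lphi hphi weight_evalD mulrDl addrC.
Qed.

(** Lagrange interpolation in the action of [h]: a projector onto the weight
    space of [mu] along those of the other weights in [s]. *)
Definition weight_proj mu (s : seq P) (v : V) : V :=
  foldr (fun nu u => match pselect (mu <> nu) with
    | left ne => let h := projT1 (cid (weight_sep charF ne)) in
        (weight_eval mu h - weight_eval nu h)^-1 *:
          (lm_act (hh h) u - weight_eval nu h *: u)
    | right _ => u end) v s.

Lemma weight_projP mu s c v w :
  weight_proj mu s (c *: v + w) = c *: weight_proj mu s v + weight_proj mu s w.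
Proof.
elim: s => //= nu s ->; case: pselect => // ne.
rewrite lm_actPr -!scaleNr !scalerDr !scalerA.
rewrite addrACA; congr (_ + _ + _); rewrite ?scalerA; congr (_ *: _); ring.
Qed.

(** For a weight outside [s] and different from [mu] the scalar is left open; this is harmless, as
    the forms to be decomposed vanish on such weight spaces. *)
Lemma weight_proj_weight mu s ka v : weight_space ka v -> exists c,
  [/\ weight_proj mu s v = c *: v, ka = mu -> c = 1 &
     ka \in s -> ka <> mu -> c = 0].
Proof.
move=> vk; elim: s => [|nu s [c [E c1 c0]]]; first by exists 1; rewrite scale1r.
rewrite /= E; case: pselect => [ne|/contrapT Emn] /=.
  case: cid => h dh /=.
  exists ((weight_eval mu h - weight_eval nu h)^-1 *
    ((weight_eval ka h - weight_eval nu h) * c)); split.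
  - rewrite lm_actZr vk !scalerA -scalerBl scalerA; congr (_ *: _); ring.
  - by move=> Ek; rewrite (c1 Ek) Ek mulr1 mulVf.
  - rewrite inE => /orP[/eqP-> _|/c0 H /H->]; first by rewrite subrr mul0r mulr0.
    by rewrite !mulr0.
exists c; split=> //; rewrite inE => /orP[/eqP->|//].
by rewrite Emn.
Qed.
End WeightSpaces.

Section Irreducible.
Context (La : P) (V : lie_module g) (v0 : V) (hw : is_irr_hw La v0).
Implicit Types (s : seq 'I_n) (v w : V).

Definition word s : V := foldr (fun i w => lm_act (ff i) w) v0 s.
Definition word_weight s : P := La - \sum_(i <- s) alpha i.

Lemma word_weightP s : weight_space (word_weight s) (word s).
Proof.
elim: s => [|i s IH] /=; first by rewrite /word_weight big_nil subr0; case: hw.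
rewrite [word_weight _](_ : _ = word_weight s - alpha i); first exact: weight_space_f.
by rewrite /word_weight big_cons opprD addrA addrAC.
Qed.

Local Notation words := [set w : V | exists s, w = word s].

(** The span is stable under the generators: [e_i] moves past each [f_j] by [act_e_f], leaving
    multiples of words, and finally kills [v0]. *)
Lemma lspan_words v : lspan words v.
Proof.
suff H : is_submodule (lspan words).
  have -> // : lspan words = setT.
  by apply: (hw_gen hw H); apply: sub_lspan; exists [::].
apply: generators_submodule.
- exact: lspan0.
- by move=> c u w su sw; apply: lspan_add => //; exact: lspanZ.
- move=> h u; apply: lspan_act => _ [s ->].
  by rewrite word_weightP; apply/lspanZ/sub_lspan; exists s.
- move=> i u; apply: lspan_act => _ [s ->].
  elim: s => [|j s IH] /=; first by rewrite (hw_e hw); exact: lspan0.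
  rewrite act_e_f; apply: lspan_add.
    apply: lspan_act IH => _ [t ->]; by apply: sub_lspan; exists (j :: t).
  case: ifP => _; last exact: lspan0.
  by rewrite word_weightP; apply/lspanZ/sub_lspan; exists s.
- move=> i u; apply: lspan_act => _ [s ->].
  by apply: sub_lspan; exists (i :: s).
Qed.

Lemma words_ext (phi psi : V -> F) : scalar phi -> scalar psi ->
  (forall s, phi (word s) = psi (word s)) -> phi = psi.
Proof.
move=> lphi lpsi E; apply/funext => v.
elim: (lspan_words v) => [|_ w [c [_ [[s ->] ->]]] _ IH].
  by rewrite !scalar0.
by rewrite lphi lpsi E IH.
Qed.

Lemma weight_sum_lspan (X : set V) v :
  (forall w, X w -> exists2 mu, weight_space mu w & mu <> La) ->
  lspan X v -> weight_space La v -> v = 0.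
Proof.
move=> XP sv vl; have [r [rP E]] : exists r : seq (P * V),
    (forall p, p \in r -> weight_space p.1 p.2 /\ p.1 <> La) /\ v = \sum_(p <- r) p.2.
  elim: sv {vl} => [|_ w [c [x [Xx ->]]] _ [r [rP ->]]].
    by exists [::]; rewrite big_nil.
  have [mu wm ne] := XP x Xx; exists ((mu, c *: x) :: r); rewrite big_cons; split=> // p.
  by rewrite inE => /orP[/eqP->|/rP//]; split=> //; exact: weight_spaceZ.
exact: weight_sum_eq0 vl rP E.
Qed.

Hypothesis alpha_free : forall c : 'I_n -> int, \sum_i c i *: alpha i = 0 -> forall i, c i = 0.

Lemma sum_alpha_count s : \sum_(i <- s) alpha i = \sum_i (count_mem i s)%:Z *: alpha i.
Proof.
elim: s => [|j s IH] /=; first by rewrite big_nil big1 // => i _; rewrite scale0r.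
rewrite big_cons IH (bigD1 j) //= [RHS](bigD1 j) //= eqxx addrA; congr (_ + _).
  by rewrite PoszD scalerDl scale1r.
by apply: eq_bigr => i ij; rewrite eq_sym (negbTE ij).
Qed.

(** Independence of the simple roots makes the weight count each letter. Thus finitely many words
    share a weight, which is the form in which finite dimension of weight spaces is used. *)
Lemma word_weight_perm s t : word_weight s = word_weight t -> perm_eq s t.
Proof.
move=> /addrI/oppr_inj; rewrite !sum_alpha_count => /eqP.
rewrite -subr_eq0 -sumrB => /eqP E; apply/allP => i _ /=.
have /alpha_free/(_ i)/eqP : \sum_i ((count_mem i s)%:Z - (count_mem i t)%:Z) *: alpha i = 0.
  by rewrite -[RHS]E; apply: eq_bigr => j _; rewrite scalerBl.
by rewrite subr_eq0 eqz_nat.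
Qed.

Lemma word_weight_hw s : word_weight s = La -> s = [::].
Proof.
move=> E; have /word_weight_perm : word_weight s = word_weight [::].
  by rewrite E /word_weight big_nil subr0.
by move/perm_size/size0nil.
Qed.

(** The form is the coefficient of [v0] along the span of the nonempty words; it is well defined
    because their weights differ from [La]. *)
Lemma hw_functional : exists2 phi, hdual La phi & phi v0 <> 0.
Proof.
pose X := [set w : V | exists2 s, s <> [::] & w = word s].
have ex v : exists c, lspan X (v - c *: v0).
  elim: (lspan_words v) => [|_ w [c [_ [[s ->] ->]]] _ [d IH]].
    by exists 0; rewrite scale0r subr0; exact: lspan0.
  case: s => [|i s].
    by exists (c + d); rewrite scalerDl opprD addrACA subrr add0r.
  exists d; rewrite -addrA; apply: lspan_add => //.
  by apply/lspanZ/sub_lspan; exists (i :: s).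
have X0 c : lspan X (c *: v0) -> c = 0.
  move=> /weight_sum_lspan E; have : c *: v0 = 0.
    apply: E => [_ [s ns ->]|]; last by apply: weight_spaceZ; case: hw.
    by exists (word_weight s); [exact: word_weightP|move/word_weight_hw].
  by move/eqP; rewrite scaler_eq0 => /orP[/eqP//|/eqP]; case: hw.
pose phi v := projT1 (cid (ex v)).
have phiP v : lspan X (v - phi v *: v0) := projT2 (cid (ex v)).
have uni v c : lspan X (v - c *: v0) -> phi v = c.
  move=> Xc; apply/eqP; rewrite -subr_eq0; apply/eqP/X0; rewrite scalerBl.
  have -> : phi v *: v0 - c *: v0 = (v - c *: v0) + (-1) *: (v - phi v *: v0).
    by rewrite scaleN1r opprB [RHS]addrC addrA subrK.
  by apply: lspan_add => //; exact: lspanZ.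
exists phi; last first.
  rewrite (uni v0 1); first by apply/eqP; exact: oner_neq0.
  by rewrite scale1r subrr; exact: lspan0.
split=> [c v w|h v].
  apply: uni; rewrite scalerDl opprD addrACA -scalerA -scalerBr.
  by apply: lspan_add => //; exact: lspanZ.
apply: uni; have -> : lm_act (hh h) v - (weight_eval La h * phi v) *: v0 =
    lm_act (hh h) (v - phi v *: v0).
  rewrite -scaleN1r lm_actDr scaleN1r; congr (_ + _).
  by rewrite -scaleNr lm_actZr (hw_h hw) scalerA mulNr mulrC scaleNr.
apply: lspan_act (phiP v) => _ [s ns ->].
by rewrite word_weightP; apply/lspanZ/sub_lspan; exists s.
Qed.

(** [phi] is the sum of its composites with the projectors for the weights in [s]; this is checked
    on words, where [phi] vanishes unless the weight lies in [s]. *)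
Lemma restricted_dual_hdual (phi : V -> F) : restricted_dual phi ->
  addspan [set psi : V -> F | exists mu, hdual mu psi] phi.
Proof.
move=> [lphi [s phis]]; pose psi mu v := phi (weight_proj mu s v).
have lpsi mu : scalar (psi mu) by move=> c v w; rewrite /psi weight_projP lphi.
have phiZ c v : phi (c *: v) = c * phi v.
  by rewrite -[c *: v]addr0 lphi (scalar0 lphi) addr0.
have psiZ mu c v : psi mu (c *: v) = c * psi mu v.
  by rewrite -[c *: v]addr0 lpsi (scalar0 (lpsi mu)) addr0.
have psiE mu t : psi mu (word t) = if (word_weight t \in s) && (word_weight t == mu)
    then phi (word t) else 0.
  have [c [E c1 c0]] := weight_proj_weight mu s (word_weightP t).
  rewrite /psi E phiZ; case: (boolP (word_weight t \in s)) => ts /=; last first.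
    by rewrite (phis _ ts _ (word_weightP t)) mulr0.
  by case: eqP => [/c1->|/(c0 ts)->]; rewrite ?mul1r ?mul0r.
have hpsi mu : hdual mu (psi mu).
  split=> // h; apply/funeqP; apply: words_ext => [c v w|c v w|t].
  - by rewrite lm_actPr lpsi.
  - by rewrite lpsi mulrDr !mulrA (mulrC c).
  - rewrite word_weightP psiZ psiE; case: andP => [[_ /eqP->//]|_].
    by rewrite !mulr0.
have -> : phi = \sum_(mu <- undup s) psi mu.
  apply: words_ext => // [c v w|t].
    rewrite !fct_sumE mulr_sumr -big_split; apply: eq_bigr => mu _ /=; exact: lpsi.
  rewrite fct_sumE (eq_bigr (fun mu => if (word_weight t \in s) && (word_weight t == mu)
    then phi (word t) else 0)) //.
  have [ts|ts] := boolP (word_weight t \in s).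
    rewrite (bigD1_seq (word_weight t)) ?undup_uniq ?mem_undup //= eqxx.
    by rewrite big1 ?addr0 // => mu /negbTE; rewrite eq_sym => ->.
  by rewrite big1 // (phis _ ts _ (word_weightP t)).
elim: (undup s) => [|mu r IH]; first by rewrite big_nil; exact: addspan0.
by rewrite big_cons; apply: addspanD => //; exists mu.
Qed.
End Irreducible.
End HighestWeight.

(** * Products in the Cartan algebra *)

Section TensorFunctionals.
Context (F : fieldType) (g : lie_algebra F) (V W : lie_module g).
Context (phi : V -> F) (psi : W -> F) (lphi : scalar phi) (lpsi : scalar psi).
Implicit Types s t : tensor V W.

Lemma tensP (t : tensor V W) : exists u : tens_term V W, t = cls (u : tens_premodule V W).
Proof. by exists (rpr (t : pm_quot (tens_premodule V W))); rewrite rprK. Qed.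

Lemma tens_fun_pure v w : tens_fun phi psi (tpure v w) = phi v * psi w.
Proof. exact: (tens_funE (Tpure v w)). Qed.

Lemma tens_fun_scalar : scalar (tens_fun phi psi : tensor V W -> F).
Proof.
move=> c s t; have [u ->] := tensP s; have [u' ->] := tensP t.
rewrite [c *: _](_ : _ = cls (Tscale c u : tens_premodule V W)); last by rewrite tens_clsZ.
rewrite [_ + _](_ : _ = cls (Tadd (Tscale c u) u' : tens_premodule V W)).
  by rewrite !(tens_funE _ lphi lpsi).
by rewrite tens_clsD.
Qed.

Lemma tens_fun_act x t : tens_fun phi psi (lm_act x t) =
  tens_fun (phi \o lm_act x) psi t + tens_fun phi (psi \o lm_act x) t.
Proof.
have lx : scalar (phi \o lm_act x) by move=> c v w /=; rewrite lm_actPr lphi.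
have lx' : scalar (psi \o lm_act x) by move=> c v w /=; rewrite lm_actPr lpsi.
have [u ->] := tensP t; rewrite [lm_act _ _]tens_actE !tens_funE //.
elim: u => [v w||u IHu u' IHu'|c u IHu] //=; first by rewrite addr0.
  by rewrite IHu IHu' addrACA.
by rewrite IHu mulrDr.
Qed.
End TensorFunctionals.

Section TensorWeights.
Context (F : fieldType) (n k : nat) (A : 'M[int]_n) (alpha : 'I_n -> 'rV[int]_(n + k)).
Local Notation g := (kac_moody F A alpha).

Lemma hdual_tens_fun (V W : lie_module g) la mu (phi : V -> F) (psi : W -> F) :
  hdual la phi -> hdual mu psi ->
  hdual (la + mu) (tens_fun phi psi : tensor V W -> F).
Proof.
move=> [lphi hphi] [lpsi hpsi]; split=> [|h t]; first exact: tens_fun_scalar.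
have [u ->] := tensP t; rewrite [lm_act _ _]tens_actE !tens_funE // weight_evalD.
elim: u => [v w||u IHu u' IHu'|c u IHu] /=; rewrite ?hphi ?hpsi ?IHu ?IHu' ?mulr0 //; ring.
Qed.

Lemma hdualZ (V : lie_module g) la c (phi : V -> F) :
  hdual la phi -> hdual la (fun w => c * phi w).
Proof.
move=> [lphi hphi]; split=> [d v w|h w]; first by rewrite lphi mulrDr !mulrA (mulrC c).
by rewrite hphi !mulrA (mulrC c).
Qed.

Lemma hdual_comp_hom (V W : lie_module g) (f : V -> W) la (phi : W -> F) :
  is_lie_hom f -> hdual la phi -> hdual la (phi \o f).
Proof.
move=> [lf hf] [lphi hphi]; split=> [c v w|h w] /=; first by rewrite lf lphi.
by rewrite hf hphi.
Qed.
End TensorWeights.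

(** * Weight forms as sums of products *)

Section ProductsSpan.
Context (F : fieldType) (charF : [pchar F] =i pred0).
Context (n k : nat) (A : 'M[int]_n) (alpha : 'I_n -> 'rV[int]_(n + k)).
Local Notation P := 'rV[int]_(n + k).
Local Notation g := (kac_moody F A alpha).
Hypothesis alpha_free : forall c : 'I_n -> int, \sum_i c i *: alpha i = 0 -> forall i, c i = 0.
Context (La N : P) (V V1 V2 : lie_module g) (v : V) (v1 : V1) (v2 : V2).
Hypotheses (hV : is_irr_hw (La + N) v) (hV1 : is_irr_hw La v1) (hV2 : is_irr_hw N v2).
Context (Phi : V -> tensor V1 V2) (Phi_hom : is_lie_hom Phi) (Phi_hw : Phi v = tpure v1 v2).

Definition coprod (phi : V1 -> F) (psi : V2 -> F) : V -> F := fun w => tens_fun phi psi (Phi w).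

Definition coprods : set (V -> F) := [set chi | exists la mu phi psi,
  [/\ hdual la phi, hdual mu psi & chi = coprod phi psi]].

Lemma coprod_hdual la mu phi psi : hdual la phi -> hdual mu psi ->
  hdual (la + mu) (coprod phi psi).
Proof. by move=> hphi hpsi; apply: (hdual_comp_hom Phi_hom); exact: hdual_tens_fun. Qed.

(** The common kernel of the products is a submodule missing the highest weight
    vector, hence zero. *)
Lemma coprods_separate w : (forall chi, coprods chi -> chi w = 0) -> w = 0.
Proof.
pose K := [set w : V | forall chi, coprods chi -> chi w = 0].
have sub : is_submodule K.
  (* The composite of [phi ⊗ psi] with the action of [x] is [phi x ⊗ psi + phi ⊗ psi x]; for
     [x = e_i] or [f_i] both terms again come from weight forms. *)
  have actK x :
      (forall la (phi : V1 -> F), hdual la phi -> exists mu, hdual mu (phi \o lm_act x)) ->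
      (forall la (psi : V2 -> F), hdual la psi -> exists mu, hdual mu (psi \o lm_act x)) ->
      forall u, K u -> K (lm_act x u).
    move=> h1 h2 u Ku _ [la [mu [phi [psi [hphi hpsi ->]]]]].
    rewrite /coprod; case: (Phi_hom) => _ ->; rewrite tens_fun_act ?(proj1 hphi) ?(proj1 hpsi) //;
      [|exact: (proj1 hphi)|exact: (proj1 hpsi)].
    have [la' hphi'] := h1 _ _ hphi; have [mu' hpsi'] := h2 _ _ hpsi.
    rewrite [X in X + _](Ku (coprod (phi \o lm_act x) psi)); last first.
      by exists la', mu, (phi \o lm_act x), psi.
    rewrite add0r; apply: (Ku (coprod phi (psi \o lm_act x))).
    by exists la, mu', phi, (psi \o lm_act x).
  apply: generators_submodule.
  - move=> _ [la [mu [phi [psi [hphi hpsi ->]]]]]; apply: scalar0.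
    by case: (coprod_hdual hphi hpsi).
  - move=> c u u' Ku Ku' chi Cchi; have [la [mu [phi [psi [hphi hpsi E]]]]] := Cchi.
    by have [l _] := coprod_hdual hphi hpsi; rewrite E l -E (Ku _ Cchi) (Ku' _ Cchi) mulr0 addr0.
  - move=> h u Ku chi Cchi; have [la [mu [phi [psi [hphi hpsi E]]]]] := Cchi.
    by have [_ l] := coprod_hdual hphi hpsi; rewrite E l -E (Ku _ Cchi) mulr0.
  - by move=> i; apply: actK => la phi /hdual_e h; exists (la - alpha i).
  - by move=> i; apply: actK => la phi /hdual_f h; exists (la + alpha i).
have [K0|KT] := hw_irr hV sub; first by move=> Kw; have : K w by []; rewrite K0.
have [phi hphi phi1] := hw_functional charF hV1 alpha_free.
have [psi hpsi psi1] := hw_functional charF hV2 alpha_free.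
have : K v by rewrite KT.
move=> /(_ (coprod phi psi)); rewrite /coprod Phi_hw tens_fun_pure; [|by case: hphi|by case: hpsi].
have C : coprods (coprod phi psi) by exists La, N, phi, psi.
by move=> /(_ C)/eqP; rewrite mulf_eq0 => /orP[/eqP|/eqP].
Qed.

(** A form of weight [mu] is determined by its values on the finitely many words of that weight. If
    [chi] were no sum of products, a combination of these words would be killed by all products but
    not by [chi], against [coprods_separate]. *)
Lemma hdual_coprods mu (chi : V -> F) : hdual mu chi -> addspan coprods chi.
Proof.
move=> hchi; have [lchi _] := hchi.
have [[s0 Es0]|ns] := pselect (exists s, word_weight alpha (La + N) s = mu); last first.
  rewrite (_ : chi = 0); first exact: addspan0.
  apply: (words_ext hV) => // [c w w'|s]; first by rewrite mulr0 addr0.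
  by apply: (hdual_weight charF hchi (word_weightP hV s)) => E; apply: ns; exists s.
pose ws := permutations s0; pose d := size ws; pose u (j : 'I_d) : V := word v (nth [::] ws j).
have wP s : word_weight alpha (La + N) s = mu -> exists j, word v s = u j.
  move=> Es; have sws : s \in ws.
    by rewrite mem_permutations; apply: (word_weight_perm alpha_free (La := La + N)); rewrite Es0.
  by rewrite -index_mem in sws; exists (Ordinal sws); rewrite /u nth_index // -index_mem.
have uP j : weight_space mu (u j).
  rewrite -[X in weight_space X _](_ : word_weight alpha (La + N) (nth [::] ws j) = mu).
    exact: word_weightP.
  have : nth [::] ws j \in ws by exact: mem_nth.
  rewrite mem_permutations => /(perm_big _) E.
  by rewrite -Es0 /word_weight E.
(* Only products of total weight [mu] are kept, so that every sum of them has weight [mu] and is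
   determined by its row of values. *)
pose C := [set chi' : V -> F | exists la la' phi psi,
  [/\ la + la' = mu, hdual la phi, hdual la' psi & chi' = coprod phi psi]].
pose Y := [set y : 'rV[F]_d | exists2 t, addspan C t & y = \row_j t (u j)].
have CP t : addspan C t -> hdual mu t.
  elim=> [|x y [la [la' [phi [psi [Emu hphi hpsi ->]]]]] _ [ly hy]].
    by split=> [c w w'|h w] /=; rewrite mulr0 ?addr0.
  have [lx hx] := coprod_hdual hphi hpsi; split=> [c w w'|h w] /=.
    by rewrite !fctE lx ly; ring.
  by rewrite !fctE hx hy Emu mulrDr.
have [[t Ct Et]|nY] := pselect (Y (\row_j chi (u j))).
  have -> : chi = t.
    have ht := CP t Ct; have [lt _] := ht.
    apply: (words_ext hV) => // s.
    have [/wP[j ->]|ne] := pselect (word_weight alpha (La + N) s = mu).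
      by have /rowP/(_ j) := Et; rewrite !mxE.
    rewrite (hdual_weight charF hchi (word_weightP hV s) ne).
    by rewrite (hdual_weight charF ht (word_weightP hV s) ne).
  elim: Ct => [|x y [la [la' [phi [psi [_ hphi hpsi ->]]]]] _ IH]; first exact: addspan0.
  by apply: addspanD => //; exists la, la', phi, psi.
have Y0 : Y 0.
  by exists 0; [exact: addspan0|apply/rowP => j; rewrite !mxE].
have YP c y z : Y y -> Y z -> Y (c *: y + z).
  move=> [s sC ->] [t tC ->]; exists ((fun w => c * s w) + t); last first.
    by apply/rowP => j; rewrite !mxE.
  elim: sC => [|a b [la [la' [phi [psi [Emu hphi hpsi ->]]]]] _ IH].
    rewrite (_ : _ + t = t) //; apply/funext => w; rewrite !fctE.
    by rewrite mulr0 add0r.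
  rewrite (_ : _ + t = coprod (fun w => c * phi w) psi + ((fun w => c * b w) + t)).
    apply: addspanD => //; exists la, la', (fun w => c * phi w), psi; split=> //.
    exact: hdualZ.
  apply/funext => w; rewrite !fctE mulrDr addrA; congr (_ + _ + _).
  have [lphi _] := hphi; have [lpsi _] := hpsi; have [lcphi _] := hdualZ c hphi.
  rewrite /coprod; have [x ->] := tensP (Phi w); rewrite !tens_funE //.
  elim: x => [p q||x IHx y' IHy|e x IHx] /=; rewrite ?mulr0 ?mulrA -?IHx -?IHy ?mulrDr //.
  by rewrite mulrA (mulrC c).
have [c [cY cu]] := subspace_separate Y0 YP nY.
case: cu; under eq_bigr => j _ do rewrite mxE.
have chiS (t : V -> F) : scalar t -> t (\sum_j c j *: u j) = \sum_j t (u j) * c j.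
  move=> lt; have tD : {morph t : a b / a + b}.
    by move=> a b; have := lt 1 a b; rewrite scale1r mul1r.
  rewrite (big_morph t tD (scalar0 lt)); apply: eq_bigr => j _.
  by rewrite -[c j *: _]addr0 lt (scalar0 lt) addr0 mulrC.
rewrite -chiS // (_ : \sum_j c j *: u j = 0) ?(scalar0 lchi) //.
(* Products of weight [mu] kill the combination by the choice of [c], all others because it has
   weight [mu]. *)
apply: coprods_separate => _ [la [la' [phi [psi [hphi hpsi ->]]]]].
have hc := coprod_hdual hphi hpsi; have [lc _] := hc; rewrite chiS //.
have [Emu|ne] := pselect (la + la' = mu).
  have := cY (\row_j coprod phi psi (u j)).
  under eq_bigr => j _ do rewrite mxE.
  apply; exists (coprod phi psi) => //.
  rewrite -[coprod _ _]addr0; apply: addspanD; last exact: addspan0.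
  by exists la, la', phi, psi.
rewrite big1 // => j _; rewrite (hdual_weight charF hc (uP j)) ?mul0r //.
exact/nesym.
Qed.
End ProductsSpan.

Section CartanProducts.
Context (F : fieldType) (charF : [pchar F] =i pred0).
Context (n k : nat) (A : 'M[int]_n) (alpha : 'I_n -> 'rV[int]_(n + k)).
Local Notation P := 'rV[int]_(n + k).
Hypothesis alphaP : is_simple_roots A alpha.
Context (L : P -> lie_module (kac_moody F A alpha)) (v : forall La, L La).
Hypothesis LP : forall La, Pplus La -> is_irr_hw La (v La).
Context (CA : cartan_algebra v).

Lemma restricted_dualD La (phi psi : L La -> F) :
  restricted_dual phi -> restricted_dual psi -> restricted_dual (phi + psi).
Proof.
move=> [lphi [s phis]] [lpsi [t psit]]; split=> [c x y|].
  by rewrite !fctE lphi lpsi; ring.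
exists (s ++ t) => mu; rewrite mem_cat negb_or => /andP[ms mt] x xm.
by rewrite !fctE (phis _ ms _ xm) (psit _ mt _ xm) addr0.
Qed.

Lemma restricted_dual0 La : restricted_dual (0 : L La -> F).
Proof. by split=> [c x y|]; [rewrite mulr0 addr0|exists [::]]. Qed.

Lemma ca_in0 La : Pplus La -> ca_in CA (0 : L La -> F) = 0.
Proof.
move=> pL; have r0 := restricted_dual0 La; have := ca_in_lin CA (-1) pL r0 r0.
rewrite scaleN1r addNr => E; rewrite -[RHS]E; congr (ca_in CA _).
by apply/funext => w; rewrite mulr0 add0r.
Qed.

(** [ca_in] is known to be linear on restricted duals only, so membership there is carried through
    the induction together with the span. *)
Lemma ca_in_addspan La (X : set (L La -> F)) (Y : set CA) phi : Pplus La ->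
  X `<=` @restricted_dual F n k A alpha (L La) ->
  (forall psi, X psi -> addspan Y (ca_in CA psi)) ->
  addspan X phi -> restricted_dual phi /\ addspan Y (ca_in CA phi).
Proof.
move=> pL Xr XY; elim=> [|psi chi Xpsi _ [rchi IH]].
  by rewrite ca_in0 //; split; [exact: restricted_dual0|exact: addspan0].
split; first exact: restricted_dualD (Xr _ Xpsi) rchi.
have := ca_in_lin CA 1 pL (Xr _ Xpsi) rchi; rewrite scale1r => E.
rewrite (_ : psi + chi = fun w => 1 * psi w + chi w); last first.
  by apply/funext => w; rewrite mul1r.
by rewrite E; apply: addspan_add => //; exact: XY.
Qed.

(** A restricted form is a sum of weight forms and each weight form a sum of products; [ca_in]
    carries both sums to the algebra. *)
Lemma ca_comp_products La N (x : CA) : Pplus La -> Pplus N -> ga_comp (La + N) x ->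
  addspan [set z : CA | exists y y', [/\ ga_comp La y, ga_comp N y' & z = y * y']] x.
Proof.
move=> pL pN; have pLN : Pplus (La + N).
  by have := ga_degD (g := CA) (La := La) (N := N); rewrite ca_deg; apply.
rewrite ca_comp // => -[phi rphi <-].
have [_ alpha_free] := alphaP.
have hL := LP pL; have hN := LP pN; have hLN := LP pLN.
have sphi := restricted_dual_hdual charF hLN rphi.
apply: (ca_in_addspan pLN _ _ sphi).2 => [psi [mu]|psi [mu hpsi]].
  exact: hdual_restricted.
have spsi := hdual_coprods charF alpha_free hLN hL hN (ca_Phi_hom CA pL pN)
  (ca_Phi_hw CA pL pN) hpsi.
apply: (ca_in_addspan pLN _ _ spsi).2 => chi [la [la' [p [q [hp hq ->]]]]].
  by apply: (hdual_restricted charF); exact: (coprod_hdual (ca_Phi_hom CA pL pN) hp hq).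
apply: sub_addspan; exists (ca_in CA p), (ca_in CA q).
have rp := hdual_restricted charF hp; have rq := hdual_restricted charF hq.
split; first by rewrite ca_comp //; exists p.
  by rewrite ca_comp //; exists q.
by rewrite ca_mul.
Qed.

(** * Affine neighbourhoods of the points of a stratum *)

Context (J : {set 'I_n}).
Local Notation S := (face_subalg (ca_face CA J)).

Lemma face_Pplus La : face J La -> @Pplus n k La.
Proof. by move=> [z p] i; have [/z->|/p] := boolP (i \in J). Qed.

(** As [m * Lb - N] lies in the face for large [m] and products span, [b ^ m] is
    a sum of products with one factor of degree [m * Lb - N]. *)
Lemma face_relevant (b : S) Lb : ga_deg S Lb -> ga_comp Lb b ->
  (forall i, i \notin J -> 0 < at_coroot Lb i) ->
  forall (Q : proj S) N, ~ (Q : set S) b -> ga_deg S N ->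
  exists m N' y, [/\ ga_deg S N', ga_comp N' y, ~ (Q : set S) y & N + N' = Lb *+ m].
Proof.
move=> dLb cb Lbpos Q N Qb [dN fN]; have [_ fLb] := dLb.
(* [m] bounds every [N(h_i)], and [Lb(h_i)] is at least 1 for [i] not in [J], so [m Lb - N] is
   nonnegative there; on [J] both terms vanish. *)
pose m := (\sum_i `|at_coroot N i|)%N; pose N' := Lb *+ m - N.
have at' i : at_coroot N' i = at_coroot Lb i *+ m - at_coroot N i.
  by rewrite /at_coroot !mxE mulmxnE.
have fN' : face J N'.
  split=> i iJ; rewrite at'.
    by rewrite (fLb.1 i iJ) (fN.1 i iJ) mul0rn subr0.
  rewrite subr_ge0; apply: (@le_trans _ _ (m%:Z)); last first.
    by rewrite -mulr_natr -[Posz m]natz ler_peMl // -gtz0_ge1; exact: Lbpos.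
  apply: le_trans (ler_norm _) _; rewrite -abszE lez_nat /m (bigD1 i) //=.
  exact: leq_addr.
have pN := face_Pplus fN; have pN' := face_Pplus fN'.
have E : N + N' = Lb *+ m by rewrite addrC subrK.
have dN' : ga_deg S N' by split=> //; rewrite ca_deg.
exists m, N'; apply: contrapT => nex.
have QN' (y : S) : ga_comp N' y -> (Q : set S) y.
  by move=> cy; apply: contrapT => nQ; apply: nex; exists y.
apply: (@ptX _ _ _ Q b m Qb).
(* Products are known to span in [CA], so the argument passes to the extension of [Q]; the factor of
   degree [N'] lies in [S], hence in [Q]. *)
suff : (face_ext Q : set CA) (\val (b ^+ m)) by exact: face_ext_val.
have cbm : ga_comp (N + N') (\val (b ^+ m) : CA).
  by rewrite E; exact: (ga_compX dLb cb m).
elim: (ca_comp_products pN pN' cbm) => [|_ z [y [y' [cy cy' ->]]] _ IH]; first exact: pt0.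
apply: ptD => //; apply/ptM; right.
have y'S : y' \in fsub_pred (ca_face CA J).
  by apply/fsub_predP/sub_addspan; exists N'; split=> //; rewrite ca_deg.
exact: (face_ext_sub (QN' (FSub y'S) cy')).
Qed.

Lemma Or_nonvanishing (Q : proj CA) (s : seq 'I_n) : Or CA J Q ->
  (forall i, i \in s -> i \notin J) ->
  exists (b : CA) Lb, [/\ ga_deg CA Lb, face J Lb, ga_comp Lb b, ~ (Q : set CA) b &
    forall i, i \in s -> 0 < at_coroot Lb i].
Proof.
move=> [QJ QK]; elim: s => [|i s IH] sJ.
  exists 1, 0; split=> //; [exact: ga_deg0|exact: face0|exact: ga_comp1|exact: pt1].
have [|b [Lb [dLb fLb cb Qb Lbs]]] := IH.
  by move=> j js; apply: sJ; rewrite inE js orbT.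
have iJ : i \notin J by apply: sJ; rewrite inE eqxx.
(* The set [K] obtained by adding [i] to [J] suffices: [Q] misses an element of degree outside the
   face of [K]. Since [Q] lies in the closure for [J], this degree is in the face of [J], and is
   therefore positive on [h_i]. *)
have [r [La [dLa nfLa cr]] Qr] : exists2 r : CA,
    homog_in (~` (ca_face CA (i |: J) : set _)) r & ~ (Q : set CA) r.
  apply: contrapT => nex; apply: QK; exists (i |: J).
    rewrite /= finset.properEneq finset.subsetUr andbT.
    by apply: contra iJ => /eqP->; rewrite finset.setU11.
  apply: addspan_sub => [|x y|x hx]; [exact: pt0|exact: ptD|].
  by apply: contrapT => nQ; apply: nex; exists x.
have pLa : Pplus La by rewrite -(ca_deg CA).
have fLa : face J La.
  apply: contrapT => nf; apply/Qr/QJ/sub_addspan; by exists La.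
have Lai : 0 < at_coroot La i.
  rewrite lt_neqAle pLa andbT; apply/negP => /eqP Lai; apply: nfLa.
  split=> j; rewrite !inE; last by rewrite negb_or => /andP[_]; exact: fLa.2.
  by case/orP => [/eqP->//|]; exact: fLa.1.
have atD j : at_coroot (La + Lb) j = at_coroot La j + at_coroot Lb j.
  by rewrite /at_coroot mxE.
exists (r * b), (La + Lb); split.
- exact: ga_degD.
- exact: (faceD dLa dLb fLa fLb).
- exact: ga_compM.
- by move=> /ptM[].
move=> j; rewrite inE atD => /orP[/eqP->|js].
  by apply: ltr_pwDl => //; exact: (face_Pplus fLb).
by apply: ltr_wpDl; [exact: pLa|exact: Lbs].
Qed.

Lemma Or_space_is_scheme : is_scheme (Or_space CA J).
Proof.
split; first exact: open_face_locally_ringed.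
move=> x; have Ox : Or CA J (set_val (set_val x)) := set_valP x.
have [i|b [Lb [dLb fLb cb Qb Lbpos]]] := @Or_nonvanishing _ (enum (~: J)) Ox.
  by rewrite mem_enum inE.
have bS : b \in fsub_pred (ca_face CA J).
  by apply/fsub_predP/sub_addspan; exists Lb.
pose b' : S := FSub bS; have dLb' : ga_deg S Lb by [].
have cb' : ga_comp Lb b' by [].
have Lbpos' i : i \notin J -> 0 < at_coroot Lb i.
  by move=> iJ; apply: Lbpos; rewrite mem_enum inE.
(* If [K] properly contains [J], then [Lb] is positive on some [h_i] with [i] in [K] and so lies
   outside the face of [K]; a point of the closure for [K] would contain [b]. *)
have bO (Q : proj S) : ~ (Q : set S) b' ->
    ((Opens (@Or_open _ _ _ _ _ _ _ CA J)) : set (Orbar_space CA J)) (face_homeo Q).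
  move=> Qb'; split; first exact: (set_valP (face_homeo Q)).
  move=> [K /= /properP[_ [i iK iJ]] KQ]; apply: Qb'; apply: face_ext_val; apply: KQ.
  apply: sub_addspan; exists Lb; split=> // -[z _].
  by have := Lbpos' i iJ; rewrite z // ltxx.
pose Q0 := face_contr (ca_face CA J) (set_val (set_val x)).
have Q0b : ~ (Q0 : set S) b' by [].
have hprimeS : forall Q : set S, is_hideal Q -> ~ Q 1 ->
    (forall y z, homog y -> homog z -> Q (y * z) -> Q y \/ Q z) -> is_hprime Q.
  move=> Q; apply: (@hprime_homog _ _ S (@lex_pos _)).
  - exact: lex_posD.
  - exact: lex_pos0.
  - exact: lex_pos_total.
exists (face_chart_dom (Opens (@Or_open _ _ _ _ _ _ _ CA J)) dLb' cb'); split=> //.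
exists (@frac_comalg F P S [set Q : proj S | ~ (Q : set S) b'] Q0 Q0b).
split; exact: (face_chart_iso dLb' cb' Q0b hprimeS (face_relevant dLb' cb' Lbpos') bO).
Qed.
End CartanProducts.

Theorem corollary3p36 (F : fieldType) (charF : [pchar F] =i pred0)
  (n l : nat) (A : 'M[int]_n)
  (gcmA : is_gcm A) (symA : symmetrizable A)
  (rankA : \rank (map_mx intr A : 'M[rat]_n) = l)
  (alpha : 'I_n -> 'rV[int]_(n + (n - l)))
  (alphaP : is_simple_roots A alpha)
  (L : 'rV[int]_(n + (n - l)) -> lie_module (kac_moody F A alpha))
  (v : forall La, L La)
  (LP : forall La, Pplus La -> is_irr_hw La (v La))
  (CA : cartan_algebra v)
  (J : {set 'I_n}) :
  is_scheme (Or_space CA J).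
Proof. exact: Or_space_is_scheme. Qed.
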